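(* Let $\theta>0$, let $f$ be a transcendental entire function (real on the real line) of finite order $\le\theta$, let $a_1<b_1$ be fixed reals, let $\lambda\ge1$ be a constant, and let $\nu>\frac{2\lambda\theta}{3\psi(\lambda)}$ be a real number. Then the method succeeds over $[a_1,b_1]$ (in the sense made precise in the context, with a single call to Algorithm 2) for positive integers $u,v$ with $uv\to\infty$ as soon as $$d=\nu\,\frac{\log(uv)}{\log\log(uv)}\,(1+o(1))$$ and $$|b_2-a_2|=(uv)^{-\frac{\nu^2}{2\theta\lambda}\,\frac{\log(uv)}{\log\log(uv)}\,(1+o(1))},$$ where $a_2<b_2$ are bounded reals.
   Context: **Order.** An entire function $f$ has finite order $\le\theta$ if $\limsup_{\rho\to+\infty}\frac{\log\log\max_{|z|=\rho}|f(z)|}{\log\rho}\le\theta$. **The function $\psi$.** Let $\varphi:[1,\infty)\to[1,\infty)$, $\varphi(x)=(1+\lfloor x\rfloor)(x-\lfloor x\rfloor/2)$, which is a bijection, and for $\lambda\ge 1$ $$\psi(\lambda)=\frac{1+\lfloor\varphi^{-1}(\lambda)\rfloor}{12\lambda}\left(6\varphi^{-1}(\lambda)^2-\lfloor\varphi^{-1}(\lambda)\rfloor-2\lfloor\varphi^{-1}(\lambda)\rfloor^2\right).$$ **Notation.** $T_n$ is the $n$-th Chebyshev polynomial of the first kind, $T_{n,[a,b]}(x)=T_n\left(\frac{2x-b-a}{b-a}\right)$. The $n$ Chebyshev nodes of $[a,b]$ are the zeros of $T_{n,[a,b]}$. For $\rho>1$, $E_{\rho,a,b}\subset\mathbb C$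 is the compact region bounded by the ellipse $\left\{\frac{b-a}{2}\cdot\frac{\rho e^{i\theta}+\rho^{-1}e^{-i\theta}}{2}+\frac{a+b}{2}:\theta\in[0,2\pi]\right\}$. **Algorithm 2.** Input: reals $a_1<b_1$, $a_2<b_2$; $f$ analytic in a neighborhood of $E_{\rho_1,a_1,b_1}$; positive integers $d,N_1,N_2,u,v$; reals $\rho_1,\rho_2\ge2$; with $N_1,N_2\ge 2$, $N_1N_2\ge N=(d+1)(d+2)/2$ and $64(\rho_1^{-N_1}+\rho_2^{-N_2})\,v\max_{z_1\in E_{\rho_1,a_1,b_1},z_2\in E_{\rho_2,a_2,b_2}}|f(z_1)+z_2|<1$. 1. Let $(f_i)_{0\le i\le N-1}$ be the list of the functions $(ux)^k(v(f(x)+t))^\ell$, $0\le k+\ell\le d$. For each $i=(k,\ell)$, compute the coefficients, in the basis $T_{k_1,[a_1,b_1]}(x)T_{k_2,[a_2,b_2]}(t)$, $0\le k_1<N_1$, $0\le k_2<N_2$, of the polynomial of degree $<N_1$ in $x$ and $<N_2$ in $t$ interpolating $f_i$ at all pairs (Chebyshev node of order $N_1$ of $[a_1,b_1]$, Chebyshev node of order $N_2$ of $[a_2,b_2]$). They form row $i$ of an $N\times N_1N_2$ matrix $A_1$. Let $A_2$ be the $N\times N$ diagonal matrix with entries $R_i=64\,u^kv^\ell\big(\max_{z\in E_{\rho_1,a_1,b_1}}|z|\big)^k\big(\max_{z_1\in E_{\rho_1,a_1,b_1},z_2\in E_{\rho_2,a_2,b_2}}|f(z_1)+z_2|\big)^\ell(\rho_1^{-N_1}+\rho_2^{-N_2})$.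 Let $\mathsf{tprec}=\lceil-\log_2(\min_iR_i)+\log_2N\rceil+2$, and let $M$ be the integer $N\times(N_1N_2+N)$ matrix obtained from $2^{\mathsf{tprec}}(A_1|A_2)$ by rounding every entry toward $0$. 2. Apply the LLL algorithm to the rows of $M$, obtaining $UM$ with $U$ unimodular. If the first two rows of $UM$ do not both have Euclidean norm at most $2^{\mathsf{tprec}}/(N+N_1N_2)$, return FAIL. 3. Otherwise let $P_0,P_1\in\mathbb Z[X_1,X_2]$ be the polynomials $\sum_{i=(k,\ell)}U[r,i]X_1^kX_2^\ell$, $r=0,1$. Let $R(X_1)=\mathrm{Res}_{X_2}(P_0,P_1)$. If $R\ne 0$ return $\mathcal L=\{t\in\mathbb Z:R(t)=0\}$; otherwise return FAIL. **''The method succeeds over $[a_1,b_1]$''** means: with $N=(d+1)(d+2)/2$, $\gamma=N/\lambda$, $N_1=\lfloor\sqrt{2\gamma N}\rfloor$, $N_2=\lceil\sqrt{2N/\gamma}\,\rceil$, a suitable $\rho_1\ge 2$ and $\rho_2=\rho_1^\gamma$, for $uv$ large enough, Algorithm 2 on $[a_1,b_1]$, $[a_2,b_2]$ passes the test of step 2 and produces $P_0,P_1$ with $|P_r(ux,v(f(x)+t))|<1$ for all $x\in[a_1,b_1]$, $t\in[a_2,b_2]$, $r=0,1$. (Consequently, if $P_0,P_1$ have no nonconstant common factor, it returns a list containing every integer $X$ with $X/u\in[a_1,b_1]$ for which some $Y\in\mathbb Z$ satisfies $Y/v-f(X/u)\in[a_2,b_2]$.) *)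

(* Defs.v *)
From HB Require Import structures.
From mathcomp Require Import all_boot all_order all_algebra.
From mathcomp Require Import all_classical all_reals all_analysis.
From mathcomp Require Import complex.

Set Implicit Arguments.
Unset Strict Implicit.
Unset Printing Implicit Defensive.

Import Order.TTheory GRing.Theory Num.Theory.
Import numFieldNormedType.Exports.

Local Open Scope classical_set_scope.
Local Open Scope ring_scope.
Local Open Scope complex_scope.

(** * Entire functions *)

Definition holo_at (R : realType) (f : R[i] -> R[i]) (z : R[i]) : Prop :=
  derivable (f : R[i]^o -> R[i]^o) z 1.

Definition entire (R : realType) (f : R[i] -> R[i]) : Prop :=
  forall z, holo_at f z.

Definition transcendental (R : realType) (f : R[i] -> R[i]) : Prop :=
  forall P : {poly {poly R[i]}}, (forall z, P.[z, f z] = 0) -> P = 0.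

Definition real_on_reals (R : realType) (f : R[i] -> R[i]) : Prop :=
  forall x : R, complex.Im (f x%:C) = 0.

(* The sets below are compact and the functions continuous, so that these
   suprema are maxima. *)
Definition max_norm (R : realType) (E : set R[i]) (f : R[i] -> R[i]) : R :=
  sup [set Normc.normc (f z) | z in E].

Definition max_norm_add (R : realType) (E1 E2 : set R[i]) (f : R[i] -> R[i]) :
    R :=
  sup [set Normc.normc (f z1 + z2) | z1 in E1 & z2 in E2].

Definition circle (R : realType) (rho : R) : set R[i] :=
  [set z | Normc.normc z = rho].

(* [ln] is 0 on nonpositive arguments; for a nonconstant entire function the
   maximum tends to infinity, so this does not affect the limsup. *)
Definition order_le (R : realType) (f : R[i] -> R[i]) (theta : R) : Prop :=
  (limf_esup (fun rho : R => (ln (ln (max_norm (circle rho) f)) / ln rho)%:E)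
     (pinfty_nbhs R) <= theta%:E)%E.

(** * The functions phi and psi *)

Definition floorR (R : realType) (x : R) : R := (Num.floor x)%:~R.

Definition phi (R : realType) (x : R) : R :=
  (1 + floorR x) * (x - floorR x / 2).

Definition phi_inv (R : realType) (y : R) : R :=
  xget 1 [set x | 1 <= x /\ phi x = y].

Definition psi (R : realType) (lambda : R) : R :=
  let x := phi_inv lambda in
  (1 + floorR x) / (12 * lambda)
  * (6 * x ^+ 2 - floorR x - 2 * floorR x ^+ 2).

(** * Chebyshev polynomials and interpolation *)

Fixpoint chebyshev_poly (R : realType) (n : nat) : {poly R} :=
  match n with
  | 0%N => 1
  | 1%N => 'X
  | (m.+1 as k).+1 => 2%:R *: ('X * chebyshev_poly R k) - chebyshev_poly R m
  end.

Definition chebyshev_on (R : realType) (n : nat) (a b : R) : {poly R} :=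
  chebyshev_poly R n \Po ((b - a)^-1 *: (2%:R *: 'X - (b + a)%:P)).

Definition chebyshev_interpolates (R : realType) (N1 N2 : nat)
    (a1 b1 a2 b2 : R) (g : R -> R -> R) (C : 'M[R]_(N1, N2)) : Prop :=
  forall x t : R,
    root (chebyshev_on N1 a1 b1) x -> root (chebyshev_on N2 a2 b2) t ->
    \sum_(k1 < N1) \sum_(k2 < N2)
      C k1 k2 * ((chebyshev_on k1 a1 b1).[x] * (chebyshev_on k2 a2 b2).[t])
    = g x t.

Definition chebyshev_coefs (R : realType) (N1 N2 : nat) (a1 b1 a2 b2 : R)
    (g : R -> R -> R) : 'M[R]_(N1, N2) :=
  xget 0 [set C | chebyshev_interpolates a1 b1 a2 b2 g C].

(* The region bounded by the ellipse is filled by the segments joining the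
   points of the ellipse to its center. *)
Definition expi (R : realType) (t : R) : R[i] := cos t +i* sin t.

Definition ellipse_region (R : realType) (rho a b : R) : set R[i] :=
  [set s%:C * (((b - a) / 2)%:C
               * ((rho%:C * expi t + (rho^-1)%:C * expi (- t)) / 2%:R))
       + ((a + b) / 2)%:C
  | s in `[0 : R, 1] & t in `[0 : R, 2 * pi]].

(** * LLL reduction *)

Definition dot (F : pzRingType) (n : nat) (x y : 'rV[F]_n) : F :=
  \sum_j x 0 j * y 0 j.

Definition gram_schmidt (n m : nat) (B Bs : 'M[rat]_(n, m)) (mu : 'M[rat]_n) :
    Prop :=
  [/\ forall i j : 'I_n, (i < j)%N -> mu i j = 0,
      forall i, mu i i = 1,
      forall i j, i != j -> dot (row i Bs) (row j Bs) = 0,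
      forall i, row i Bs != 0
    & B = mu *m Bs].

Definition lll_reduced (n m : nat) (B : 'M[int]_(n, m)) : Prop :=
  exists (Bs : 'M[rat]_(n, m)) (mu : 'M[rat]_n),
  [/\ gram_schmidt (map_mx intr B) Bs mu,
      forall i j : 'I_n, (j < i)%N -> `|mu i j| <= 1 / 2
    & forall i j : 'I_n, j.+1 = i :> nat ->
        3 / 4 * dot (row j Bs) (row j Bs)
        <= dot (row i Bs + mu i j *: row j Bs) (row i Bs + mu i j *: row j Bs)].

(* The contract of the LLL algorithm (with the parameter 3/4): it outputs some
   LLL-reduced basis of the lattice spanned by the rows of [M]. *)
Definition lll_output (n m : nat) (M : 'M[int]_(n, m)) (U : 'M[int]_n) : Prop :=
  U \in unitmx /\ lll_reduced (U *m M).

(** * Algorithm 2 *)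

Record alg2_input (R : realType) := Alg2Input {
  in_a1 : R; in_b1 : R; in_a2 : R; in_b2 : R;
  in_d : nat; in_N1 : nat; in_N2 : nat; in_u : nat; in_v : nat;
  in_rho1 : R; in_rho2 : R
}.

Definition nb_monomials (d : nat) : nat := (d.+1 * d.+2)./2.

Definition in_N (R : realType) (I : alg2_input R) : nat := nb_monomials (in_d I).

Definition in_E1 (R : realType) (I : alg2_input R) : set R[i] :=
  ellipse_region (in_rho1 I) (in_a1 I) (in_b1 I).

Definition in_E2 (R : realType) (I : alg2_input R) : set R[i] :=
  ellipse_region (in_rho2 I) (in_a2 I) (in_b2 I).

Definition decay (R : realType) (I : alg2_input R) : R :=
  in_rho1 I ^- in_N1 I + in_rho2 I ^- in_N2 I.

Definition alg2_valid (R : realType) (f : R[i] -> R[i]) (I : alg2_input R) :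
    Prop :=
  [/\ [/\ in_a1 I < in_b1 I, in_a2 I < in_b2 I
        & forall z : R[i]^o, in_E1 I z -> \forall w \near z, holo_at f w],
      [/\ (0 < in_d I)%N, (0 < in_u I)%N & (0 < in_v I)%N],
      [/\ (2 <= in_N1 I)%N, (2 <= in_N2 I)%N
        & (in_N I <= in_N1 I * in_N2 I)%N],
      2 <= in_rho1 I /\ 2 <= in_rho2 I
    & 64 * decay I * (in_v I)%:R * max_norm_add (in_E1 I) (in_E2 I) f < 1].

(* The pairs (k, l) with k + l <= d, listed in an arbitrary order. *)
Definition monomial_listing (d : nat)
    (e : 'I_(nb_monomials d) -> nat * nat) : Prop :=
  injective e /\
  forall k l : nat, (k + l <= d)%N <-> exists i, e i = (k, l).

Definition real_part_on (R : realType) (f : R[i] -> R[i]) (x : R) : R :=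
  complex.Re (f x%:C).

Definition monomial_fun (R : realType) (f : R[i] -> R[i]) (u v : nat)
    (kl : nat * nat) (x t : R) : R :=
  (u%:R * x) ^+ kl.1 * (v%:R * (real_part_on f x + t)) ^+ kl.2.

Definition alg2_A1 (R : realType) (f : R[i] -> R[i]) (I : alg2_input R)
    (e : 'I_(in_N I) -> nat * nat) : 'M[R]_(in_N I, in_N1 I * in_N2 I) :=
  \matrix_(i < in_N I)
    mxvec (chebyshev_coefs (in_N1 I) (in_N2 I)
             (in_a1 I) (in_b1 I) (in_a2 I) (in_b2 I)
             (monomial_fun f (in_u I) (in_v I) (e i))).

Definition alg2_R (R : realType) (f : R[i] -> R[i]) (I : alg2_input R)
    (kl : nat * nat) : R :=
  64 * (in_u I)%:R ^+ kl.1 * (in_v I)%:R ^+ kl.2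
  * max_norm (in_E1 I) id ^+ kl.1
  * max_norm_add (in_E1 I) (in_E2 I) f ^+ kl.2
  * decay I.

Definition alg2_A2 (R : realType) (f : R[i] -> R[i]) (I : alg2_input R)
    (e : 'I_(in_N I) -> nat * nat) : 'M[R]_(in_N I) :=
  diag_mx (\row_i alg2_R f I (e i)).

Definition log2 (R : realType) (x : R) : R := ln x / ln 2.

Definition alg2_tprec (R : realType) (f : R[i] -> R[i]) (I : alg2_input R)
    (e : 'I_(in_N I) -> nat * nat) : int :=
  Num.ceil (- log2 (inf (range (fun i => alg2_R f I (e i))))
            + log2 (in_N I)%:R) + 2.

Definition round_to_zero (R : realType) (x : R) : int :=
  if 0 <= x then Num.floor x else Num.ceil x.

Definition alg2_M (R : realType) (f : R[i] -> R[i]) (I : alg2_input R)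
    (e : 'I_(in_N I) -> nat * nat) :
    'M[int]_(in_N I, in_N1 I * in_N2 I + in_N I) :=
  map_mx (@round_to_zero R)
    ((2 : R) ^ alg2_tprec f e *: row_mx (alg2_A1 f e) (alg2_A2 f e)).

Definition row_norm (R : realType) (n m : nat) (A : 'M[int]_(n, m)) (i : 'I_n) :
    R :=
  Num.sqrt (\sum_j ((A i j)%:~R) ^+ 2).

(* 'X stands for X_1 and 'Y for X_2. *)
Definition alg2_P (d : nat) (e : 'I_(nb_monomials d) -> nat * nat)
    (U : 'M[int]_(nb_monomials d)) (r : 'I_(nb_monomials d)) :
    {poly {poly int}} :=
  \sum_i (U r i)%:~R * 'X ^+ (e i).1 * 'Y ^+ (e i).2.

Definition eval2 (R : realType) (P : {poly {poly int}}) (x y : R) : R :=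
  (map_poly (map_poly (intr : int -> R)) P).[x, y].

(* The last condition is required of every possible output of LLL; the
   condition before it says that there is one. *)
Definition alg2_succeeds (R : realType) (f : R[i] -> R[i]) (I : alg2_input R) :
    Prop :=
  alg2_valid f I /\
  forall e : 'I_(in_N I) -> nat * nat, monomial_listing e ->
    let M := alg2_M f e in
    (exists U, lll_output M U) /\
    forall U, lll_output M U ->
    forall r : 'I_(in_N I), (r < 2)%N ->
      row_norm R (U *m M) r
        <= 2 ^ alg2_tprec f e / (in_N I + in_N1 I * in_N2 I)%:R
      /\
      forall x t : R, x \in `[in_a1 I, in_b1 I] -> t \in `[in_a2 I, in_b2 I] ->
        `| eval2 (alg2_P e U r) ((in_u I)%:R * x)
             ((in_v I)%:R * (real_part_on f x + t)) | < 1.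

Definition method_input (R : realType) (lambda a1 b1 a2 b2 : R) (d u v : nat)
    (rho1 : R) : alg2_input R :=
  let N : R := (nb_monomials d)%:R in
  let gamma := N / lambda in
  {| in_a1 := a1; in_b1 := b1; in_a2 := a2; in_b2 := b2;
     in_d := d;
     in_N1 := `|Num.floor (Num.sqrt (2 * gamma * N))|%N;
     in_N2 := `|Num.ceil (Num.sqrt (2 * N / gamma))|%N;
     in_u := u; in_v := v;
     in_rho1 := rho1; in_rho2 := rho1 `^ gamma |}.

Definition method_succeeds (R : realType) (f : R[i] -> R[i])
    (lambda a1 b1 a2 b2 : R) (d u v : nat) : Prop :=
  exists rho1 : R, 2 <= rho1 /\
    alg2_succeeds f (method_input lambda a1 b1 a2 b2 d u v rho1).

(* Main.v *)
(** Let [L = ln (uv)] and take [rho1 = L ^ (sg / theta)] with [sg < 1] close to 1, so that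
    the growth of [f] keeps [ln |f|] below [L ^ tau], [tau < 1], on the ellipse.

    An entire function is, by Cauchy's formula on a large square, a locally uniform limit of
    polynomials; for polynomials the Chebyshev coefficients of an interpolant are averages
    over roots of unity, which bounds the entries of [A1] by
    [u^k v^l X^k F^l rho1^(-k1) rho2^(-k2)] up to a constant, and the interpolation error by
    [R_i].  The first two vectors of an LLL-reduced basis are bounded through
    [det (M M^T)].  Expanding this Gram determinant over choices of [N] distinct columns, a
    choice contributes at most [rho1] to the power minus twice the sum of the weights
    [k1 + gamma k2] of its columns.  The least such sum is [N^2 psi(lambda) / lambda - O(N)],
    while the sum of the logarithms of the monomial sizes is [(N d / 3) (L + o(L))];
    comparing the two, with [N ~ d^2 / 2], gives exactly the condition on [nu].  The
    condition on [b2 - a2] keeps the second ellipse bounded. *)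

Require Import Defs.
From HB Require Import structures.
From mathcomp Require Import all_boot all_order all_algebra.
From mathcomp Require Import all_classical all_reals all_analysis.
From mathcomp Require Import complex perm.
From mathcomp Require Import zify ring lra.
Import Order.TTheory GRing.Theory Num.Theory.
Import numFieldNormedType.Exports.
Local Open Scope classical_set_scope.
Local Open Scope ring_scope.
Local Open Scope complex_scope.

Set Implicit Arguments.
Unset Strict Implicit.
Unset Printing Implicit Defensive.

(** * Goursat and polynomial approximation of entire functions *)

(** Holomorphy is given only as pointwise complex derivability, so Cauchy's formula has to start
    from Goursat's theorem. Squares make contour integrals into real integrals over segments.
    Interpolation coefficients and errors at fixed sizes are finite combinations of values, hence
    continuous for the sup norm on a disc; estimates for polynomials with constants free of the
    degree therefore pass to the limit.

    The weight bound is a duality argument: for any threshold [tau], [n] distinct columns weigh at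
    least [n * tau] minus the total deficit below [tau]. About [gamma * phi x] columns lie below
    [x * gamma], so [x = phi_inv lambda] is the threshold with about [N] columns below it, and [psi]
    comes out of its deficits.

    Two lower bounds are essential. The precision depends on the least [R_i], which a small [f + t]
    would make tiny; two points where [f] differs exclude this uniformly in [t]. *)

Section ComplexModulus.
Variable R : realType.
Local Notation C := R[i].
Local Notation nc := (@Normc.normc R).

Lemma nc_ge0 (z : C) : 0 <= nc z.
Proof. by case: z => a b /=; apply: sqrtr_ge0. Qed.

Lemma ncR (x : R) : nc x%:C = `|x|.
Proof. by rewrite /= expr0n /= addr0 sqrtr_sqr. Qed.

Lemma ncB (z w : C) : nc (z - w) = nc (w - z).
Proof. by rewrite -normcN opprB. Qed.

Lemma ncX (z : C) n : nc (z ^+ n) = nc z ^+ n.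
Proof.
elim: n => [|n IH]; first by rewrite !expr0 Normc.normc1.
by rewrite !exprS Normc.normcM IH.
Qed.

Lemma nc_eq0 (z : C) : (nc z == 0) = (z == 0).
Proof.
by apply/eqP/eqP => [/Normc.eq0_normc //|->]; rewrite Normc.normc0.
Qed.

Lemma nc_gt0 (z : C) : (0 < nc z) = (z != 0).
Proof. by rewrite lt_def nc_ge0 andbT nc_eq0. Qed.

Lemma nc_Re (z : C) : `|complex.Re z| <= nc z.
Proof.
case: z => a b /=; rewrite -sqrtr_sqr ler_wsqrtr // lerDl; exact: sqr_ge0.
Qed.

Lemma nc_Im (z : C) : `|complex.Im z| <= nc z.
Proof.
case: z => a b /=; rewrite -sqrtr_sqr ler_wsqrtr // lerDr; exact: sqr_ge0.
Qed.

Lemma nc_le_ReIm (z : C) : nc z <= `|complex.Re z| + `|complex.Im z|.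
Proof.
case: z => a b /=; rewrite -[leRHS]ger0_norm ?addr_ge0 //.
rewrite -sqrtr_sqr ler_wsqrtr //.
have -> : a ^+ 2 + b ^+ 2 = `|a| ^+ 2 + `|b| ^+ 2 by rewrite !real_normK ?num_real.
have := mulr_ge0 (normr_ge0 a) (normr_ge0 b); nra.
Qed.

Lemma nci : nc ('i)%C = 1.
Proof. by rewrite /= expr0n /= add0r expr1n sqrtr1. Qed.

Lemma nc_triangle (z w : C) : nc z <= nc w + nc (z - w).
Proof. by have := le_normcD w (z - w); rewrite addrC subrK. Qed.

Lemma nc_sum (I : Type) (r : seq I) (P : pred I) (F : I -> C) :
  nc (\sum_(i <- r | P i) F i) <= \sum_(i <- r | P i) nc (F i).
Proof.
elim/big_rec2 : _ => [|i x y _ h]; first by rewrite Normc.normc0.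
by apply: le_trans (le_normcD _ _) _; rewrite lerD2l.
Qed.

Lemma ReD (z w : C) : complex.Re (z + w) = complex.Re z + complex.Re w.
Proof. by case: z w => ? ? [? ?]. Qed.
Lemma ImD (z w : C) : complex.Im (z + w) = complex.Im z + complex.Im w.
Proof. by case: z w => ? ? [? ?]. Qed.
Lemma ReN (z : C) : complex.Re (- z) = - complex.Re z.
Proof. by case: z => ? ?. Qed.
Lemma ImN (z : C) : complex.Im (- z) = - complex.Im z.
Proof. by case: z => ? ?. Qed.
Lemma ReM (z w : C) :
  complex.Re (z * w) = complex.Re z * complex.Re w - complex.Im z * complex.Im w.
Proof. by case: z w => ? ? [? ?]. Qed.
Lemma ImM (z w : C) :
  complex.Im (z * w) = complex.Re z * complex.Im w + complex.Im z * complex.Re w.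
Proof. by case: z w => ? ? [? ?]. Qed.

Lemma complex_ext (z w : C) :
  complex.Re z = complex.Re w -> complex.Im z = complex.Im w -> z = w.
Proof. by case: z w => ? ? [? ?] /= -> ->. Qed.

End ComplexModulus.

(** * Integrals of complex functions over real segments *)

Section ComplexIntegral.
Variable R : realType.
Local Notation C := R[i].
Local Notation nc := (@Normc.normc R).
Local Notation mu := (@lebesgue_measure R).
Implicit Types (g h : R -> C) (a b c : R).

Definition ccont g : Prop :=
  continuous (fun x => complex.Re (g x)) /\ continuous (fun x => complex.Im (g x)).

Definition cint g a b : C :=
  (\int[mu]_(x in `[a, b]) complex.Re (g x)) +i*
  (\int[mu]_(x in `[a, b]) complex.Im (g x)).

Lemma ccont_eps g :
  (forall x e, 0 < e -> exists2 d, 0 < d &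
     forall y, `|y - x| < d -> nc (g y - g x) < e) -> ccont g.
Proof.
move=> H; split=> x; apply/cvgrPdist_lt => e e0; have [d d0 hd] := H x e e0;
  near=> y; rewrite distrC.
- rewrite -ReN -ReD; apply: le_lt_trans (nc_Re _) _; apply: hd.
  rewrite distrC; near: y; apply/nbhs_ballP; exists d => // z.
- rewrite -ImN -ImD; apply: le_lt_trans (nc_Im _) _; apply: hd.
  rewrite distrC; near: y; apply/nbhs_ballP; exists d => // z.
Unshelve. all: by end_near. Qed.

Lemma ccontD g h : ccont g -> ccont h -> ccont (fun x => g x + h x).
Proof.
move=> [g1 g2] [h1 h2]; split=> x.
  under [fun x => _]eq_fun do rewrite ReD; apply: cvgD; [exact: g1|exact: h1].
under [fun x => _]eq_fun do rewrite ImD; apply: cvgD; [exact: g2|exact: h2].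
Qed.

Lemma ccontM g h : ccont g -> ccont h -> ccont (fun x => g x * h x).
Proof.
move=> [g1 g2] [h1 h2]; split=> x.
  under [fun x => _]eq_fun do rewrite ReM.
  by apply: cvgB; apply: cvgM; [exact: g1|exact: h1|exact: g2|exact: h2].
under [fun x => _]eq_fun do rewrite ImM.
by apply: cvgD; apply: cvgM; [exact: g1|exact: h2|exact: g2|exact: h1].
Qed.

Lemma ccont_cst (z : C) : ccont (fun=> z).
Proof. by split=> x; exact: cvg_cst. Qed.

Lemma ccontN g : ccont g -> ccont (fun x => - g x).
Proof.
move=> hg; have := ccontM (ccont_cst (-1)) hg.
by under [X in ccont X -> _]eq_fun do rewrite mulN1r.
Qed.

Lemma cts_integrable (f : R -> R) a b :
  continuous f -> mu.-integrable `[a, b] (EFin \o f).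
Proof.
move=> cf; apply: continuous_compact_integrable; first exact: segment_compact.
exact: continuous_subspaceT.
Qed.

Lemma cintD g h a b : ccont g -> ccont h ->
  cint (fun x => g x + h x) a b = cint g a b + cint h a b.
Proof.
move=> [g1 g2] [h1 h2]; rewrite /cint; apply: complex_ext; rewrite (ReD, ImD) /=.
  rewrite -RintegralD //; try exact: cts_integrable.
  by apply: eq_Rintegral => x _; rewrite ReD.
rewrite -RintegralD //; try exact: cts_integrable.
by apply: eq_Rintegral => x _; rewrite ImD.
Qed.

Lemma cintM (z : C) g a b : ccont g ->
  cint (fun x => z * g x) a b = z * cint g a b.
Proof.
move=> [g1 g2]; rewrite /cint; apply: complex_ext; rewrite (ReM, ImM) /=.
  rewrite -!RintegralZl //; try exact: cts_integrable.
  rewrite -RintegralB //; try by apply: cts_integrable => x; apply: cvgM;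
    [exact: cvg_cst|move: x].
  by apply: eq_Rintegral => x _; rewrite ReM.
rewrite -!RintegralZl //; try exact: cts_integrable.
rewrite -RintegralD //; try by apply: cts_integrable => x; apply: cvgM;
    [exact: cvg_cst|move: x].
by apply: eq_Rintegral => x _; rewrite ImM.
Qed.

Lemma cintN g a b : ccont g -> cint (fun x => - g x) a b = - cint g a b.
Proof.
move=> hg; rewrite -[RHS]mulN1r -cintM //; congr cint.
by apply/funext => x; rewrite mulN1r.
Qed.

Lemma cintB g h a b : ccont g -> ccont h ->
  cint (fun x => g x - h x) a b = cint g a b - cint h a b.
Proof. by move=> hg hh; rewrite cintD ?cintN //; exact: ccontN. Qed.

Lemma cint_cst (z : C) a b : a <= b -> cint (fun=> z) a b = z * (b - a)%:C.
Proof.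
move=> ab; rewrite /cint !Rintegral_cst //= lebesgue_measure_itv /= lte_fin.
move: ab; rewrite le_eqVlt => /predU1P[->|ab].
  by rewrite ltxx subrr mulr0 /= !mulr0.
by rewrite ab; apply: complex_ext; rewrite (ReM, ImM) /= !mulr0 ?subr0 ?add0r.
Qed.

Lemma RintU (f : R -> R) a c b : continuous f -> a <= c <= b ->
  \int[mu]_(x in `[a, b]) f x =
  \int[mu]_(x in `[a, c]) f x + \int[mu]_(x in `[c, b]) f x.
Proof.
move=> cf /andP[ac cb].
have := @Rintegral_itvB R f (BLeft a) (BRight b) c (cts_integrable a b cf).
rewrite !bnd_simp => /(_ ac cb) h.
rewrite -(@Rintegral_itv_obnd_cbnd R c (BRight b) f).
  by rewrite -h addrC subrK.
apply: (@integrableS _ _ _ mu `[c, b]) => //; last exact: cts_integrable.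
by apply: subset_itvr; rewrite bnd_simp.
Qed.

Lemma cint_chasles g a c b : ccont g -> a <= c <= b ->
  cint g a b = cint g a c + cint g c b.
Proof.
by move=> [g1 g2] acb; apply: complex_ext; rewrite (ReD, ImD) /=; exact: RintU.
Qed.

Lemma Rint_bound (f : R -> R) a b K : continuous f -> a <= b ->
  (forall x, a <= x <= b -> `|f x| <= K) ->
  `|\int[mu]_(x in `[a, b]) f x| <= K * (b - a).
Proof.
move=> cf ab H; apply: le_trans (le_normr_Rintegral _ (cts_integrable _ _ cf)) _ => //.
have -> : K * (b - a) = \int[mu]_(x in `[a, b]) K.
  rewrite Rintegral_cst //= lebesgue_measure_itv /= lte_fin.
  move: ab; rewrite le_eqVlt => /predU1P[->|ab]; last by rewrite ab.
  by rewrite ltxx subrr !mulr0.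
apply: le_Rintegral => //.
- by apply: cts_integrable => x; exact: (cvg_norm (cf x)).
- by apply: cts_integrable => x; exact: cvg_cst.
Qed.

(** The factor 2 comes from bounding the real and imaginary parts separately; all later estimates
    tolerate an absolute constant. *)
Lemma cint_bound g a b K : ccont g -> a <= b ->
  (forall x, a <= x <= b -> nc (g x) <= K) -> nc (cint g a b) <= 2 * K * (b - a).
Proof.
move=> [g1 g2] ab H; apply: le_trans (nc_le_ReIm _) _ => /=.
rewrite -mulrA mulr_natl mulr2n; apply: lerD; apply: Rint_bound => // x /H;
  apply: le_trans; [exact: nc_Re|exact: nc_Im].
Qed.

Lemma ccont_bounded g a b : ccont g -> a <= b ->
  exists2 K, 0 < K & forall x, a <= x <= b -> nc (g x) <= K.
Proof.
move=> [g1 g2] ab.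
have [u _ hu] := EVT_max ab (continuous_subspaceT (fun x => cvg_norm (g1 x))).
have [v _ hv] := EVT_max ab (continuous_subspaceT (fun x => cvg_norm (g2 x))).
exists (`|complex.Re (g u)| + `|complex.Im (g v)| + 1).
  by rewrite ltr_wpDl // addr_ge0.
move=> x hx; apply: le_trans (nc_le_ReIm _) _.
have := hu x; have := hv x; rewrite in_itv /= => /(_ hx) h1 /(_ hx) h2.
by rewrite -[leLHS]addr0; apply: lerD => //; apply: lerD.
Qed.

End ComplexIntegral.

(** * Goursat's theorem on rectangles *)

Section Goursat.
Variable R : realType.
Local Notation C := R[i].
Local Notation nc := (@Normc.normc R).
Implicit Types (f g : C -> C) (a b c d : R) (z w p : C).

Local Arguments Normc.normc : simpl never.

Definition ccontC f := forall z e, 0 < e ->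
  exists2 dl, 0 < dl & forall w, nc (w - z) < dl -> nc (f w - f z) < e.

(** The denominator is cleared, so that [w = z] is no exception and the remainder can be bounded
    directly under an integral. *)
Definition cderiv f z (l : C) := forall e, 0 < e ->
  exists2 dl, 0 < dl & forall w, nc (w - z) < dl ->
    nc (f w - f z - l * (w - z)) <= e * nc (w - z).

Lemma cderiv_cont f z l : cderiv f z l -> forall e, 0 < e ->
  exists2 dl, 0 < dl & forall w, nc (w - z) < dl -> nc (f w - f z) < e.
Proof.
move=> H e e0; have [dl dl0 hd] := H 1 ltr01.
have k0 : 0 < 1 + nc l by rewrite ltr_pwDl // nc_ge0.
exists (Num.min dl (e / (1 + nc l))); first by rewrite lt_min dl0 divr_gt0.
move=> w; rewrite lt_min => /andP[/hd h1 h2].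
have h3 : nc (f w - f z) <= (1 + nc l) * nc (w - z).
  apply: le_trans (nc_triangle _ (l * (w - z))) _.
  by rewrite Normc.normcM mulrDl addrC; apply: lerD.
apply: le_lt_trans h3 _.
by rewrite mulrC -ltr_pdivlMr.
Qed.

Lemma ccont_hline f c : ccontC f -> ccont (fun x : R => f (x +i* c)).
Proof.
move=> H; apply: ccont_eps => x e /(H (x +i* c)) [dl dl0 hd]; exists dl => // y hy.
apply: hd; suff -> : nc ((y +i* c) - (x +i* c)) = `|y - x| by [].
by rewrite -ncR; congr nc; apply: complex_ext => /=; rewrite ?subrr.
Qed.

Lemma ccont_vline f a : ccontC f -> ccont (fun y : R => f (a +i* y)).
Proof.
move=> H; apply: ccont_eps => x e /(H (a +i* x)) [dl dl0 hd]; exists dl => // y hy.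
apply: hd; suff -> : nc ((a +i* y) - (a +i* x)) = `|y - x| by [].
by rewrite /Normc.normc /= subrr expr0n /= add0r sqrtr_sqr.
Qed.

(** The boundary is traversed counterclockwise. Opposite sides are grouped because their
    contributions are compared pairwise in [rect_int_affine] and [sq_int_inv_ge]. *)
Definition rect_int f a b c d : C :=
  cint (fun x => f (x +i* c)) a b - cint (fun x => f (x +i* d)) a b
  + 'i%C * (cint (fun y => f (b +i* y)) c d - cint (fun y => f (a +i* y)) c d).

Lemma rect_int_splith f m a b c d : ccontC f -> a <= m <= b ->
  rect_int f a b c d = rect_int f a m c d + rect_int f m b c d.
Proof.
move=> hf hm; rewrite /rect_int.
rewrite (cint_chasles (ccont_hline c hf) hm) (cint_chasles (ccont_hline d hf) hm).
by ring.
Qed.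

Lemma rect_int_splitv f m a b c d : ccontC f -> c <= m <= d ->
  rect_int f a b c d = rect_int f a b c m + rect_int f a b m d.
Proof.
move=> hf hm; rewrite /rect_int.
rewrite (cint_chasles (ccont_vline b hf) hm) (cint_chasles (ccont_vline a hf) hm).
by ring.
Qed.

Lemma rect_int_bound f a b c d K : ccontC f -> a <= b -> c <= d ->
  (forall x y, a <= x <= b -> c <= y <= d -> nc (f (x +i* y)) <= K) ->
  nc (rect_int f a b c d) <= 4 * K * ((b - a) + (d - c)).
Proof.
move=> hf ab cd H; rewrite /rect_int.
have ha1 : a <= a <= b by rewrite lexx.
have hb1 : a <= b <= b by rewrite ab lexx.
have hc1 : c <= c <= d by rewrite lexx.
have hd1 : c <= d <= d by rewrite cd lexx.
apply: le_trans (le_normcD _ _) _.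
rewrite Normc.normcM nci mul1r.
apply: le_trans (lerD (le_normcD _ _) (le_normcD _ _)) _.
rewrite !normcN.
have h1 := cint_bound (ccont_hline c hf) ab (fun x hx => H x c hx hc1).
have h2 := cint_bound (ccont_hline d hf) ab (fun x hx => H x d hx hd1).
have h3 := cint_bound (ccont_vline a hf) cd (fun x hx => H a x ha1 hx).
have h4 := cint_bound (ccont_vline b hf) cd (fun x hx => H b x hb1 hx).
by move: h1 h2 h3 h4; lra.
Qed.

Lemma ccontC_affine (al be p : C) : ccontC (fun z => al + be * (z - p)).
Proof.
move=> z e e0; have k0 : 0 < 1 + nc be by rewrite ltr_pwDl // nc_ge0.
exists (e / (1 + nc be)); first by rewrite divr_gt0.
move=> w; rewrite ltr_pdivlMr // => h.
have -> : al + be * (w - p) - (al + be * (z - p)) = be * (w - z) by ring.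
rewrite Normc.normcM; apply: le_lt_trans h.
by rewrite mulrC ler_wpM2l ?nc_ge0 // lerDr.
Qed.

Lemma ccontC_B f g : ccontC f -> ccontC g -> ccontC (fun z => f z - g z).
Proof.
move=> hf hg z e e0; have e2 : 0 < e / 2 by rewrite divr_gt0.
have [d1 d10 h1] := hf z _ e2; have [d2 d20 h2] := hg z _ e2.
exists (Num.min d1 d2); first by rewrite lt_min d10.
move=> w; rewrite lt_min => /andP[/h1 k1 /h2 k2].
have -> : f w - g w - (f z - g z) = (f w - f z) + (g z - g w) by ring.
apply: le_lt_trans (le_normcD _ _) _; rewrite (ncB (g z)).
by rewrite [e]splitr; apply: ltrD.
Qed.

Lemma rect_int_B f g a b c d : ccontC f -> ccontC g ->
  rect_int (fun z => f z - g z) a b c d = rect_int f a b c d - rect_int g a b c d.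
Proof.
move=> hf hg; rewrite /rect_int.
rewrite (cintB _ _ (ccont_hline c hf) (ccont_hline c hg)).
rewrite (cintB _ _ (ccont_hline d hf) (ccont_hline d hg)).
rewrite (cintB _ _ (ccont_vline a hf) (ccont_vline a hg)).
rewrite (cintB _ _ (ccont_vline b hf) (ccont_vline b hg)).
by ring.
Qed.

(** An affine function differs by a constant between opposite sides, so each pair of sides
    integrates a constant, and the two results cancel. *)
Lemma rect_int_affine (al be p : C) a b c d : a <= b -> c <= d ->
  rect_int (fun z => al + be * (z - p)) a b c d = 0.
Proof.
move=> ab cd; have hf := ccontC_affine al be p; rewrite /rect_int.
rewrite -(cintB _ _ (ccont_hline c hf) (ccont_hline d hf)).
rewrite -(cintB _ _ (ccont_vline b hf) (ccont_vline a hf)).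
under [X in cint X a b]eq_fun => x.
  rewrite (_ : _ - _ = be * 'i%C * (c - d)%:C); last first.
    suff: (x +i* c) - (x +i* d) = 'i%C * (c - d)%:C.
      by move=> h; rewrite -[RHS]mulrA -h; ring.
    by apply: complex_ext => /=; ring.
  over.
under [X in cint X c d]eq_fun => x.
  rewrite (_ : _ - _ = be * (b - a)%:C); last first.
    suff: (b +i* x) - (a +i* x) = (b - a)%:C by move=> <-; ring.
    by apply: complex_ext => /=; ring.
  over.
rewrite !cint_cst // -(opprB d c) rmorphN; ring.
Qed.

(** Subtracting the affine part at [p] does not change the integral and makes the integrand at most
    [e] times the size of the rectangle. Multiplied by the perimeter this is quadratic in the size,
    exactly the rate lost by repeated quartering. *)
Lemma rect_int_local f a b c d (l : C) (p : C) e : ccontC f ->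
  a <= complex.Re p <= b -> c <= complex.Im p <= d -> 0 <= e ->
  (forall x y, a <= x <= b -> c <= y <= d ->
     nc (f (x +i* y) - f p - l * ((x +i* y) - p)) <= e * nc ((x +i* y) - p)) ->
  nc (rect_int f a b c d) <= 4 * e * ((b - a) + (d - c)) ^+ 2.
Proof.
move=> hf h1 h2 e0 H.
have ab : a <= b by case/andP: h1 => /le_trans; apply.
have cd : c <= d by case/andP: h2 => /le_trans; apply.
have hg := ccontC_affine (f p) l p.
have -> : rect_int f a b c d =
  rect_int (fun z => f z - (f p + l * (z - p))) a b c d.
  by rewrite rect_int_B // rect_int_affine // subr0.
rewrite expr2 mulrA -[4 * e * _]mulrA.
apply: rect_int_bound => //; first exact: ccontC_B.
move=> x y hx hy; rewrite opprD addrA; apply: le_trans (H x y hx hy) _.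
apply: ler_wpM2l => //; apply: le_trans (nc_le_ReIm _) _.
rewrite ReD ReN ImD ImN /=; apply: lerD; rewrite ler_norml.
  by move: h1 hx; lra.
by move: h2 hy; lra.
Qed.

Lemma quarter (x1 x2 x3 x4 : C) :
  [\/ nc (x1 + x2 + (x3 + x4)) / 4 <= nc x1, nc (x1 + x2 + (x3 + x4)) / 4 <= nc x2,
      nc (x1 + x2 + (x3 + x4)) / 4 <= nc x3 | nc (x1 + x2 + (x3 + x4)) / 4 <= nc x4].
Proof.
have h := le_trans (le_normcD (x1 + x2) (x3 + x4))
  (lerD (le_normcD x1 x2) (le_normcD x3 x4)).
set n := nc (_ + _ + _) in h *.
case: (leP (n / 4) (nc x1)) => h1; first by constructor 1.
case: (leP (n / 4) (nc x2)) => h2; first by constructor 2.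
case: (leP (n / 4) (nc x3)) => h3; first by constructor 3.
case: (leP (n / 4) (nc x4)) => h4; first by constructor 4.
by move: h h1 h2 h3 h4; lra.
Qed.

Lemma goursat f a b c d : a <= b -> c <= d -> ccontC f ->
  (forall x y, a <= x <= b -> c <= y <= d -> exists l, cderiv f (x +i* y) l) ->
  rect_int f a b c d = 0.
Proof.
move=> ab cd hf hd.
(* A rectangle of generation [n] is recorded by its lower left corner alone, its dimensions being
   [wd n] and [ht n]. *)
pose wd n := (b - a) / 2 ^+ n; pose ht n := (d - c) / 2 ^+ n.
have wdS n : wd n = wd n.+1 + wd n.+1.
  by rewrite /wd exprS invfM mulrCA; field.
have htS n : ht n = ht n.+1 + ht n.+1.
  by rewrite /ht exprS invfM mulrCA; field.
have p2 n : 0 < 2 ^+ n :> R by apply: exprn_gt0.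
have wd0 n : 0 <= wd n by rewrite divr_ge0 ?subr_ge0 // ltW.
have ht0 n : 0 <= ht n by rewrite divr_ge0 ?subr_ge0 // ltW.
pose W n (q : R * R) := nc (rect_int f q.1 (q.1 + wd n) q.2 (q.2 + ht n)).
have stepE (nq : nat * (R * R)) : exists q' : R * R,
   [/\ nq.2.1 <= q'.1, q'.1 + wd nq.1.+1 <= nq.2.1 + wd nq.1,
       nq.2.2 <= q'.2, q'.2 + ht nq.1.+1 <= nq.2.2 + ht nq.1
     & W nq.1 nq.2 / 4 <= W nq.1.+1 q'].
  case: nq => n [x y] /=.
  have e1 : W n (x, y) = nc (
     rect_int f x (x + wd n.+1) y (y + ht n.+1) +
     rect_int f x (x + wd n.+1) (y + ht n.+1) (y + ht n) +
     (rect_int f (x + wd n.+1) (x + wd n) y (y + ht n.+1) +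
     rect_int f (x + wd n.+1) (x + wd n) (y + ht n.+1) (y + ht n))).
    have hx : x <= x + wd n.+1 <= x + wd n.
      by rewrite (wdS n); have := wd0 n.+1; lra.
    have hy : y <= y + ht n.+1 <= y + ht n.
      by rewrite (htS n); have := ht0 n.+1; lra.
    rewrite /W /= (rect_int_splith _ _ hf hx).
    by rewrite !(rect_int_splitv _ _ hf hy).
  rewrite e1; have := wdS n; have := htS n; have := wd0 n.+1; have := ht0 n.+1.
  move=> k1 k2 k3 k4.
  case: (quarter (rect_int f x (x + wd n.+1) y (y + ht n.+1))
     (rect_int f x (x + wd n.+1) (y + ht n.+1) (y + ht n))
     (rect_int f (x + wd n.+1) (x + wd n) y (y + ht n.+1))
     (rect_int f (x + wd n.+1) (x + wd n) (y + ht n.+1) (y + ht n))) => h.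
  - by exists (x, y); split=> //; rewrite /fst /snd ?lexx //; lra.
  - exists (x, y + ht n.+1); split=> //; rewrite /fst /snd ?lexx //; try lra.
    by rewrite /W /= -[y + _ + _]addrA -htS.
  - exists (x + wd n.+1, y); split=> //; rewrite /fst /snd ?lexx //; try lra.
    by rewrite /W /= -[x + _ + _]addrA -wdS.
  - exists (x + wd n.+1, y + ht n.+1); split=> //; rewrite /fst /snd ?lexx //; try lra.
    by rewrite /W /= -[x + _ + _]addrA -[y + _ + _]addrA -wdS -htS.
have [step hstep] := choice stepE.
pose q := fix q n := if n is m.+1 then step (m, q m) else (a, c).
have qS n : [/\ (q n).1 <= (q n.+1).1, (q n.+1).1 + wd n.+1 <= (q n).1 + wd n,
       (q n).2 <= (q n.+1).2, (q n.+1).2 + ht n.+1 <= (q n).2 + ht n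
     & W n (q n) / 4 <= W n.+1 (q n.+1)] by exact: hstep (n, q n).
(* Nested intervals: the supremum of the left endpoints lies in all of them. It is applied to each
   coordinate of the corners. *)
have mono (s w : nat -> R) : (forall n, 0 <= w n) -> (forall n, s n <= s n.+1) ->
    (forall n, s n.+1 + w n.+1 <= s n + w n) ->
    exists s0, forall n, s n <= s0 <= s n + w n.
  move=> w0 h1 h2.
  have i1 : {homo s : i j / (i <= j)%N >-> i <= j} by apply: homo_leq => //; exact: le_trans.
  have i2 i j : (i <= j)%N -> s j + w j <= s i + w i.
    move=> ij; rewrite -(subnK ij); elim: (j - i)%N => // k IH.
    by apply: le_trans IH; rewrite addSn.
  have i3 i j : s i <= s j + w j.
    case: (leqP i j) => ij; first by apply: le_trans (i1 _ _ ij) _; rewrite lerDl.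
    by apply: le_trans (i2 _ _ (ltnW ij)); rewrite lerDl.
  exists (sup (range s)) => n; apply/andP; split.
    apply: ub_le_sup; last by exists n.
    by exists (s n + w n) => _ [m _ <-]; exact: i3.
  by apply: ge_sup; [exists (s 0%N); exists 0%N|move=> _ [m _ <-]; exact: i3].
have [p1 hp1] := mono (fun n => (q n).1) wd wd0 (fun n => let: And5 h _ _ _ _ := qS n in h)
  (fun n => let: And5 _ h _ _ _ := qS n in h).
have [p2' hp2] := mono (fun n => (q n).2) ht ht0 (fun n => let: And5 _ _ h _ _ := qS n in h)
  (fun n => let: And5 _ _ _ h _ := qS n in h).
have Wn n : W 0%N (a, c) / 4 ^+ n <= W n (q n).
  elim: n => [|n IH]; first by rewrite expr0 divr1.
  case: (qS n) => _ _ _ _; apply: le_trans.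
  by rewrite exprS invfM mulrCA [leLHS]mulrC ler_pM2r // invr_gt0.
have hW0 : W 0%N (a, c) = nc (rect_int f a b c d).
  by rewrite /W /wd /ht /= expr0 !divr1 (addrC a) (addrC c) !subrK.
set s := (b - a) + (d - c).
have s0 : 0 <= s by rewrite addr_ge0 ?subr_ge0.
(* The integral over generation [n] is at least the original one divided by [4 ^+ n], and at most
   [4 * e * (s / 2 ^+ n) ^+ 2] for [n] large; the powers of 4 cancel. *)
have key e : 0 < e -> W 0%N (a, c) <= 4 * e * s ^+ 2.
  move=> e0.
  have := hp1 0%N; have := hp2 0%N; rewrite /= /wd /ht expr0 !divr1 => hh2 hh1.
  have [|| l hl] := hd p1 p2'; [lra|lra|].
  have [dl dl0 hdl] := hl e e0.
  have [n hn] : exists n, s / 2 ^+ n < dl.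
    have /cvgrPdist_lt/(_ dl dl0) [n _ hn] : geometric s (2^-1 : R) n @[n --> \oo] --> 0.
      by apply: cvg_geometric; rewrite ger0_norm // invf_lt1 // ltr1n.
    exists n; have := hn n (leqnn n); rewrite /= sub0r normrN.
    by rewrite exprVn ger0_norm // divr_ge0 // ltW.
  have hs : wd n + ht n = s / 2 ^+ n by rewrite /wd /ht -mulrDl.
  have h1 : W n (q n) <= 4 * e * (wd n + ht n) ^+ 2.
    have -> : wd n + ht n = ((q n).1 + wd n - (q n).1) + ((q n).2 + ht n - (q n).2).
      by ring.
    apply: (@rect_int_local _ _ _ _ _ l (p1 +i* p2')) => //; first exact: ltW.
    move=> x y hx hy; apply: hdl; apply: le_lt_trans hn; rewrite -hs.
    apply: le_trans (nc_le_ReIm _) _ => /=.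
    have := hp1 n; have := hp2 n => u1 u2.
    apply: lerD; rewrite ler_norml; [move: u2 hx|move: u1 hy]; lra.
  have := le_trans (Wn n) h1; rewrite hs expr_div_n -exprM mulnC exprM.
  have -> : (2 ^+ 2 : R) = 4 by rewrite expr2; lra.
  by rewrite mulrA ler_pM2r // invr_gt0 exprn_gt0.
apply: Normc.eq0_normc; apply/eqP; rewrite -hW0 eq_le; apply/andP; split; last exact: nc_ge0.
apply/ler_addgt0Pl => e e0; rewrite addr0.
have k0 : 0 < 4 * (1 + s ^+ 2) by rewrite mulr_gt0 // ltr_pwDl // sqr_ge0.
have := key (e / (4 * (1 + s ^+ 2))) (divr_gt0 e0 k0); move/le_trans; apply.
have -> : 4 * (e / (4 * (1 + s ^+ 2))) * s ^+ 2 = e * (s ^+ 2 / (1 + s ^+ 2)).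
  by field; rewrite lt0r_neq0 // ltr_pwDl // sqr_ge0.
rewrite ler_piMr ?(ltW e0) // ler_pdivrMr ?mul1r ?lerDr //.
by rewrite ltr_pwDl // sqr_ge0.
Qed.

End Goursat.

(** * Cauchy's formula on squares and approximation by polynomials *)

Section CauchyOnSquares.
Variable R : realType.
Local Notation C := R[i].
Local Notation nc := (@Normc.normc R).
Implicit Types (f g h : C -> C) (z w : C).

Local Arguments Normc.normc : simpl never.

Definition differentiable_everywhere f := forall z, exists l, cderiv f z l.

Lemma differentiable_ccontC f : differentiable_everywhere f -> ccontC f.
Proof. by move=> hf z e e0; have [l hl] := hf z; exact: cderiv_cont hl _ e0. Qed.

(** The value [l0], meant to be the derivative at [z0], makes the quotient continuous on the whole
    plane, as [goursat] demands. *)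
Definition diff_quot f (z0 l0 : C) z := if z == z0 then l0 else (f z - f z0) / (z - z0).

Lemma diff_quot_derivable f z0 l0 z : z != z0 -> (exists l, cderiv f z l) ->
  exists l, cderiv (diff_quot f z0 l0) z l.
Proof.
move=> zz0 [l hl].
set Q := (f z - f z0) / (z - z0).
have D0 : 0 < nc (z - z0) by rewrite nc_gt0 subr_eq0.
set D := nc (z - z0) in D0.
exists ((l - Q) / (z - z0)) => e e0.
have e1 : 0 < e * D / 4 by rewrite divr_gt0 // mulr_gt0.
have [d d0 hd] := hl _ e1.
have k0 : 0 < e * D ^+ 2 / 4 / (1 + nc (l - Q)).
  by rewrite divr_gt0 ?ltr_pwDl ?nc_ge0 // divr_gt0 // mulr_gt0 // exprn_gt0.
exists (Num.min (Num.min d (D / 2)) (e * D ^+ 2 / 4 / (1 + nc (l - Q)))).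
  by rewrite !lt_min d0 k0 divr_gt0.
move=> w; rewrite !lt_min => /andP[/andP[/hd h1 h2] h3].
have hw : D / 2 <= nc (w - z0).
  have := nc_triangle (z - z0) (w - z0).
  have -> : z - z0 - (w - z0) = z - w by ring.
  by rewrite (ncB z w) -/D; move: h2; lra.
have w0 : w - z0 != 0.
  by rewrite -nc_gt0; apply: lt_le_trans hw; rewrite divr_gt0.
have z0' : z - z0 != 0 by rewrite subr_eq0.
have wz0 : w != z0 by rewrite -subr_eq0.
rewrite /diff_quot (negbTE zz0) (negbTE wz0).
have -> : (f w - f z0) / (w - z0) - (f z - f z0) / (z - z0) - (l - Q) / (z - z0) * (w - z)
  = (f w - f z - l * (w - z)) / (w - z0)
    + (l - Q) * (w - z) * (z - w) / ((w - z0) * (z - z0)).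
  by rewrite /Q; field; rewrite w0 z0'.
have n0 : 0 <= nc (w - z) by exact: nc_ge0.
have iw : (nc (w - z0))^-1 <= 2 / D.
  by rewrite -[leRHS]invrK lef_pV2 ?posrE ?invf_div // ?divr_gt0 //; apply: lt_le_trans hw; rewrite divr_gt0.
have iw0 : 0 <= (nc (w - z0))^-1 by rewrite invr_ge0 nc_ge0.
apply: le_trans (le_normcD _ _) _.
rewrite !Normc.normcM !Normc.normcV Normc.normcM (ncB z w) -/D.
have t1 : nc (f w - f z - l * (w - z)) / nc (w - z0) <= e / 2 * nc (w - z).
  have -> : e / 2 * nc (w - z) = (e * D / 4 * nc (w - z)) * (2 / D).
    by field; rewrite lt0r_neq0.
  by apply: ler_pM => //; exact: nc_ge0.
have t2 : nc (l - Q) * nc (w - z) <= e * D ^+ 2 / 4.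
  move: h3; rewrite ltr_pdivlMr ?ltr_pwDl ?nc_ge0 // => /ltW; apply: le_trans.
  by rewrite mulrC ler_wpM2l // lerDr.
have t3 : nc (l - Q) * nc (w - z) * nc (w - z) / (nc (w - z0) * D) <= e / 2 * nc (w - z).
  have -> : e / 2 * nc (w - z) = (e * D ^+ 2 / 4 * nc (w - z)) * (2 / D * D^-1).
    by field; rewrite lt0r_neq0.
  rewrite invfM; apply: ler_pM => //.
  - by rewrite !mulr_ge0 // nc_ge0.
  - by rewrite mulr_ge0 // invr_ge0 ltW.
  - by apply: ler_wpM2r.
  - by apply: ler_wpM2r => //; rewrite invr_ge0 ltW.
by apply: le_trans (lerD t1 t3) _; rewrite -mulrDl -splitr.
Qed.

Lemma diff_quot_ccontC f z0 l0 : differentiable_everywhere f -> cderiv f z0 l0 ->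
  ccontC (diff_quot f z0 l0).
Proof.
move=> hf hl z; have [->|zz0] := eqVneq z z0; last first.
  have [l hq] := diff_quot_derivable l0 zz0 (hf z).
  by move=> e e0; exact: cderiv_cont hq _ e0.
move=> e e0; have e1 : 0 < e / 2 by rewrite divr_gt0.
have [d d0 hd] := hl _ e1; exists d => // w /hd h.
rewrite /diff_quot eqxx; case: eqP => [_|/eqP w0]; first by rewrite subrr Normc.normc0.
have w1 : w - z0 != 0 by rewrite subr_eq0.
have -> : (f w - f z0) / (w - z0) - l0 = (f w - f z0 - l0 * (w - z0)) / (w - z0).
  by field.
rewrite Normc.normcM Normc.normcV ltr_pdivrMr ?nc_gt0 //.
apply: le_lt_trans h _; rewrite ltr_pM2r ?nc_gt0 //; lra.
Qed.

(** Goursat's theorem removes everything except a square of half-side [t] around [z0], where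
    differentiability may fail. There the quotient is bounded by continuity, so the integral is O(t)
    for every small [t]. *)
Lemma rect_int_diff_quot f (x0 y0 : R) l0 (a b c d : R) :
  differentiable_everywhere f -> cderiv f (x0 +i* y0) l0 ->
  a < x0 < b -> c < y0 < d -> rect_int (diff_quot f (x0 +i* y0) l0) a b c d = 0.
Proof.
move=> hf hl hx hy; set q := diff_quot _ _ _; set z0 := x0 +i* y0 in hl q *.
have cq : ccontC q by exact: diff_quot_ccontC.
have dq x y : x != x0 \/ y != y0 -> exists l, cderiv q (x +i* y) l.
  move=> h; apply: diff_quot_derivable => //.
  by rewrite eq_complex /= negb_and; apply/orP.
have [dl dl0 hdl] := cq z0 1 ltr01.
set K := nc (q z0) + 1.
have K0 : 0 < K by rewrite ltr_wpDl // nc_ge0.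
(* The term [dl / 3] gives [t + t < dl], which keeps the small square where [q] stays within 1 of
   [q z0]; the other terms keep it inside the rectangle. *)
pose T := Num.min (Num.min (x0 - a) (b - x0)) (Num.min (Num.min (y0 - c) (d - y0)) (dl / 3)).
have T0 : 0 < T by rewrite !lt_min; move: hx hy; lra.
have key t : 0 < t <= T -> nc (rect_int q a b c d) <= 16 * K * t.
  rewrite !le_min => /andP[t0 /andP[/andP[t1 t2] /andP[/andP[t3 t4] t5]]].
  have i1 : a <= x0 - t <= b by move: hx; lra.
  have i2 : x0 - t <= x0 + t <= b by move: hx; lra.
  have i3 : c <= y0 - t <= d by move: hy; lra.
  have i4 : y0 - t <= y0 + t <= d by move: hy; lra.
  rewrite (rect_int_splith _ _ cq i1) (rect_int_splith _ _ cq i2).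
  rewrite (rect_int_splitv (x0 - t) _ cq i3) (rect_int_splitv (x0 - t) _ cq i4).
  rewrite (@goursat _ q a (x0 - t) c d) //; [|lra|move: hy; lra|].
    2:{ by move=> x y hx' _; apply: dq; left; apply/eqP => E; move: hx'; rewrite E; lra. }
  rewrite (@goursat _ q (x0 + t) b c d) //; [|lra|move: hy; lra|].
    2:{ by move=> x y hx' _; apply: dq; left; apply/eqP => E; move: hx'; rewrite E; lra. }
  rewrite (@goursat _ q (x0 - t) (x0 + t) c (y0 - t)) //; [|lra|lra|].
    2:{ by move=> x y _ hx'; apply: dq; right; apply/eqP => E; move: hx'; rewrite E; lra. }
  rewrite (@goursat _ q (x0 - t) (x0 + t) (y0 + t) d) //; [|lra|lra|].
    2:{ by move=> x y _ hx'; apply: dq; right; apply/eqP => E; move: hx'; rewrite E; lra. }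
  rewrite !add0r !addr0.
  have -> : 16 * K * t = 4 * K * ((x0 + t - (x0 - t)) + (y0 + t - (y0 - t))) by ring.
  apply: rect_int_bound => //; [lra|lra|move=> x y hx' hy'].
  apply: le_trans (nc_triangle _ (q z0)) _; rewrite lerD2l ltW //; apply: hdl.
  apply: le_lt_trans (nc_le_ReIm _) _ => /=.
  apply: (@le_lt_trans _ _ (t + t)); last by lra.
  by apply: lerD; rewrite ler_norml; [move: hx'|move: hy']; lra.
apply: Normc.eq0_normc; apply/eqP; rewrite eq_le; apply/andP; split; last exact: nc_ge0.
apply/ler_addgt0Pl => e e0; rewrite addr0.
have t0 : 0 < Num.min T (e / (16 * K)) <= T.
  by rewrite lt_min T0 divr_gt0 ?mulr_gt0 //= ge_min lexx.
apply: le_trans (key _ t0) _.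
rewrite mulrC -ler_pdivlMr ?mulr_gt0 //.
by rewrite ge_min lexx orbT.
Qed.

Lemma ccont_inv (g : R -> C) : ccont g -> (forall x, g x != 0) ->
  ccont (fun x => (g x)^-1).
Proof.
move=> [g1 g2] g0.
have n0 x : (complex.Re (g x)) ^+ 2 + (complex.Im (g x)) ^+ 2 != 0.
  apply: contra (g0 x); rewrite paddr_eq0 ?sqr_ge0 // !sqrf_eq0.
  by rewrite eq_complex.
have cn x : (fun x => (complex.Re (g x)) ^+ 2 + (complex.Im (g x)) ^+ 2)
    @ x --> (complex.Re (g x)) ^+ 2 + (complex.Im (g x)) ^+ 2.
  by apply: cvgD; rewrite expr2; under eq_fun do rewrite expr2; apply: cvgM;
    (exact: g1 || exact: g2).
split=> x.
  under [fun x => _]eq_fun => y.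
    rewrite (_ : complex.Re _ = complex.Re (g y) /
       ((complex.Re (g y)) ^+ 2 + (complex.Im (g y)) ^+ 2)); last by case: (g y).
    over.
  by apply: cvgM; [exact: g1|apply: cvgV; [exact: n0|exact: cn]].
under [fun x => _]eq_fun => y.
  rewrite (_ : complex.Im _ = - (complex.Im (g y) /
     ((complex.Re (g y)) ^+ 2 + (complex.Im (g y)) ^+ 2))); last by case: (g y).
  over.
by apply: cvgN; apply: cvgM; [exact: g2|apply: cvgV; [exact: n0|exact: cn]].
Qed.

Section Square.
Variable S : R.
Hypothesis S0 : 0 < S.

Definition on_square z :=
  (exists2 x, - S <= x <= S & z = x +i* S \/ z = x +i* (- S)) \/
  (exists2 y, - S <= y <= S & z = S +i* y \/ z = (- S) +i* y).

(** Continuity is asked along the four sides alone, because the Cauchy kernel has its pole inside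
    the square. *)
Definition sq_cont g := [/\ ccont (fun x => g (x +i* (- S))), ccont (fun x => g (x +i* S)),
  ccont (fun y => g (S +i* y)) & ccont (fun y => g ((- S) +i* y))].

Definition sq_int g := rect_int g (- S) S (- S) S.

Let SS : - S <= S. Proof. by rewrite ge0_cp // ltW. Qed.

Lemma on_square_ge z : on_square z -> S <= nc z.
Proof.
have aS : `|S| = S by rewrite gtr0_norm.
case=> [[x hx [->|->]]|[y hy [->|->]]].
- by have := nc_Im (x +i* S); rewrite /= aS.
- by have := nc_Im (x +i* (- S)); rewrite /= normrN aS.
- by have := nc_Re (S +i* y); rewrite /= aS.
- by have := nc_Re ((- S) +i* y); rewrite /= normrN aS.
Qed.

Lemma sq_intD g h : sq_cont g -> sq_cont h ->
  sq_int (fun z => g z + h z) = sq_int g + sq_int h.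
Proof.
move=> [g1 g2 g3 g4] [h1 h2 h3 h4]; rewrite /sq_int /rect_int.
rewrite (cintD _ _ g1 h1) (cintD _ _ g2 h2) (cintD _ _ g3 h3) (cintD _ _ g4 h4); ring.
Qed.

Lemma sq_intM (c : C) g : sq_cont g -> sq_int (fun z => c * g z) = c * sq_int g.
Proof.
move=> [g1 g2 g3 g4]; rewrite /sq_int /rect_int.
rewrite (cintM _ _ _ g1) (cintM _ _ _ g2) (cintM _ _ _ g3) (cintM _ _ _ g4); ring.
Qed.

Lemma sq_contD g h : sq_cont g -> sq_cont h -> sq_cont (fun z => g z + h z).
Proof. by move=> [? ? ? ?] [? ? ? ?]; split; exact: ccontD. Qed.

Lemma sq_contM g h : sq_cont g -> sq_cont h -> sq_cont (fun z => g z * h z).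
Proof. by move=> [? ? ? ?] [? ? ? ?]; split; exact: ccontM. Qed.

Lemma sq_cont_cst (c : C) : sq_cont (fun=> c).
Proof. by split; exact: ccont_cst. Qed.

Lemma sq_contX g n : sq_cont g -> sq_cont (fun z => g z ^+ n).
Proof.
move=> hg; elim: n => [|n IH]; first exact: sq_cont_cst.
by under [X in sq_cont X]eq_fun do rewrite exprS; exact: sq_contM.
Qed.

Lemma sq_cont_sum n (F : 'I_n -> C -> C) : (forall i, sq_cont (F i)) ->
  sq_cont (fun z => \sum_i F i z) /\ sq_int (fun z => \sum_i F i z) = \sum_i sq_int (F i).
Proof.
elim: n F => [|n IH] F hF.
  under [X in sq_cont X]eq_fun do rewrite big_ord0.
  under [X in sq_int X = _]eq_fun do rewrite big_ord0.
  split; first exact: sq_cont_cst.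
  rewrite big_ord0; have := sq_intM 0 (sq_cont_cst 0); by rewrite !mul0r.
have [h1 h2] := IH _ (fun i => hF (lift ord0 i)).
under [X in sq_cont X]eq_fun do rewrite big_ord_recl.
under [X in sq_int X = _]eq_fun do rewrite big_ord_recl.
split; first exact: sq_contD.
by rewrite sq_intD // h2 big_ord_recl.
Qed.

Lemma sq_int_eq g h : (forall z, on_square z -> g z = h z) -> sq_int g = sq_int h.
Proof.
move=> H; rewrite /sq_int /rect_int /cint.
have E (i : R -> C) : (forall x, x \in `[- S, S] -> on_square (i x)) ->
  (\int[lebesgue_measure]_(x in `[- S, S]) complex.Re (g (i x)) =
   \int[lebesgue_measure]_(x in `[- S, S]) complex.Re (h (i x))) /\
  (\int[lebesgue_measure]_(x in `[- S, S]) complex.Im (g (i x)) =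
   \int[lebesgue_measure]_(x in `[- S, S]) complex.Im (h (i x))).
  by move=> hi; split; apply: eq_Rintegral => x /set_mem /= /hi /H ->.
have [-> ->] := E (fun x => x +i* (- S)) (fun x hx => or_introl (ex_intro2 _ _ x hx (or_intror erefl))).
have [-> ->] := E (fun x => x +i* S) (fun x hx => or_introl (ex_intro2 _ _ x hx (or_introl erefl))).
have [-> ->] := E (fun x => S +i* x) (fun x hx => or_intror (ex_intro2 _ _ x hx (or_introl erefl))).
by have [-> ->] := E (fun x => (- S) +i* x) (fun x hx => or_intror (ex_intro2 _ _ x hx (or_intror erefl))).
Qed.

Lemma sq_int_bound g K : sq_cont g -> (forall z, on_square z -> nc (g z) <= K) ->
  nc (sq_int g) <= 16 * K * S.
Proof.
move=> [g1 g2 g3 g4] H; rewrite /sq_int /rect_int.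
apply: le_trans (le_normcD _ _) _.
rewrite Normc.normcM nci mul1r.
apply: le_trans (lerD (le_normcD _ _) (le_normcD _ _)) _.
rewrite !normcN.
have := cint_bound g1 SS (fun x hx => H _ (or_introl (ex_intro2 _ _ x hx (or_intror erefl)))).
have := cint_bound g2 SS (fun x hx => H _ (or_introl (ex_intro2 _ _ x hx (or_introl erefl)))).
have := cint_bound g3 SS (fun x hx => H _ (or_intror (ex_intro2 _ _ x hx (or_introl erefl)))).
have := cint_bound g4 SS (fun x hx => H _ (or_intror (ex_intro2 _ _ x hx (or_intror erefl)))).
by lra.
Qed.

Lemma sq_cont_bounded g : sq_cont g ->
  exists2 K, 0 < K & forall z, on_square z -> nc (g z) <= K.
Proof.
move=> [g1 g2 g3 g4].
have [k1 k10 h1] := ccont_bounded g1 SS; have [k2 k20 h2] := ccont_bounded g2 SS.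
have [k3 k30 h3] := ccont_bounded g3 SS; have [k4 k40 h4] := ccont_bounded g4 SS.
exists (k1 + k2 + (k3 + k4)); first by rewrite !addr_gt0.
move=> z [] [x hx [->|->]].
- by apply: le_trans (h2 x hx) _; lra.
- by apply: le_trans (h1 x hx) _; lra.
- by apply: le_trans (h3 x hx) _; lra.
- by apply: le_trans (h4 x hx) _; lra.
Qed.

Lemma ccontC_sq_cont f : ccontC f -> sq_cont f.
Proof. by move=> hf; split; (exact: ccont_hline || exact: ccont_vline). Qed.

Lemma sq_cont_inv z0 : nc z0 < S -> sq_cont (fun z => (z - z0)^-1).
Proof.
move=> h.
have ci : ccontC (fun z => z - z0).
  by move=> z e e0; exists e => // w; rewrite (_ : _ - z0 - _ = w - z) //; ring.
have n1 : complex.Re z0 < S by apply: le_lt_trans h; apply: le_trans (nc_Re _); exact: ler_norm.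
have n2 : complex.Im z0 < S by apply: le_lt_trans h; apply: le_trans (nc_Im _); exact: ler_norm.
have n3 : - S < complex.Re z0.
  by rewrite ltrNl; apply: le_lt_trans h; apply: le_trans (nc_Re _); rewrite -normrN; exact: ler_norm.
have n4 : - S < complex.Im z0.
  by rewrite ltrNl; apply: le_lt_trans h; apply: le_trans (nc_Im _); rewrite -normrN; exact: ler_norm.
case: z0 ci {h} n1 n2 n3 n4 => x0 y0 ci /= n1 n2 n3 n4.
split; apply: ccont_inv; (try exact: (ccont_hline _ ci));
  (try exact: (ccont_vline _ ci)); move=> x; rewrite subr_eq0 eq_complex /= negb_and; apply/orP.
- by right; rewrite lt_eqF.
- by right; rewrite gt_eqF.
- by left; rewrite gt_eqF.
- by left; rewrite lt_eqF.
Qed.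

(** The exact modulus is [2 * pi], but a lower bound is enough to divide. In the imaginary part each
    pair of opposite sides reduces to the integral of [k], whose values on a side are at least
    [1 / S], so each pair contributes at least 2. *)
Lemma sq_int_inv_ge : 4 <= nc (sq_int (fun z => (z - 0)^-1)).
Proof.
apply: le_trans (nc_Im _); apply: le_trans (ler_norm _).
have c0 : sq_cont (fun z => (z - 0)^-1) by apply: sq_cont_inv; rewrite Normc.normc0.
case: (c0) => c1 c2 c3 c4.
rewrite /sq_int /rect_int -(cintB _ _ c1 c2) -(cintB _ _ c3 c4) ImD ImM /=.
rewrite mul0r add0r mul1r.
pose k (x : R) := 2 * S / (x ^+ 2 + S ^+ 2).
have n0 x : x ^+ 2 + S ^+ 2 != 0 :> R.
  by rewrite lt0r_neq0 // ltr_wpDl ?sqr_ge0 // exprn_gt0.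
have ck : continuous k.
  move=> x; apply: cvgM; first exact: cvg_cst.
  apply: cvgV; first exact: n0.
  by apply: cvgD; [exact: exprn_continuous|exact: cvg_cst].
have E1 : \int[lebesgue_measure]_(x in `[- S, S])
    complex.Im ((x +i* (- S) - 0)^-1 - (x +i* S - 0)^-1) =
    \int[lebesgue_measure]_(x in `[- S, S]) k x.
  apply: eq_Rintegral => x _; rewrite !subr0 /= /k sqrrN.
  by field.
have E2 : \int[lebesgue_measure]_(x in `[- S, S])
    complex.Re ((S +i* x - 0)^-1 - ((- S) +i* x - 0)^-1) =
    \int[lebesgue_measure]_(x in `[- S, S]) k x.
  apply: eq_Rintegral => x _; rewrite !subr0 /= /k sqrrN (addrC (S ^+ 2)).
  by field.
rewrite E1 E2.
have : 2 <= \int[lebesgue_measure]_(x in `[- S, S]) k x.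
  have -> : 2 = \int[lebesgue_measure]_(x in `[- S, S]) (S^-1 : R).
    rewrite Rintegral_cst //= lebesgue_measure_itv /= lte_fin ifT.
      by rewrite /=; field; rewrite lt0r_neq0.
    by move: S0; lra.
  apply: le_Rintegral => //.
  - by apply: cts_integrable => x; exact: cvg_cst.
  - exact: cts_integrable.
  move=> x /=; rewrite in_itv /= => hx.
  have hx2 : x ^+ 2 <= S ^+ 2.
    by rewrite -subr_ge0 subr_sqr mulr_ge0 //; move: hx; lra.
  rewrite /k ler_pdivlMr; last by rewrite ltr_wpDl ?sqr_ge0 // exprn_gt0.
  rewrite mulrC ler_pdivrMr //; move: hx2; nra.
lra.
Qed.

End Square.

Section Approximation.
Variable f : C -> C.
Hypothesis hf : differentiable_everywhere f.

(** The vanishing integral of the difference quotient is split into two terms, each continuous along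
    the square; the winding integral stays as a factor instead of being evaluated. *)
Lemma cauchy_square S z0 : 0 < S -> nc z0 < S ->
  f z0 * sq_int S (fun z => (z - z0)^-1) = sq_int S (fun z => f z * (z - z0)^-1).
Proof.
move=> S0 hz; have [l0 hl] := hf z0.
have ci := sq_cont_inv hz.
have cf := ccontC_sq_cont S (differentiable_ccontC hf).
have n1 : `|complex.Re z0| < S by apply: le_lt_trans hz; exact: nc_Re.
have n2 : `|complex.Im z0| < S by apply: le_lt_trans hz; exact: nc_Im.
have : sq_int S (diff_quot f z0 l0) = 0.
  case: z0 hz hl ci n1 n2 => x0 y0 hz hl ci /= n1 n2.
  by apply: rect_int_diff_quot => //; rewrite -ltr_norml.
rewrite (@sq_int_eq S _ (fun z => f z * (z - z0)^-1 + (- f z0) * (z - z0)^-1)); last first.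
  move=> z hz'; rewrite /diff_quot ifN; first by rewrite mulrBl mulNr.
  apply/eqP => E; have := on_square_ge S0 hz'; rewrite E; move: hz; lra.
rewrite sq_intD; [|exact: sq_contM|by apply: sq_contM => //; exact: sq_cont_cst].
by rewrite sq_intM // mulNr => /eqP; rewrite subr_eq0 => /eqP.
Qed.

Lemma square_inv_le S z0 z : 0 < S -> nc z0 <= S / 2 -> on_square S z ->
  z - z0 != 0 /\ nc (z - z0)^-1 <= 2 / S.
Proof.
move=> S0 h hz; have h1 := on_square_ge S0 hz.
have h2 : S / 2 <= nc (z - z0).
  by have := nc_triangle z z0; move: h h1; lra.
have h3 : 0 < nc (z - z0) by apply: lt_le_trans h2; rewrite divr_gt0.
split; first by rewrite -nc_gt0.
by rewrite Normc.normcV -[leRHS]invrK lef_pV2 ?posrE ?invf_div // divr_gt0.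
Qed.

(** The kernels at [z0] and at 0 differ by [z0 / ((z - z0) * z)], of order [r / S ^+ 2], while the
    perimeter is of order [S]. On a large square the winding integral is thus almost the same for
    all [z0] in the disc. *)
Lemma winding_square S r z0 : 0 < S -> nc z0 <= r -> r <= S / 2 ->
  nc (sq_int S (fun z => (z - z0)^-1) - sq_int S (fun z => (z - 0)^-1)) <= 32 * r / S.
Proof.
move=> S0 hz hr.
have hz2 : nc z0 <= S / 2 by exact: le_trans hr.
have hz1 : nc z0 < S by apply: le_lt_trans hz2 _; lra.
have h0 : nc (0 : C) < S by rewrite Normc.normc0.
have c1 := sq_cont_inv hz1; have c2 := sq_cont_inv h0.
rewrite -[X in _ - X]mul1r -mulNr -sq_intM // -sq_intD //; last first.
  by apply: sq_contM => //; exact: sq_cont_cst.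
rewrite (@sq_int_eq S _ (fun z => z0 * ((z - z0)^-1 * (z - 0)^-1))); last first.
  move=> z hz'; have [k1 _] := square_inv_le S0 hz2 hz'.
  have k2 : z - 0 != 0 by rewrite subr0 -nc_gt0; exact: lt_le_trans (on_square_ge S0 hz').
  by move: k2; rewrite subr0 => k2; field; rewrite k1 k2.
have -> : 32 * r / S = 16 * (r * (2 / S * S^-1)) * S by field; rewrite lt0r_neq0.
apply: sq_int_bound => //.
  by apply: sq_contM; [exact: sq_cont_cst|exact: sq_contM].
move=> z hz'; have [_ k1] := square_inv_le S0 hz2 hz'.
rewrite !Normc.normcM; apply: ler_pM => //; rewrite ?mulr_ge0 ?nc_ge0 //.
apply: ler_pM => //; rewrite ?nc_ge0 //.
by rewrite subr0 Normc.normcV lef_pV2 ?posrE //; [exact: on_square_ge|exact: lt_le_trans (on_square_ge S0 hz')].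
Qed.

Lemma entire_bounded r : 0 < r -> exists2 B, 0 < B & forall z, nc z <= r -> nc (f z) <= B.
Proof.
(* With this [S] the winding integral drifts by at most [32 * r / S = 2], half of its lower bound 4.
   Boundedness on the disc is thereby reduced to extreme values on four real segments. *)
move=> r0; pose S := 16 * r; have S0 : 0 < S by rewrite mulr_gt0.
have cf := ccontC_sq_cont S (differentiable_ccontC hf).
have [K K0 hK] := sq_cont_bounded S0 cf.
exists (16 * K); first by rewrite mulr_gt0.
move=> z0 hz; have hr : r <= S / 2 by rewrite /S; move: r0; lra.
have hz2 : nc z0 <= S / 2 by exact: le_trans hr.
have hz1 : nc z0 < S by apply: le_lt_trans hz2 _; lra.
have h1 := winding_square S0 hz hr.
have h2 := sq_int_inv_ge S0.
have h3 : 2 <= nc (sq_int S (fun z => (z - z0)^-1)).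
  have := nc_triangle (sq_int S (fun z => (z - 0)^-1)) (sq_int S (fun z => (z - z0)^-1)).
  rewrite ncB; move: h1 h2; rewrite /S.
  have -> : 32 * r / (16 * r) = 2 by field; rewrite lt0r_neq0.
  lra.
have : nc (sq_int S (fun z => f z * (z - z0)^-1)) <= 16 * (K * (2 / S)) * S.
  apply: sq_int_bound => //; first by apply: sq_contM => //; exact: sq_cont_inv.
  move=> z hz'; have [_ k1] := square_inv_le S0 hz2 hz'.
  by rewrite Normc.normcM; apply: ler_pM; rewrite ?nc_ge0 //; exact: hK.
rewrite -cauchy_square // Normc.normcM.
have -> : 16 * (K * (2 / S)) * S = 32 * K by field; rewrite lt0r_neq0.
have := nc_ge0 (f z0); nra.
Qed.

(* Cauchy's formula on a large square, with the kernel 1/(z - z0) expanded in a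
   geometric series; the square is taken large so that the winding integral of
   1/(z - z0) may be replaced by the constant one of 1/z, of modulus at least 4. *)
Lemma entire_poly_approx r e : 0 < r -> 0 < e ->
  exists p : {poly C}, forall z, nc z <= r -> nc (f z - p.[z]) <= e.
Proof.
move=> r0 e0; have [B B0 hB] := entire_bounded r0.
(* The first term gives [r <= S / 2]. The second makes [B * (32 * r / S)] at most [2 * e], half of
   what division by [I0], of modulus at least 4, allows. *)
pose S := 2 * r + 16 * B * r / e.
have t0 : 0 < 16 * B * r / e by rewrite divr_gt0 // !mulr_gt0.
have S0 : 0 < S by rewrite addr_gt0 // mulr_gt0.
have hr : r <= S / 2 by rewrite /S; lra.
have cf := ccontC_sq_cont S (differentiable_ccontC hf).
have [K K0 hK] := sq_cont_bounded S0 cf.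
have [n hn] : exists n, 8 * K * 2^-1 ^+ n < e / 2.
  have /cvgrPdist_lt/(_ (e / 2)) : geometric (8 * K) (2^-1 : R) n @[n --> \oo] --> 0.
    by apply: cvg_geometric; rewrite ger0_norm // invf_lt1 // ltr1n.
  case; first by rewrite divr_gt0.
  move=> n _ hn; exists n; have := hn n (leqnn n); rewrite /= sub0r normrN.
  by rewrite ger0_norm // mulr_ge0 ?mulr_ge0 ?exprn_ge0 ?invr_ge0 // ltW.
set I0 := sq_int S (fun z => (z - 0)^-1).
have hI := sq_int_inv_ge S0; rewrite -/I0 in hI.
have I00 : I0 != 0 by rewrite -nc_gt0; apply: lt_le_trans hI.
have h0 : nc (0 : C) < S by rewrite Normc.normc0.
have c2 := sq_cont_inv h0.
pose A (k : nat) := sq_int S (fun z => f z * (z - 0)^-1 ^+ k.+1).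
exists (\poly_(k < n) (A k / I0)) => z0 hz.
have hz2 : nc z0 <= S / 2 by exact: le_trans hr.
have hz1 : nc z0 < S by apply: le_lt_trans hz2 _; lra.
have c1 := sq_cont_inv hz1.
set W := sq_int S (fun z => (z - z0)^-1).
have hW : nc (W - I0) <= 32 * r / S by exact: winding_square.
set J := sq_int S (fun z => f z * (z - z0)^-1).
have hJ : f z0 * W = J by exact: cauchy_square.
pose rem z := f z * ((z0 * (z - 0)^-1) ^+ n * (z - z0)^-1).
have cT (k : nat) : sq_cont S (fun z => z0 ^+ k * (f z * (z - 0)^-1 ^+ k.+1)).
  apply: sq_contM; first exact: sq_cont_cst.
  by apply: sq_contM => //; exact: sq_contX.
have [cs Es] := sq_cont_sum (fun k : 'I_n => cT k).
have crem : sq_cont S rem.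
  apply: sq_contM => //; apply: sq_contM => //; apply: sq_contX.
  by apply: sq_contM => //; exact: sq_cont_cst.
have EJ : J = \sum_(k < n) z0 ^+ k * A k + sq_int S rem.
  have Ek (k : 'I_n) : true -> z0 ^+ k * A k =
      sq_int S (fun z => z0 ^+ k * (f z * (z - 0)^-1 ^+ k.+1)).
    by rewrite sq_intM //; apply: sq_contM => //; exact: sq_contX.
  rewrite (eq_bigr _ Ek).
  rewrite -Es -sq_intD //; apply: sq_int_eq => z hz'.
  have k2 : z != 0 by rewrite -nc_gt0; exact: lt_le_trans (on_square_ge S0 hz').
  have [k1 _] := square_inv_le S0 hz2 hz'.
  rewrite /rem subr0.
  have -> : \sum_(i < n) z0 ^+ i * (f z * z^-1 ^+ i.+1) =
     f z * z^-1 * \sum_(i < n) (z0 * z^-1) ^+ i.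
    rewrite mulr_sumr; apply: eq_bigr => i _; rewrite exprMn exprS; ring.
  have : \sum_(i < n) (z0 * z^-1) ^+ i = (1 - (z0 * z^-1) ^+ n) * (z / (z - z0)).
    have k3 : 1 - z0 * z^-1 != 0.
      rewrite -(mulfV k2) -mulrBl mulf_neq0 // invr_eq0 //.
    have k4 : z / (z - z0) = (1 - z0 * z^-1)^-1.
      by rewrite -(mulfV k2) -mulrBl invfM invrK mulrC.
    rewrite k4; apply: (canRL (mulfK k3)).
    by set t := z0 * z^-1; rewrite -[RHS]opprB subrX1; ring.
  move=> ->; set u := (_ ^+ n); field; rewrite k1 k2 //.
have hrem : nc (sq_int S rem) <= 32 * K * 2^-1 ^+ n.
  have -> : 32 * K * 2^-1 ^+ n = 16 * (K * (2^-1 ^+ n * (2 / S))) * S.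
    by field; rewrite lt0r_neq0.
  apply: sq_int_bound => // z hz'; have [_ k1] := square_inv_le S0 hz2 hz'.
  rewrite !Normc.normcM ncX; apply: ler_pM => //; rewrite ?mulr_ge0 ?exprn_ge0 ?nc_ge0 //.
    exact: hK.
  apply: ler_pM => //; rewrite ?exprn_ge0 ?nc_ge0 //.
  apply: lerXn2r; rewrite ?nnegrE ?nc_ge0 ?invr_ge0 //.
  have k2 := on_square_ge S0 hz'.
  rewrite Normc.normcM Normc.normcV subr0 ler_pdivrMr; last exact: lt_le_trans k2.
  apply: le_trans hz2 _; rewrite mulrC; move: k2; lra.
have -> : f z0 - (\poly_(k < n) (A k / I0)).[z0] =
   (f z0 * (I0 - W) + sq_int S rem) / I0.
  rewrite horner_poly mulrBr hJ EJ.
  have -> : \sum_(i < n) A i / I0 * z0 ^+ i = (\sum_(k < n) z0 ^+ k * A k) / I0.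
    by rewrite mulr_suml; apply: eq_bigr => i _; ring.
  by field.
rewrite Normc.normcM Normc.normcV ler_pdivrMr; last by apply: lt_le_trans hI.
apply: (@le_trans _ _ (e * 4)); last by rewrite ler_pM2l.
apply: le_trans (le_normcD _ _) _.
rewrite Normc.normcM (ncB I0) [e * 4](_ : _ = e * 2 + e * 2); last by ring.
apply: lerD; last by move: hrem hn; lra.
apply: (@le_trans _ _ (B * (32 * r / S))).
  by apply: ler_pM; rewrite ?nc_ge0 //; exact: hB.
rewrite mulrA ler_pdivrMr // /S.
have -> : e * 2 * (2 * r + 16 * B * r / e) = 4 * r * e + B * (32 * r).
  by field; rewrite lt0r_neq0.
by rewrite lerDr !mulr_ge0 // ltW.
Qed.

End Approximation.

Lemma entire_differentiable f : entire f -> differentiable_everywhere f.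
Proof.
move=> hf z; have := hf z; rewrite /holo_at => /cvg_ex [l /= hl].
exists l => e e0.
have e0' : 0 < e%:C by rewrite ltcR.
have /cvgrPdist_le/(_ _ e0') := hl.
move=> /nbhs_ballP[d /= d0 hd].
(* Radii of balls in [R[i]] are themselves complex numbers; positivity forces the imaginary part of
   [d] to vanish. *)
exists (complex.Re d).
  by move: d0; rewrite ltcE /= => /andP[_].
move=> w hw; have [->|wz] := eqVneq w z.
  by rewrite !subrr mulr0 subrr Normc.normc0 mulr0.
have wz0 : w - z != 0 by rewrite subr_eq0.
have := hd (w - z); rewrite /= /ball /= sub0r normrN.
have dR : d = (complex.Re d)%:C.
  by move: d0; rewrite ltcE /= => /andP[/eqP E _]; apply: complex_ext.
have -> : `|w - z| = (nc (w - z))%:C by rewrite normc_def; case: (w - z).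
rewrite {1}dR ltcR => /(_ hw wz0).
rewrite (_ : (w - z) *: 1 + z = w); last by rewrite /GRing.scale /= mulr1 subrK.
have -> : l - (w - z)^-1 *: (f w - f z) = - ((f w - f z - l * (w - z)) / (w - z)).
  by rewrite /GRing.scale /=; field.
rewrite normrN (_ : forall u : C, `|u| = (nc u)%:C); last first.
  by move=> u; rewrite normc_def; case: u.
rewrite lecR Normc.normcM Normc.normcV ler_pdivrMr // nc_gt0 //.
Qed.

End CauchyOnSquares.

(** * Chebyshev interpolation in one variable *)

Section ChebyshevBasis.
Variables (K : fieldType) (t : nat -> {poly K}).
Hypothesis K2 : 2%:R != 0 :> K.
Hypotheses (t0 : t 0%N = 1) (t1 : t 1%N = 'X).
Hypothesis tS : forall n, t n.+2 = 2%:R *: ('X * t n.+1) - t n.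

(** The basis is any sequence with the Chebyshev recurrence, so that the expansion serves the real
    polynomials and their complex images alike. *)
Definition cheb_span n (p : {poly K}) : Prop :=
  exists a : nat -> K, p = \sum_(i < n) a i *: t i.

Lemma cheb_spanD n p q : cheb_span n p -> cheb_span n q -> cheb_span n (p + q).
Proof.
move=> [a ->] [b ->]; exists (fun i => a i + b i).
by rewrite -big_split; apply: eq_bigr => i _; rewrite scalerDl.
Qed.

Lemma cheb_spanZ n c p : cheb_span n p -> cheb_span n (c *: p).
Proof.
move=> [a ->]; exists (fun i => c * a i).
by rewrite scaler_sumr; apply: eq_bigr => i _; rewrite scalerA.
Qed.

Lemma cheb_span0 n : cheb_span n 0.
Proof. by exists (fun=> 0); rewrite big1 // => i _; rewrite scale0r. Qed.

Lemma cheb_span_t n i : (i < n)%N -> cheb_span n (t i).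
Proof.
move=> h; exists (fun j => (j == i)%:R).
rewrite (bigD1 (Ordinal h)) //= eqxx scale1r big1 ?addr0 // => j /negPf hj.
by rewrite -val_eqE /= in hj; rewrite hj scale0r.
Qed.

Lemma cheb_span_mulX n p : cheb_span n p -> cheb_span n.+1 ('X * p).
Proof.
move=> [a ->]; rewrite mulr_sumr; apply: big_ind.
- exact: cheb_span0.
- exact: cheb_spanD.
move=> [i hi] _ /=; rewrite -scalerAr; apply: cheb_spanZ.
case: i hi => [|i] hi; first by rewrite t0 mulr1 -t1; apply: cheb_span_t.
have -> : 'X * t i.+1 = 2%:R^-1 *: (t i.+2 + t i).
  by rewrite tS subrK scalerA mulVf // scale1r.
by apply: cheb_spanZ; apply: cheb_spanD; apply: cheb_span_t => //; lia.
Qed.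

Lemma cheb_expansion n (p : {poly K}) : (size p <= n)%N -> cheb_span n p.
Proof.
elim: n p => [|n IH] p hp.
  have -> : p = 0 by apply/eqP; rewrite -size_poly_leq0.
  exact: cheb_span0.
have E : p = 'X * drop_poly 1 p + p`_0 *: t 0%N.
  rewrite -{1}(poly_take_drop 1 p) addrC expr1 mulrC; congr (_ + _).
  apply/polyP => i; rewrite coef_take_poly coefZ t0 coef1.
  by case: i => [|i] /=; rewrite ?mulr1 ?mulr0.
rewrite E; apply: cheb_spanD; last by apply: cheb_spanZ; exact: cheb_span_t.
by apply: cheb_span_mulX; apply: IH; rewrite size_drop_poly; lia.
Qed.

End ChebyshevBasis.

(** * Chebyshev nodes and aliasing *)

Section ChebyshevNodes.
Variable R : realType.
Local Notation T := (@chebyshev_poly R).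
Implicit Types (n i k N : nat).

Lemma chebyshev_polySS n : T n.+2 = 2%:R *: ('X * T n.+1) - T n.
Proof. by []. Qed.

Lemma nat_ind2 (P : nat -> Prop) :
  P 0%N -> P 1%N -> (forall n, P n -> P n.+1 -> P n.+2) -> forall n, P n.
Proof.
by move=> h0 h1 hS n; elim: n {-2}n (leqnn n) => [[]//|n IH [|[|m]] // hm];
  apply: hS; apply: IH; lia.
Qed.

Lemma chebyshev_cos n (x : R) : (T n).[cos x] = cos (n%:R * x).
Proof.
elim/nat_ind2: n => [||n h0 h1].
- by rewrite /= hornerC mul0r cos0.
- by rewrite /= hornerX mul1r.
rewrite chebyshev_polySS hornerD hornerN hornerZ hornerM hornerX h0 h1.
have -> : n.+2%:R * x = n.+1%:R * x + x by rewrite -[n.+2]addn1 natrD mulrDl mul1r.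
have -> : n%:R * x = n.+1%:R * x - x by rewrite -[n.+1]addn1 natrD mulrDl mul1r addrK.
rewrite cosB cosD; ring.
Qed.

Lemma chebyshev_le1 n (x : R) : -1 <= x <= 1 -> `|(T n).[x]| <= 1.
Proof.
move=> hx; rewrite -(@acosK R x); last by rewrite in_itv.
by rewrite chebyshev_cos; exact: cos_max.
Qed.

Lemma size_chebyshev n : (size (T n) <= n.+1)%N /\ (T n)`_n != 0.
Proof.
elim/nat_ind2: n => [||n [s0 _] [s1 c1]].
- by rewrite /= size_poly1 coef1 eqxx oner_neq0.
- by rewrite /= size_polyX coefX eqxx oner_neq0.
rewrite chebyshev_polySS; split.
  rewrite (leq_trans (size_polyD _ _)) // geq_max size_polyN; apply/andP; split; last exact: leqW (leqW s0).
  rewrite (leq_trans (size_scale_leq _ _)) // (leq_trans (size_polyMleq _ _)) //.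
  by rewrite size_polyX.
rewrite coefB coefZ coefXM /= [(T n)`_ _]nth_default ?subr0; last exact: leqW s0.
by rewrite mulf_neq0 // pnatr_eq0.
Qed.

Definition cheb_angle N (j : nat) : R := (j.*2.+1)%:R * pi / (N.*2)%:R.
Definition cheb_node N (j : nat) : R := cos (cheb_angle N j).

Lemma cheb_angle_itv N j : (j < N)%N -> cheb_angle N j \in `[0, pi].
Proof.
move=> h; rewrite in_itv /= /cheb_angle; apply/andP; split.
  by rewrite divr_ge0 // mulr_ge0 // pi_ge0.
rewrite ler_pdivrMr ?ltr0n; last by lia.
by rewrite mulrC ler_pM2l ?pi_gt0 // ler_nat; lia.
Qed.

Lemma cheb_node_inj N : {in gtn N &, injective (cheb_node N)}.
Proof.
move=> i j hi hj; rewrite !unfold_in /= in hi hj => /cos_inj.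
move=> /(_ (cheb_angle_itv hi) (cheb_angle_itv hj)); rewrite /cheb_angle => h.
have k0 : pi / (N.*2)%:R != 0 :> R.
  rewrite mulf_neq0 ?invr_eq0 ?pnatr_eq0 ?lt0r_neq0 ?pi_gt0 //.
  by rewrite -lt0n; lia.
move: h; rewrite -!mulrA => /(mulIf k0)/eqP; rewrite eqr_nat => /eqP; lia.
Qed.

Lemma cheb_node_itv N j : -1 <= cheb_node N j <= 1.
Proof. by rewrite cos_geN1 cos_le1. Qed.

Lemma cos_cheb_angle N j : (0 < N)%N -> cos (N%:R * cheb_angle N j) = 0.
Proof.
move=> N0; have -> : N%:R * cheb_angle N j = pi / 2 + j%:R * pi.
  rewrite /cheb_angle -!muln2 -[(j * 2).+1]addn1 natrD !natrM.
  by field; rewrite pnatr_eq0 -lt0n.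
elim: j => [|j IH]; first by rewrite mul0r addr0 cos_pihalf.
have -> : j.+1%:R * pi = j%:R * pi + pi :> R by rewrite -natr1; ring.
by rewrite addrA cosDpi IH oppr0.
Qed.

(** At the angles of the nodes the cosine of the [N]-fold angle vanishes, so index [N + k] folds to
    [N - k] with a change of sign, and [T N] itself vanishes. The bound [r <= i] later ensures that
    a coefficient of index [k] receives contributions only from degrees at least [k]. *)
Lemma cheb_alias N i : (0 < N)%N -> exists (s : R) (r : nat),
  [/\ `|s| <= 1, (r < N)%N, (r <= i)%N, (i < N)%N -> s = 1 /\ r = i
    & forall j, (T i).[cheb_node N j] = s * (T r).[cheb_node N j]].
Proof.
move=> N0; elim: i {-2}i (leqnn i) => [|m IH] i him.
  have -> : i = 0%N by lia.
  by exists 1, 0%N; split=> //; [rewrite normr1|move=> j; rewrite mul1r].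
have key k j : cos ((N + k)%:R * cheb_angle N j) + cos (k%:R * cheb_angle N j - N%:R * cheb_angle N j) = 0.
  by rewrite natrD mulrDl cosD cosB cos_cheb_angle //; ring.
case: (ltnP i N) => hiN.
  by exists 1, i; split=> //; [rewrite normr1|move=> j; rewrite mul1r].
(* Beyond [2 * N] the folding leads to index [i - 2 * N] with the opposite sign, where the induction
   hypothesis takes over. *)
case: (leqP i (N + N)) => hi2; last first.
  have [|s [r [h1 h2 h3 h4 h5]]] := IH (i - N - N)%N; first by lia.
  exists (- s), r; split=> //; rewrite ?normrN //; first by lia.
  move=> j; rewrite mulNr -h5 /cheb_node !chebyshev_cos.
  have := key (i - N)%N j; rewrite subnKC // -mulrBl -natrB; last by lia.
  by move/eqP; rewrite addr_eq0 => /eqP.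
case: (eqVneq i N) => [->|hneq].
  exists 0, 0%N; split=> //; first by rewrite normr0.
  by move=> j; rewrite mul0r /cheb_node chebyshev_cos cos_cheb_angle.
exists (-1), (N - (i - N))%N; split; rewrite ?normrN ?normr1 //; [by lia|by lia|].
move=> j; rewrite mulN1r /cheb_node !chebyshev_cos.
have := key (i - N)%N j; rewrite subnKC // -(cosN (_ - _)) opprB -mulrBl -natrB; last by lia.
by move/eqP; rewrite addr_eq0 => /eqP.
Qed.

Lemma root_chebyshev N x : (0 < N)%N ->
  root (T N) x <-> exists2 j : 'I_N, true & x = cheb_node N j.
Proof.
move=> N0; split; last first.
  by case=> j _ ->; rewrite /root /cheb_node chebyshev_cos cos_cheb_angle.
move=> hx; apply: contrapT => hn.
pose s := x :: [seq cheb_node N j | j <- iota 0 N].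
have us : uniq s.
  rewrite /= map_inj_in_uniq ?iota_uniq ?andbT.
    apply/mapP => -[j]; rewrite mem_iota => /andP[_ hj] E.
    by apply: hn; exists (Ordinal hj).
  by move=> i j; rewrite !mem_iota /= !add0n => hi hj; apply: cheb_node_inj.
have as_ : all (root (T N)) s.
  rewrite /= hx; apply/allP => _ /mapP[j _ ->].
  by rewrite /root /cheb_node chebyshev_cos cos_cheb_angle.
have [h1 h2] := size_chebyshev N.
have TN0 : T N != 0 by apply: contra h2 => /eqP ->; rewrite coef0.
have := max_poly_roots TN0 as_ us; rewrite /= size_map size_iota ltnNge.
by move=> /negP; apply; exact: leq_trans h1 _.
Qed.

Definition cheb_mx N : 'M[R]_N := \matrix_(j < N, k < N) (T k).[cheb_node N j].

(** The Lagrange polynomials of the nodes, expanded in the Chebyshev basis, are the columns of a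
    right inverse. *)
Lemma cheb_mx_unit N : cheb_mx N \in unitmx.
Proof.
pose L (i : 'I_N) : {poly R} := \prod_(j < N | j != i)
  ((cheb_node N i - cheb_node N j)^-1 *: ('X - (cheb_node N j)%:P)).
have sL (i : 'I_N) : (size (L i) <= N)%N.
  have : (size (L i) <= (\sum_(j < N | j != i) 1).+1)%N.
    rewrite /L; elim/big_rec2: _ => [|j y p _ hp]; first by rewrite size_poly1.
    rewrite (leq_trans (size_polyMleq _ _)) //.
    have hA : (size ((cheb_node N i - cheb_node N j)^-1 *: ('X - (cheb_node N j)%:P)) <= 2)%N.
      by rewrite (leq_trans (size_scale_leq _ _)) // size_XsubC.
    by rewrite -subn1 leq_subLR (leq_trans (leq_add hA hp)).
  rewrite sum1_card => /leq_trans; apply.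
  have -> : #|[pred j | j != i]| = N.-1 by rewrite -[in RHS](card_ord N) -(cardC1 i).
  by rewrite prednK //; apply: leq_ltn_trans (ltn_ord i).
have hL (i j : 'I_N) : (L i).[cheb_node N j] = (i == j)%:R.
  rewrite /L horner_prod; have [<-|nij] := eqVneq i j.
    rewrite big1 // => k hk; rewrite !hornerE mulVf // subr_eq0.
    apply: contra hk => /eqP E; apply/eqP/val_inj; apply: (@cheb_node_inj N) => //;
      by rewrite unfold_in /=.
  by rewrite (bigD1 j) /= 1?eq_sym // !hornerE subrr mulr0 mul0r.
have ex (i : 'I_N) := cheb_expansion (_ : 2%:R != 0 :> R) (erefl : T 0 = 1) (erefl : T 1 = 'X)
  chebyshev_polySS (sL i).
have [|a ha] := @choice _ _ (fun (i : 'I_N) (a : nat -> R) => L i = \sum_(k < N) a k *: T k).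
  by move=> i; apply: ex; rewrite pnatr_eq0.
have : cheb_mx N *m (\matrix_(k < N, i < N) a i k) = 1%:M.
  apply/matrixP => j i; rewrite !mxE.
  have <- : (L i).[cheb_node N j] = (j == i)%:R by rewrite hL eq_sym.
  rewrite ha horner_sum; apply: eq_bigr => k _; rewrite !mxE hornerZ; ring.
by move/mulmx1_unit => [].
Qed.

(* [cheb_coef_mx N k j] is the weight of the value at the [j]-th node in the
   [k]-th coefficient of the interpolant. *)
Definition cheb_coef_mx N : 'M[R]_N := invmx (cheb_mx N).

Lemma cheb_coef_mxK N (k r : 'I_N) :
  \sum_(j < N) cheb_coef_mx N k j * (T r).[cheb_node N j] = (k == r)%:R.
Proof.
have := mulVmx (cheb_mx_unit N) => /matrixP/(_ k r); rewrite !mxE => <-.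
by apply: eq_bigr => j _; rewrite !mxE.
Qed.

End ChebyshevNodes.

(** * Complex numbers of modulus one and roots of unity *)

Section ExpI.
Variable R : realType.
Local Notation C := R[i].
Local Notation nc := (@Normc.normc R).

Lemma expiD (s t : R) : expi (s + t) = expi s * expi t.
Proof.
by apply: complex_ext; rewrite (ReM, ImM) /= ?cosD ?sinD; ring.
Qed.

Lemma expi0 : expi (0 : R) = 1.
Proof. by rewrite /expi cos0 sin0. Qed.

Lemma expiN (t : R) : expi (- t) = (expi t)^-1.
Proof.
have h : expi (- t) * expi t = 1 by rewrite -expiD addNr expi0.
have n0 : expi t != 0.
  by apply/eqP => E; move: h; rewrite E mulr0 => /eqP; rewrite eq_sym oner_eq0.
by apply: (mulIf n0); rewrite h mulVf.
Qed.

Lemma expi_neq0 (t : R) : expi t != 0.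
Proof.
have h : expi (- t) * expi t = 1 by rewrite -expiD addNr expi0.
by apply/eqP => E; move: h; rewrite E mulr0 => /eqP; rewrite eq_sym oner_eq0.
Qed.

Lemma expiX (t : R) n : expi t ^+ n = expi (n%:R * t).
Proof.
elim: n => [|n IH]; first by rewrite mul0r expi0 expr0.
by rewrite exprS IH -expiD; congr expi; rewrite -natr1; ring.
Qed.

Lemma nc_expi (t : R) : nc (expi t) = 1.
Proof. by rewrite /= cos2Dsin2 sqrtr1. Qed.

Lemma expi_eq1 (t : R) : 0 < t < pi *+ 2 -> expi t != 1.
Proof.
move=> ht; apply/eqP => -[h _].
have : 0 < sin (t / 2).
  by apply: sin_gt0_pi; move: ht; rewrite mulr2n; lra.
have : cos (t / 2 *+ 2) = cos t by congr cos; rewrite mulr2n -splitr.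
rewrite cos_mulr2n h mulr2n cos2sin2; nra.
Qed.

Definition unit_root n : C := expi (pi *+ 2 / n%:R).

Lemma sum_unit_root n e : (0 < n)%N ->
  \sum_(k < n) unit_root n ^+ (k * e) = if (n %| e)%N then n%:R else 0.
Proof.
move=> n0; have wn : unit_root n ^+ n = 1.
  rewrite expiX mulrC divfK ?pnatr_eq0 -?lt0n // /expi.
  by rewrite cos2pi sin2pi.
under eq_bigr => k _ do rewrite mulnC exprM.
case: ifPn => h.
  have we : unit_root n ^+ e = 1 by rewrite -(divnK h) mulnC exprM wn expr1n.
  under eq_bigr => k _ do rewrite we expr1n.
  by rewrite sumr_const card_ord.
have w1 : unit_root n ^+ e != 1.
  rewrite (divn_eq e n) exprD mulnC exprM wn expr1n mul1r expiX.
  apply: expi_eq1; have h1 : (0 < e %% n)%N by rewrite lt0n.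
  have h2 : (e %% n < n)%N by rewrite ltn_mod.
  have p0 : 0 < pi *+ 2 :> R by rewrite mulrn_wgt0 // pi_gt0.
  have nR : 0 < n%:R :> R by rewrite ltr0n.
  apply/andP; split; first by rewrite mulr_gt0 ?ltr0n // divr_gt0.
  by rewrite mulrCA gtr_pMr // ltr_pdivrMr // mul1r ltr_nat.
have : (unit_root n ^+ e - 1) * \sum_(k < n) (unit_root n ^+ e) ^+ k = 0.
  by rewrite -subrX1 -exprM mulnC exprM wn expr1n subrr.
by move/eqP; rewrite mulf_eq0 subr_eq0 (negPf w1) /= => /eqP.
Qed.

End ExpI.

(** * Chebyshev coefficients from values on an ellipse *)

Section ChebyshevCoefficients.
Variable R : realType.
Local Notation C := R[i].
Local Notation nc := (@Normc.normc R).
Local Notation T := (@chebyshev_poly R).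
Local Arguments Normc.normc : simpl never.

Definition TC k : {poly C} := map_poly (real_complex R) (T k).

Lemma TCR k (x : R) : (TC k).[x%:C] = ((T k).[x])%:C.
Proof. exact: horner_map. Qed.

Lemma TC0 : TC 0 = 1. Proof. by rewrite /TC /= rmorph1. Qed.
Lemma TC1 : TC 1 = 'X. Proof. by rewrite /TC /= map_polyX. Qed.
Lemma TCSS n : TC n.+2 = 2%:R *: ('X * TC n.+1) - TC n.
Proof.
rewrite /TC chebyshev_polySS rmorphB /= map_polyZ /= rmorphM /= map_polyX.
by rewrite rmorph_nat.
Qed.

Lemma C2 : 2%:R != 0 :> C. Proof. by rewrite pnatr_eq0. Qed.

Lemma TC_joukowski n (w : C) : w != 0 ->
  (TC n).[(w + w^-1) / 2%:R] = (w ^+ n + w^-1 ^+ n) / 2%:R.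
Proof.
move=> w0.
elim/nat_ind2: n => [||n h0 h1].
- by rewrite TC0 hornerC !expr0; field.
- by rewrite TC1 hornerX !expr1.
rewrite TCSS hornerD hornerN hornerZ hornerM hornerX h0 h1 !exprS.
by field.
Qed.

Definition jouk (rho t : R) : C :=
  (rho%:C * expi t + (rho^-1)%:C * expi (- t)) / 2%:R.

(** On the ellipse [T m] combines the frequencies [m] and [- m] with weights [rho ^+ m / 2] and
    [rho ^- m / 2]. Averaging over roots of unity against the frequency [- i] isolates
    [a i * rho ^+ i / 2], hence the factor 2; for [i = 0] the two frequencies coincide and add
    up. *)
Lemma cheb_coef_bound D (a : nat -> C) (rho M : R) : 0 < rho ->
  (forall t, 0 <= t <= 2 * pi ->
     nc (\sum_(i < D) a i * (TC i).[jouk rho t]) <= M) ->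
  forall i, (i < D)%N -> nc (a i) <= 2 * M / rho ^+ i.
Proof.
(* [n] exceeds every sum of two indices below [D], so distinct frequencies remain distinct modulo
   [n]. Moreover the inverse of [w] is [w ^+ (2 * D)], which turns negative frequencies into natural
   exponents. *)
move=> r0 H i hi; pose n := (2 * D).+1; pose w := unit_root R n.
have rC0 : rho%:C != 0 :> C by rewrite eq_complex /= eqxx andbT lt0r_neq0.
pose J (k : nat) := jouk rho (k%:R * (pi *+ 2 / n%:R)).
have wn : w ^+ n = 1.
  by rewrite expiX mulrC divfK ?pnatr_eq0 // /expi cos2pi sin2pi.
have wX k : expi (k%:R * (pi *+ 2 / n%:R)) = w ^+ k by rewrite expiX.
have w0 : w != 0 by exact: expi_neq0.
have JE k : J k = (rho%:C * w ^+ k + (rho%:C * w ^+ k)^-1) / 2%:R.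
  by rewrite /J /jouk expiN wX invfM fmorphV.
have TJ m k : (TC m).[J k] = (rho%:C ^+ m * w ^+ (k * m) +
    rho%:C ^- m * w ^+ (k * (2 * D * m))) / 2%:R.
  rewrite JE TC_joukowski; last by rewrite mulf_neq0 // expf_neq0.
  rewrite !exprMn !exprVn exprMn invfM -!exprM; congr ((_ + _ * _) / _).
  apply: (mulfI (expf_neq0 (k * m) w0)); rewrite mulfV ?expf_neq0 //.
  rewrite -exprD; have -> : (k * m + k * (2 * D * m) = n * (k * m))%N.
    by rewrite /n; ring.
  by rewrite exprM wn expr1n.
pose P k := \sum_(m < D) a m * (TC m).[J k].
pose S := \sum_(k < n) P k * w ^+ (k * (n - i)).
have hn : (0 < n)%N by [].
have ES : S = n%:R * (a i * (rho%:C ^+ i + (i == 0)%:R) / 2%:R).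
  rewrite /S /P.
  under eq_bigr => k _ do rewrite mulr_suml.
  rewrite exchange_big /=.
  have E (m : 'I_D) : \sum_(k < n) a m * (TC m).[J k] * w ^+ (k * (n - i)) =
     a m * (rho%:C ^+ m * (if (n %| m + (n - i))%N then n%:R else 0) +
            rho%:C ^- m * (if (n %| 2 * D * m + (n - i))%N then n%:R else 0)) / 2%:R.
    rewrite -!sum_unit_root // !mulr_sumr -big_split /= mulr_sumr mulr_suml.
    apply: eq_bigr => k _; rewrite TJ !mulnDr !exprD.
    move: (w ^+ (k * m)) (w ^+ (k * (n - i))) (w ^+ (k * (2 * D * m))) => x y z.
    by rewrite -/w; field; rewrite expf_neq0.
  rewrite (eq_bigr _ (fun m _ => E m)) (bigD1 (Ordinal hi)) //= big1 ?addr0.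
    rewrite subnKC ?dvdnn; last by rewrite /n; lia.
    have -> : (n %| 2 * D * i + (n - i))%N = (i == 0%N).
      apply/idP/eqP => [h|->]; last by rewrite muln0 add0n subn0 dvdnn.
      have h' : (n %| i + i)%N.
        have e1 : (2 * D * i + (n - i) + (i + i) = n * i.+1)%N by rewrite /n; nia.
        by rewrite -(dvdn_addr _ h) e1 dvdn_mulr.
      case: (posnP i) => // i0; have := @dvdn_leq n (i + i).
      by rewrite addn_gt0 i0 => /(_ isT h'); rewrite /n; lia.
    case: eqP => [->|_]; rewrite ?expr0 ?mulr0 ?addr0; last by ring.
    have -> : true%:R = 1 :> C by [].
    by rewrite invr1; ring.
  move=> m hm; have hmi : m <> i :> nat by move=> e; move/eqP: hm; apply; apply: val_inj.
  have -> : (n %| m + (n - i))%N = false.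
    apply/negP => h; have hm' := ltn_ord m.
    case: (ltnP m i) => hh.
      by move: h => /dvdn_leq; rewrite /n; lia.
    have : (n %| m - i)%N.
      have e1 : (m + (n - i) = n + (m - i))%N by rewrite /n; lia.
      by rewrite -(dvdn_addr _ (dvdnn n)) -e1.
    by move/dvdn_leq; rewrite /n; lia.
  have -> : (n %| 2 * D * m + (n - i))%N = false.
    apply/negP => h; have hm' := ltn_ord m.
    have h' : (n %| i + m)%N.
      have e1 : (2 * D * m + (n - i) + (i + m) = n * m.+1)%N by rewrite /n; nia.
      by rewrite -(dvdn_addr _ h) e1 dvdn_mulr.
    by move/dvdn_leq: h'; rewrite /n; lia.
  by rewrite !mulr0 addr0 mulr0 mul0r.
have nS : nc S <= n%:R * M.
  apply: le_trans (nc_sum _ _ _) _.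
  apply: (@le_trans _ _ (\sum_(k < n) M)); last by rewrite sumr_const card_ord mulr_natl.
  apply: ler_sum => k _; rewrite Normc.normcM ncX nc_expi expr1n mulr1.
  apply: H; apply/andP; split.
    by rewrite mulr_ge0 // divr_ge0 // mulrn_wge0 // pi_ge0.
  rewrite mulrCA -(mulr_natl pi) -[leRHS]mulr1; apply: ler_wpM2l.
    by rewrite mulr_ge0 // pi_ge0.
  by rewrite ler_pdivrMr ?ltr0n // mul1r ler_nat ltnW.
have nR : 0 < n%:R :> R by rewrite ltr0n.
move: nS; rewrite ES !Normc.normcM Normc.normcV.
have ncn k : nc (k%:R : C) = k%:R.
  by rewrite -(rmorph_nat (real_complex R)) ncR ger0_norm.
rewrite !ncn ler_pM2l // ler_pdivrMr // => h.
have e0 : 0 <= (i == 0)%:R :> R by [].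
have : nc (rho%:C ^+ i + (i == 0)%:R) = rho ^+ i + (i == 0)%:R.
  rewrite -(rmorph_nat (real_complex R)) -rmorphXn -rmorphD ncR ger0_norm //.
  by rewrite addr_ge0 // exprn_ge0 // ltW.
move=> E; rewrite E in h.
rewrite ler_pdivlMr ?exprn_gt0 // mulrC.
have := nc_ge0 (a i); move: h; rewrite mulrDr => h k.
have := mulr_ge0 k e0; lra.
Qed.

End ChebyshevCoefficients.

(** * Locally uniform limits of polynomials *)

Section PolyApprox.
Variable R : realType.
Local Notation C := R[i].
Local Notation nc := (@Normc.normc R).
Local Arguments Normc.normc : simpl never.
Implicit Types h g : C -> C.

Definition poly_approx h := forall r e : R, 0 < r -> 0 < e ->
  exists p : {poly C}, forall z, nc z <= r -> nc (h z - p.[z]) <= e.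

Lemma entire_approx h : entire h -> poly_approx h.
Proof.
by move=> hh r e; apply: entire_poly_approx; exact: entire_differentiable.
Qed.

Lemma poly_approx_cst (c : C) : poly_approx (fun=> c).
Proof.
by move=> r e _ e0; exists c%:P => z _; rewrite hornerC subrr Normc.normc0 ltW.
Qed.

Lemma poly_approx_id : poly_approx id.
Proof.
by move=> r e _ e0; exists 'X => z _; rewrite hornerX subrr Normc.normc0 ltW.
Qed.

Lemma poly_approxD h g : poly_approx h -> poly_approx g ->
  poly_approx (fun z => h z + g z).
Proof.
move=> hh hg r e r0 e0; have e2 : 0 < e / 2 by rewrite divr_gt0.
have [p hp] := hh r _ r0 e2; have [q hq] := hg r _ r0 e2.
exists (p + q) => z hz; rewrite hornerD.
have -> : h z + g z - (p.[z] + q.[z]) = (h z - p.[z]) + (g z - q.[z]) by ring.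
apply: le_trans (le_normcD _ _) _; rewrite [e]splitr.
by apply: lerD; [exact: hp|exact: hq].
Qed.

Lemma horner_bounded (p : {poly C}) r : 0 < r ->
  exists2 B, 0 < B & forall z, nc z <= r -> nc p.[z] <= B.
Proof.
move=> r0; exists (\sum_(i < size p) nc p`_i * r ^+ i + 1).
  by rewrite ltr_wpDl // sumr_ge0 // => i _; rewrite mulr_ge0 ?nc_ge0 // exprn_ge0 // ltW.
move=> z hz; rewrite horner_coef; apply: le_trans (nc_sum _ _ _) _.
apply: (@le_trans _ _ (\sum_(i < size p) nc p`_i * r ^+ i)); last by rewrite lerDl.
apply: ler_sum => i _; rewrite Normc.normcM ncX; apply: ler_wpM2l; first exact: nc_ge0.
by apply: lerXn2r; rewrite ?nnegrE ?nc_ge0 // ltW.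
Qed.

Lemma poly_approx_bounded h r : poly_approx h -> 0 < r ->
  exists2 B, 0 < B & forall z, nc z <= r -> nc (h z) <= B.
Proof.
move=> hh r0; have [p hp] := hh r 1 r0 ltr01; have [B B0 hB] := horner_bounded p r0.
exists (B + 1); first by rewrite addr_gt0.
move=> z hz; apply: le_trans (nc_triangle _ p.[z]) _.
by apply: lerD; [exact: hB|exact: hp].
Qed.

Lemma poly_approxM h g : poly_approx h -> poly_approx g ->
  poly_approx (fun z => h z * g z).
Proof.
move=> hh hg r e r0 e0.
have [B B0 hB] := poly_approx_bounded hg r0.
have e1 : 0 < e / 2 / B by rewrite !divr_gt0.
have [p hp] := hh r _ r0 e1.
have [B' B'0 hB'] := horner_bounded p r0.
have e2 : 0 < e / 2 / B' by rewrite !divr_gt0.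
have [q hq] := hg r _ r0 e2.
exists (p * q) => z hz; rewrite hornerM.
have -> : h z * g z - p.[z] * q.[z] = (h z - p.[z]) * g z + p.[z] * (g z - q.[z]) by ring.
apply: le_trans (le_normcD _ _) _; rewrite !Normc.normcM [e]splitr; apply: lerD.
  have -> : e / 2 = e / 2 / B * B by rewrite divfK // lt0r_neq0.
  by apply: ler_pM; rewrite ?nc_ge0 //; [exact: hp|exact: hB].
have -> : e / 2 = B' * (e / 2 / B') by rewrite [RHS]mulrC divfK // lt0r_neq0.
by apply: ler_pM; rewrite ?nc_ge0 //; [exact: hB'|exact: hq].
Qed.

Lemma poly_approxX h n : poly_approx h -> poly_approx (fun z => h z ^+ n).
Proof.
move=> hh; elim: n => [|n IH]; first exact: poly_approx_cst.
by under [X in poly_approx X]eq_fun do rewrite exprS; exact: poly_approxM.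
Qed.

Lemma poly_approx_sum n (F : 'I_n -> C -> C) : (forall i, poly_approx (F i)) ->
  poly_approx (fun z => \sum_i F i z).
Proof.
elim: n F => [|n IH] F hF.
  by under [X in poly_approx X]eq_fun do rewrite big_ord0; exact: poly_approx_cst.
under [X in poly_approx X]eq_fun do rewrite big_ord_recl.
by apply: poly_approxD => //; apply: IH => i; exact: hF.
Qed.

(** [K1] expresses continuity of [L] for the sup norm on a disc containing [E]; it may be huge,
    since it disappears in the limit. [K2] is the good constant, known for polynomials in terms of
    [E] alone. *)
Lemma functional_limit (L : (C -> C) -> C) (E : set C) (r K1 K2 M : R) h :
  0 < r -> 0 <= K1 -> 0 <= K2 ->
  (forall z, E z -> nc z <= r) ->
  (forall g g', L (fun z => g z - g' z) = L g - L g') ->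
  (forall g e, 0 <= e -> (forall z, nc z <= r -> nc (g z) <= e) -> nc (L g) <= K1 * e) ->
  (forall (p : {poly C}) M', (forall z, E z -> nc p.[z] <= M') ->
     nc (L (fun z => p.[z])) <= K2 * M') ->
  poly_approx h -> (forall z, E z -> nc (h z) <= M) -> nc (L h) <= K2 * M.
Proof.
move=> r0 K10 K20 Er LB Lc Lp hh hM; apply/ler_addgt0Pl => e e0.
have k0 : 0 < K1 + K2 + 1 by rewrite ltr_wpDl // addr_ge0.
have e1 : 0 < e / (K1 + K2 + 1) by rewrite divr_gt0.
set d := e / (K1 + K2 + 1) in e1.
have [p hp] := hh r d r0 e1.
have h1 : nc (L (fun z => h z - p.[z])) <= K1 * d by apply: Lc => //; exact: ltW.
have h2 : nc (L (fun z => p.[z])) <= K2 * (M + d).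
  apply: Lp => z Ez; apply: le_trans (nc_triangle _ (h z)) _.
  by apply: lerD; [exact: hM|rewrite ncB; apply: hp; exact: Er].
rewrite LB in h1.
apply: le_trans (nc_triangle _ (L (fun z => p.[z]))) _.
have : (K1 + K2 + 1) * d = e by rewrite mulrC divfK // lt0r_neq0.
rewrite !mulrDl mul1r; move: h1 h2; rewrite mulrDr; lra.
Qed.

End PolyApprox.

(** * Interpolation functionals in one variable *)

Section Interpolation1D.
Variable R : realType.
Local Notation C := R[i].
Local Notation nc := (@Normc.normc R).
Local Notation T := (@chebyshev_poly R).
Local Arguments Normc.normc : simpl never.

Definition affine_on (a b : R) : {poly R} := (b - a)^-1 *: (2%:R *: 'X - (b + a)%:P).
Definition node_on N (a b : R) j := (b - a) / 2 * cheb_node R N j + (a + b) / 2.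

Lemma affine_on_node N (a b : R) j : a < b -> (affine_on a b).[node_on N a b j] = cheb_node R N j.
Proof.
move=> ab; rewrite /affine_on /node_on hornerZ hornerD hornerN hornerZ hornerX hornerC.
by field; rewrite subr_eq0 gt_eqF.
Qed.

Lemma affine_on_itv (a b x : R) : a < b -> a <= x <= b -> -1 <= (affine_on a b).[x] <= 1.
Proof.
move=> ab hx; rewrite /affine_on hornerZ hornerD hornerN hornerZ hornerX hornerC.
have k0 : 0 < b - a by rewrite subr_gt0.
by rewrite mulrC ler_pdivrMr // ler_pdivlMr //; move: hx; lra.
Qed.

Lemma chebyshev_on_horner n (a b x : R) :
  (chebyshev_on n a b).[x] = (T n).[(affine_on a b).[x]].
Proof. exact: horner_comp. Qed.

Lemma chebyshev_on_le1 n (a b x : R) : a < b -> a <= x <= b -> `|(chebyshev_on n a b).[x]| <= 1.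
Proof. by move=> ab hx; rewrite chebyshev_on_horner chebyshev_le1 // affine_on_itv. Qed.

Lemma root_chebyshev_on N (a b x : R) : (0 < N)%N -> a < b ->
  root (chebyshev_on N a b) x <-> exists2 j : 'I_N, true & x = node_on N a b j.
Proof.
move=> N0 ab; rewrite /root chebyshev_on_horner.
have [h1 h2] := root_chebyshev (affine_on a b).[x] N0.
split.
  move=> /h1[j _ e]; exists j => //.
  rewrite /node_on -e /affine_on hornerZ hornerD hornerN hornerZ hornerX hornerC.
  by field; rewrite subr_eq0 gt_eqF.
by move=> [j _ e]; apply: h2; exists j => //; rewrite e affine_on_node.
Qed.

Lemma node_on_itv N (a b : R) j : a < b -> a <= node_on N a b j <= b.
Proof.
move=> ab; have /andP[h1 h2] := cheb_node_itv R N j; rewrite /node_on.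
by apply/andP; split; nra.
Qed.

Definition disc_of (rho a b : R) := (b - a) * rho + (`|a| + `|b|) + 1.

Lemma ellipse_disc (rho a b : R) z : a < b -> 1 <= rho -> ellipse_region rho a b z ->
  nc z <= disc_of rho a b.
Proof.
move=> ab rho1 [s /=]; rewrite in_itv /= => /andP[s0 s1] [t _ <-].
have ba : 0 < b - a by rewrite subr_gt0.
have r0 : 0 < rho by apply: lt_le_trans rho1.
apply: le_trans (le_normcD _ _) _.
rewrite !Normc.normcM !Normc.normcV !ncR (ger0_norm s0).
have -> : nc 2%:R = 2 :> R by rewrite -(rmorph_nat (real_complex R)) ncR ger0_norm.
rewrite ger0_norm; last by rewrite divr_ge0 // ltW.
have h1 : nc (rho%:C * expi t + (rho^-1)%:C * expi (- t)) <= rho + rho^-1.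
  apply: le_trans (le_normcD _ _) _; rewrite !Normc.normcM !ncR !nc_expi !mulr1.
  by rewrite !ger0_norm ?invr_ge0 // ltW.
have h2 : rho^-1 <= rho by apply: (le_trans _ rho1); rewrite invf_le1.
have h3 : nc (rho%:C * expi t + (rho^-1)%:C * expi (- t)) / 2 <= rho.
  by rewrite ler_pdivrMr //; move: h1 h2; lra.
have h4 : (b - a) / 2 * (nc (rho%:C * expi t + (rho^-1)%:C * expi (- t)) / 2) <= (b - a) * rho.
  apply: ler_pM; rewrite ?divr_ge0 ?nc_ge0 // ?ltW //; move: ba; lra.
have h5 : `|(a + b) / 2| <= `|a| + `|b|.
  rewrite normrM [`|2^-1|]ger0_norm ?invr_ge0 // ler_pdivrMr //.
  apply: le_trans (ler_normD _ _) _; have := normr_ge0 a; have := normr_ge0 b; lra.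
rewrite /disc_of -addrA; apply: lerD; last by move: h5; lra.
apply: le_trans h4; apply: ler_piMl => //.
by rewrite mulr_ge0 // divr_ge0 ?nc_ge0 // ltW.
Qed.

Lemma disc_of_gt0 (rho a b : R) : a < b -> 1 <= rho -> 0 < disc_of rho a b.
Proof.
move=> ab r1; rewrite ltr_wpDl // addr_ge0 ?addr_ge0 // mulr_ge0 ?subr_ge0 ?ltW //.
exact: lt_le_trans r1.
Qed.

Lemma itv_disc (rho a b x : R) : a < b -> 1 <= rho -> a <= x <= b -> nc x%:C <= disc_of rho a b.
Proof.
move=> ab r1 hx; rewrite ncR /disc_of.
have : 0 <= (b - a) * rho.
  by rewrite mulr_ge0 ?subr_ge0 ?(ltW ab) //; apply: le_trans r1.
have := ler_norm b; have := ler_norm (- a); rewrite normrN => h1 h2 h3.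
have := normr_ge0 a; have := normr_ge0 b => h4 h5.
by rewrite ler_norml; move: hx; lra.
Qed.

Lemma ellipse_jouk (rho a b t : R) : 0 <= t <= 2 * pi ->
  ellipse_region rho a b (((b - a) / 2)%:C * jouk rho t + ((a + b) / 2)%:C).
Proof.
move=> ht; exists 1 => /=; first by rewrite in_itv /= ler01 lexx.
by exists t; rewrite ?in_itv //= mul1r.
Qed.

Lemma tail_geometric (x : R) k D : 0 <= x -> x <= 1 / 2 ->
  \sum_(i < D | (k <= i)%N) x ^+ i <= 2 * x ^+ k.
Proof.
move=> x0 x1.
have xk j : 0 <= x ^+ j by exact: exprn_ge0.
suff : \sum_(i < D | (k <= i)%N) x ^+ i <= 2 * x ^+ k - (if (k <= D)%N then 2 * x ^+ D else 2 * x ^+ k).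
  move/le_trans; apply; rewrite gerBl.
  by case: ifP => _; rewrite mulr_ge0.
elim: D => [|D IH].
  by rewrite big_ord0; case: k => [|k] /=; rewrite subrr.
have -> : \sum_(i < D.+1 | (k <= i)%N) x ^+ i =
    \sum_(i < D | (k <= i)%N) x ^+ i + (if (k <= D)%N then x ^+ D else 0).
  by rewrite big_mkcond big_ord_recr /= -big_mkcond.
have xs : x ^+ D.+1 <= x ^+ D / 2.
  by rewrite exprS mulrC -[x ^+ D / 2]mulr1 -mulrA; apply: ler_wpM2l => //; lra.
case: (ltngtP k D) IH => h; rewrite ?leqnn.
- by rewrite leqW ?(ltnW h) //; move: xs; lra.
- by rewrite addr0; case: ifP => // h'; have -> : D.+1 = k by lia.
- by rewrite h leqnSn; move: xs; lra.
Qed.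

Definition interp_coef N (a b : R) (k : 'I_N) (h : C -> C) : C :=
  \sum_(j < N) (cheb_coef_mx R N k j)%:C * h (node_on N a b j)%:C.

Lemma interp_coefB N a b k g h :
  @interp_coef N a b k (fun z => g z - h z) = interp_coef a b k g - interp_coef a b k h.
Proof.
by rewrite /interp_coef -sumrB; apply: eq_bigr => j _; rewrite mulrBr.
Qed.

Definition coef_norm N (k : 'I_N) : R := \sum_(j < N) `|cheb_coef_mx R N k j|.

Lemma coef_norm_ge0 N (k : 'I_N) : 0 <= coef_norm k.
Proof. by apply: sumr_ge0 => i _. Qed.

Lemma interp_coef_cont N (a b rho : R) (k : 'I_N) g e : a < b -> 1 <= rho -> 0 <= e ->
  (forall z, nc z <= disc_of rho a b -> nc (g z) <= e) ->
  nc (interp_coef a b k g) <= coef_norm k * e.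
Proof.
move=> ab r1 e0 hg; apply: le_trans (nc_sum _ _ _) _; rewrite /coef_norm mulr_suml.
apply: ler_sum => j _; rewrite Normc.normcM ncR; apply: ler_wpM2l => //.
by apply: hg; apply: itv_disc => //; exact: node_on_itv.
Qed.

(** The length [D] depends on [p], but the bounds on the coefficients do not depend on [D]; this is
    what survives the passage to limits. *)
Lemma poly_cheb (p : {poly C}) (a b rho M : R) : a < b -> 0 < rho ->
  (forall z, ellipse_region rho a b z -> nc p.[z] <= M) ->
  exists (D : nat) (c : nat -> C),
    (forall x : R, p.[x%:C] = \sum_(i < D) c i * ((T i).[(affine_on a b).[x]])%:C) /\
    (forall i, (i < D)%N -> nc (c i) <= 2 * M / rho ^+ i).
Proof.
move=> ab r0 hM.
pose q := p \Po (((b - a) / 2)%:C *: 'X + (((a + b) / 2)%:C)%:P).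
have [c hc] := cheb_expansion (C2 R) (TC0 R) (TC1 R) (TCSS R) (leqnn (size q)).
move: (size q) hc => D hc.
have qE (w : C) : p.[((b - a) / 2)%:C * w + ((a + b) / 2)%:C] = \sum_(i < D) c i * (TC R i).[w].
  have : q.[w] = p.[((b - a) / 2)%:C * w + ((a + b) / 2)%:C].
    by rewrite /q horner_comp hornerD hornerZ hornerX hornerC.
  by rewrite hc horner_sum => <-; apply: eq_bigr => i _; rewrite hornerZ.
exists D, c; split.
  move=> x; under eq_bigr => i _ do rewrite -TCR.
  rewrite -qE; congr (p.[_]); rewrite -!rmorphM -rmorphD; congr (_%:C).
  rewrite /affine_on hornerZ hornerD hornerN hornerZ hornerX hornerC.
  by field; rewrite subr_eq0 gt_eqF.
apply: cheb_coef_bound => // t ht; rewrite -qE; apply: hM; exact: ellipse_jouk.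
Qed.

Section Functional.
Variables (N : nat) (a b rho : R).
Hypotheses (N0 : (0 < N)%N) (ab : a < b) (rho2 : 2 <= rho).

Let rho1 : 1 <= rho. Proof. by apply: le_trans rho2; rewrite ler1n. Qed.
Let rho0 : 0 < rho. Proof. exact: lt_le_trans rho1. Qed.
Let irho : 0 <= rho^-1 /\ rho^-1 <= 1 / 2.
Proof.
by split; [rewrite invr_ge0 ltW|rewrite div1r lef_pV2 ?posrE].
Qed.

Lemma interp_coef_T i : exists s (r : 'I_N),
  [/\ `|s| <= 1, (r <= i)%N, (i < N)%N -> s = 1 /\ r = i :> nat
    & forall k, interp_coef a b k
        (fun z => (TC R i \Po map_poly (real_complex R) (affine_on a b)).[z])
      = (s * (k == r)%:R)%:C].
Proof.
have [s [r [h1 h2 h3 h4 h5]]] := cheb_alias R i N0.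
exists s, (Ordinal h2); split=> // k.
rewrite /interp_coef -(cheb_coef_mxK R k (Ordinal h2)) mulr_sumr rmorph_sum /=.
apply: eq_bigr => j _; rewrite horner_comp horner_map /= TCR -rmorphM.
by congr (_%:C); rewrite affine_on_node // h5 mulrCA.
Qed.

Lemma interp_coef_sum D (c : nat -> C) (k : 'I_N) (p : {poly C}) :
  (forall x : R, p.[x%:C] = \sum_(i < D) c i * ((T i).[(affine_on a b).[x]])%:C) ->
  interp_coef a b k (fun z => p.[z]) = \sum_(i < D) c i *
    interp_coef a b k (fun z => (TC R i \Po map_poly (real_complex R) (affine_on a b)).[z]).
Proof.
move=> hp; rewrite /interp_coef; under eq_bigr => j _ do rewrite hp mulr_sumr.
rewrite exchange_big /=; apply: eq_bigr => i _; rewrite mulr_sumr.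
by apply: eq_bigr => j _; rewrite horner_comp horner_map /= TCR mulrCA.
Qed.

(** By aliasing only the coefficients [c i] with [k <= i] reach index [k], each with a factor of
    modulus at most 1. Their bounds [2 * M / rho ^+ i] form a geometric tail of ratio at most 1/2,
    which at most doubles its first term. *)
Lemma interp_coef_bound (k : 'I_N) h M : poly_approx h ->
  (forall z, ellipse_region rho a b z -> nc (h z) <= M) ->
  nc (interp_coef a b k h) <= 4 / rho ^+ k * M.
Proof.
apply: (@functional_limit R (interp_coef a b k) _ (disc_of rho a b) (coef_norm k)) => //.
- exact: disc_of_gt0.
- exact: coef_norm_ge0.
- by rewrite divr_ge0 // exprn_ge0 // ltW.
- by move=> z; exact: ellipse_disc.
- exact: interp_coefB.
- by move=> g e e0; exact: interp_coef_cont.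
move=> p {}M hM; have [D [c [hp hc]]] := poly_cheb ab rho0 hM.
have M0 : 0 <= M.
  apply: le_trans (hM _ (@ellipse_jouk rho a b 0 _)); first exact: nc_ge0.
  by rewrite lexx mulr_ge0 // pi_ge0.
rewrite (interp_coef_sum k hp); apply: le_trans (nc_sum _ _ _) _.
apply: (@le_trans _ _ (\sum_(i < D | (k <= i)%N) 2 * M * rho^-1 ^+ i)); last first.
  rewrite -mulr_sumr.
  have := tail_geometric k D irho.1 irho.2; rewrite exprVn => htail.
  have -> : 4 / rho ^+ k * M = (2 * M) * (2 * rho ^- k) by ring.
  by apply: ler_wpM2l => //; rewrite mulr_ge0.
rewrite [leRHS]big_mkcond /=; apply: ler_sum => i _.
have [s [r [h1 h2 _ ->]]] := interp_coef_T i.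
rewrite Normc.normcM ncR normrM.
have k1 := hc i (ltn_ord i); have k2 := nc_ge0 (c i).
have k3 : 0 <= 2 * M * rho^-1 ^+ i by rewrite !mulr_ge0 // exprn_ge0 // irho.1.
case: eqP => [->|_]; last by rewrite normr0 !mulr0; case: ifP.
rewrite h2 normr1 mulr1 exprVn; apply: le_trans k1.
by rewrite -[leRHS]mulr1; apply: ler_wpM2l.
Qed.

Definition interp_err (x : R) (h : C -> C) : C :=
  h x%:C - \sum_(k < N) interp_coef a b k h * ((T k).[(affine_on a b).[x]])%:C.

(** Interpolation reproduces [T i] for [i < N] and replaces it by [s * T r] otherwise, an error of
    at most 2 on the interval. The coefficient bound, this error and the geometric tail from [N] on
    each contribute a factor 2. *)
Lemma interp_err_bound (x : R) h M : a <= x <= b -> poly_approx h ->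
  (forall z, ellipse_region rho a b z -> nc (h z) <= M) ->
  nc (interp_err x h) <= 8 / rho ^+ N * M.
Proof.
move=> hx; have hT i : `|(T i).[(affine_on a b).[x]]| <= 1.
  by apply: chebyshev_le1; exact: affine_on_itv.
apply: (@functional_limit R (interp_err x) _ (disc_of rho a b) (1 + \sum_(k < N) coef_norm k)) => //.
- exact: disc_of_gt0.
- by rewrite addr_ge0 // sumr_ge0 // => k _; exact: coef_norm_ge0.
- by rewrite divr_ge0 // exprn_ge0 // ltW.
- by move=> z; exact: ellipse_disc.
- move=> g g'; rewrite /interp_err; under eq_bigr => k _ do rewrite interp_coefB mulrBl.
  by rewrite sumrB; ring.
- move=> g e e0 hg; rewrite mulrDl mul1r; apply: le_trans (le_normcD _ _) _.
  apply: lerD; first by apply: hg; exact: itv_disc.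
  rewrite normcN mulr_suml; apply: le_trans (nc_sum _ _ _) _; apply: ler_sum => k _.
  rewrite Normc.normcM ncR -[leRHS]mulr1; apply: ler_pM => //; first exact: nc_ge0.
  exact: interp_coef_cont hg.
move=> p {}M hM; have [D [c [hp hc]]] := poly_cheb ab rho0 hM.
have M0 : 0 <= M.
  apply: le_trans (hM _ (@ellipse_jouk rho a b 0 _)); first exact: nc_ge0.
  by rewrite lexx mulr_ge0 // pi_ge0.
have -> : interp_err x (fun z => p.[z]) = \sum_(i < D) c i *
  (((T i).[(affine_on a b).[x]])%:C - \sum_(k < N)
   interp_coef a b k (fun z => (TC R i \Po map_poly (real_complex R) (affine_on a b)).[z])
    * ((T k).[(affine_on a b).[x]])%:C).
  rewrite /interp_err hp; under [X in _ - X]eq_bigr => k _ do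
    rewrite (interp_coef_sum k hp) mulr_suml.
  rewrite exchange_big /= -sumrB; apply: eq_bigr => i _.
  rewrite mulrBr mulr_sumr; congr (_ - _); apply: eq_bigr => k _; by rewrite mulrA.
apply: le_trans (nc_sum _ _ _) _.
apply: (@le_trans _ _ (\sum_(i < D | (N <= i)%N) 4 * M * rho^-1 ^+ i)); last first.
  rewrite -mulr_sumr.
  have := tail_geometric N D irho.1 irho.2; rewrite exprVn => htail.
  have -> : 8 / rho ^+ N * M = (4 * M) * (2 * rho ^- N) by ring.
  by apply: ler_wpM2l => //; rewrite mulr_ge0.
rewrite [leRHS]big_mkcond /=; apply: ler_sum => i _.
have [s [r [h1 _ h3 h4]]] := interp_coef_T i.
have -> : \sum_(k < N) interp_coef a b k
     (fun z => (TC R i \Po map_poly (real_complex R) (affine_on a b)).[z])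
     * ((T k).[(affine_on a b).[x]])%:C = (s * (T r).[(affine_on a b).[x]])%:C.
  rewrite (bigD1 r) //= big1 ?addr0 => [|k hk].
    by rewrite h4 eqxx mulr1 -rmorphM.
  by rewrite h4 (negPf hk) mulr0 mul0r.
case: ltnP => hi.
  have [-> ->] := h3 hi; rewrite mul1r subrr mulr0 Normc.normc0.
  by [].
rewrite Normc.normcM -rmorphB ncR.
have h5 : `|(T i).[(affine_on a b).[x]] - s * (T r).[(affine_on a b).[x]]| <= 2.
  apply: le_trans (ler_normB _ _) _; rewrite normrM -[2]/(1 + 1).
  by apply: lerD => //; rewrite -[leRHS]mulr1; apply: ler_pM.
have := ler_pM (nc_ge0 (c i)) (normr_ge0 _) (hc i (ltn_ord i)) h5.
by move/le_trans; apply; rewrite exprVn; move: (rho ^- i) => y; lra.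
Qed.

End Functional.
End Interpolation1D.

(** * Chebyshev interpolation in two variables *)

(** The angles 0 and [pi] give the two real vertices. Their half-axis [A] is at least half the
    interval because [rho + rho^-1 >= 2], and the scaling parameter of the region reaches every
    point in between. *)
Lemma itv_ellipse (R : realType) (rho a b t : R) : a < b -> 1 <= rho -> a <= t <= b ->
  ellipse_region rho a b t%:C.
Proof.
move=> ab r1 ht; have r0 : 0 < rho by exact: lt_le_trans r1.
pose A := (b - a) / 2 * ((rho + rho^-1) / 2); pose s := t - (a + b) / 2.
have hs : 2 <= rho + rho^-1.
  have -> : rho + rho^-1 = 2 + (rho - 1) ^+ 2 / rho by field; rewrite lt0r_neq0.
  by rewrite lerDl divr_ge0 ?sqr_ge0 // ltW.
have hA : (b - a) / 2 <= A.
  by rewrite /A -[leLHS]mulr1 ler_pM2l ?divr_gt0 ?subr_gt0 // ler_pdivlMr ?mul1r.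
have A0 : 0 < A by apply: lt_le_trans hA; rewrite divr_gt0 ?subr_gt0.
have sA : `|s| <= A.
  by apply: le_trans hA; rewrite ler_norml /s; move: ht; lra.
have E (c : R) : (c = 1 \/ c = -1) -> forall w, c = cos w -> sin w = 0 ->
    (`|s| / A)%:C * (((b - a) / 2)%:C * ((rho%:C * expi w + (rho^-1)%:C * expi (- w)) / 2%:R))
    + ((a + b) / 2)%:C = (c * `|s| + (a + b) / 2)%:C.
  move=> hc w cw sw.
  have -> : expi w = c%:C by rewrite /expi -cw sw.
  have -> : expi (- w) = c%:C by rewrite /expi cosN sinN -cw sw oppr0.
  rewrite -(rmorph_nat (real_complex R)) -fmorphV -!(rmorphM, rmorphD) /=.
  congr (_%:C); congr (_ + _).
  have -> : (b - a) / 2 * ((rho * c + rho^-1 * c) / 2) = A * c by rewrite /A; ring.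
  by rewrite mulrA divfK ?lt0r_neq0 // mulrC.
have s01 : 0 <= `|s| / A <= 1.
  by rewrite divr_ge0 //= ?(ltW A0) // ler_pdivrMr // mul1r.
exists (`|s| / A); first by rewrite /= in_itv.
have pp := pi_ge0 R.
case: (leP 0 s) => hs0.
  exists 0; first by rewrite /= in_itv /= lexx mulr_ge0.
  rewrite (E 1) ?cos0 ?sin0 //; last by left.
  by rewrite mul1r ger0_norm // /s; congr (_%:C); ring.
exists pi; first by rewrite /= in_itv /= pp; lra.
rewrite (E (-1)) ?cospi ?sinpi //; last by right.
by rewrite ltr0_norm // /s; congr (_%:C); ring.
Qed.

Section Interpolation2D.
Variable R : realType.
Local Notation C := R[i].
Local Notation nc := (@Normc.normc R).
Local Notation T := (@chebyshev_poly R).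
Local Arguments Normc.normc : simpl never.

Variables (N1 N2 : nat) (a1 b1 a2 b2 : R).
Hypotheses (N10 : (0 < N1)%N) (N20 : (0 < N2)%N) (ab1 : a1 < b1) (ab2 : a2 < b2).

Local Notation x1 := (node_on N1 a1 b1).
Local Notation x2 := (node_on N2 a2 b2).

Definition grid_mx (g : R -> R -> R) : 'M[R]_(N1, N2) := \matrix_(i, j) g (x1 i) (x2 j).

Lemma chebyshev_interpolatesE g (C : 'M[R]_(N1, N2)) :
  chebyshev_interpolates a1 b1 a2 b2 g C <->
  cheb_mx R N1 *m C *m (cheb_mx R N2)^T = grid_mx g.
Proof.
have E i j : \sum_(k1 < N1) \sum_(k2 < N2)
      C k1 k2 * ((chebyshev_on k1 a1 b1).[x1 i] * (chebyshev_on k2 a2 b2).[x2 j]) =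
    \sum_(k2 < N2) (\sum_(k1 < N1) (T k1).[cheb_node R N1 i] * C k1 k2) *
      (T k2).[cheb_node R N2 j].
  rewrite exchange_big; apply: eq_bigr => k2 _; rewrite mulr_suml.
  apply: eq_bigr => k1 _; rewrite !chebyshev_on_horner !affine_on_node //; ring.
split=> [H|H].
  apply/matrixP => i j; rewrite !mxE -H.
  - rewrite E; apply: eq_bigr => k2 _; rewrite !mxE; congr (_ * _).
    by apply: eq_bigr => k1 _; rewrite mxE.
  - by apply/root_chebyshev_on => //; exists i.
  - by apply/root_chebyshev_on => //; exists j.
move=> x t /root_chebyshev_on[]// i _ -> /root_chebyshev_on[]// j _ ->.
rewrite E; have /matrixP/(_ i j) := H; rewrite !mxE => <-.
apply: eq_bigr => k2 _; rewrite !mxE; congr (_ * _).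
by apply: eq_bigr => k1 _; rewrite mxE.
Qed.

(** The interpolation conditions form a matrix equation with invertible node matrices on both sides,
    so the solution exists and is unique and [xget] does not fall back on its default. *)
Lemma chebyshev_coefsE g : chebyshev_coefs N1 N2 a1 b1 a2 b2 g =
  cheb_coef_mx R N1 *m grid_mx g *m (cheb_coef_mx R N2)^T.
Proof.
apply: xget_unique => [|C] /=.
  apply/chebyshev_interpolatesE; rewrite /cheb_coef_mx !mulmxA.
  rewrite mulmxV ?cheb_mx_unit // mul1mx -mulmxA -trmx_mul.
  by rewrite mulmxV ?cheb_mx_unit // trmx1 mulmx1.
move/chebyshev_interpolatesE <-; rewrite /cheb_coef_mx !mulmxA.
rewrite mulVmx ?cheb_mx_unit // mul1mx -mulmxA -trmx_mul.
by rewrite mulVmx ?cheb_mx_unit // trmx1 mulmx1.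
Qed.

Variables (rho1 rho2 : R) (G : C -> C -> C) (g : R -> R -> R) (M : R).
Hypotheses (rho12 : 2 <= rho1) (rho22 : 2 <= rho2).
Hypothesis Gg : forall x t : R, G x%:C t%:C = (g x t)%:C.
Hypothesis G1 : forall t, poly_approx (fun z => G z t).
Hypothesis G2 : forall z, poly_approx (G z).
Hypothesis GM : forall z t, ellipse_region rho1 a1 b1 z -> ellipse_region rho2 a2 b2 t ->
  nc (G z t) <= M.

Local Notation Cg := (chebyshev_coefs N1 N2 a1 b1 a2 b2 g).

(** Tensor structure: the coefficient is the one-variable functional in the second variable followed
    by the one in the first, so one-variable bounds multiply. *)
Lemma chebyshev_coefs_iterate k1 k2 : (Cg k1 k2)%:C =
  interp_coef a1 b1 k1 (fun z => interp_coef a2 b2 k2 (G z)).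
Proof.
rewrite chebyshev_coefsE mxE rmorph_sum /= /interp_coef.
under [RHS]eq_bigr => j1 _ do rewrite mulr_sumr.
rewrite exchange_big /=; apply: eq_bigr => j2 _.
rewrite !mxE rmorphM rmorph_sum /= mulr_suml; apply: eq_bigr => j1 _.
by rewrite Gg !mxE -!rmorphM /=; congr (_%:C); ring.
Qed.

Lemma inner_approx k2 : poly_approx (fun z => @interp_coef R N2 a2 b2 k2 (G z)).
Proof.
apply: poly_approx_sum => j; apply: poly_approxM; first exact: poly_approx_cst.
exact: G1.
Qed.

Lemma chebyshev_coefs_bound k1 k2 : `|Cg k1 k2| <= 16 * M / (rho1 ^+ k1 * rho2 ^+ k2).
Proof.
rewrite -ncR chebyshev_coefs_iterate.
have -> : 16 * M / (rho1 ^+ k1 * rho2 ^+ k2) = 4 / rho1 ^+ k1 * (4 / rho2 ^+ k2 * M).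
  by rewrite invfM; ring.
apply: interp_coef_bound => //; first exact: inner_approx.
by move=> z hz; apply: interp_coef_bound => // t ht; exact: GM.
Qed.

(** The error is the [x]-error of [G] at [t] plus the [x]-interpolant of the [t]-error. The second
    part sums [4 / rho1 ^+ k1] times [8 / rho2 ^+ N2] over [k1], and the geometric series doubles 32
    into 64. *)
Lemma chebyshev_interp_error x t : a1 <= x <= b1 -> a2 <= t <= b2 ->
  `|g x t - \sum_(k1 < N1) \sum_(k2 < N2)
      Cg k1 k2 * ((chebyshev_on k1 a1 b1).[x] * (chebyshev_on k2 a2 b2).[t])|
  <= 64 * M * (rho1 ^- N1 + rho2 ^- N2).
Proof.
move=> hx ht.
have rho10 : 0 < rho1 by apply: lt_le_trans rho12.
have rho20 : 0 < rho2 by apply: lt_le_trans rho22.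
have E : (g x t - \sum_(k1 < N1) \sum_(k2 < N2)
      Cg k1 k2 * ((chebyshev_on k1 a1 b1).[x] * (chebyshev_on k2 a2 b2).[t]))%:C =
   interp_err N1 a1 b1 x (fun z => G z t%:C) +
   \sum_(k1 < N1) interp_coef a1 b1 k1 (fun z => interp_err N2 a2 b2 t (G z)) *
     ((T k1).[(affine_on a1 b1).[x]])%:C.
  have E1 (k1 : 'I_N1) : interp_coef a1 b1 k1 (fun z => interp_err N2 a2 b2 t (G z)) =
     interp_coef a1 b1 k1 (fun z => G z t%:C) -
     \sum_(k2 < N2) (Cg k1 k2)%:C * ((T k2).[(affine_on a2 b2).[t]])%:C.
    rewrite interp_coefB; congr (_ - _).
    under [RHS]eq_bigr => k2 _ do rewrite chebyshev_coefs_iterate {1}/interp_coef mulr_suml.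
    rewrite exchange_big /= {1}/interp_coef; apply: eq_bigr => j _.
    by rewrite mulr_sumr; apply: eq_bigr => k2 _; rewrite mulrA.
  under [X in _ = _ + X]eq_bigr => k1 _ do rewrite E1 mulrBl.
  rewrite sumrB addrA /interp_err subrK Gg rmorphB; congr (_ - _).
  rewrite rmorph_sum /=; apply: eq_bigr => k1 _; rewrite rmorph_sum /= mulr_suml.
  apply: eq_bigr => k2 _; rewrite -!rmorphM /= !chebyshev_on_horner; congr (_%:C); ring.
rewrite -ncR E; apply: le_trans (le_normcD _ _) _.
have r11 : 1 <= rho1 by apply: le_trans rho12; rewrite ler1n.
have r21 : 1 <= rho2 by apply: le_trans rho22; rewrite ler1n.
have M0 : 0 <= M.
  exact: le_trans (nc_ge0 _) (GM (itv_ellipse ab1 r11 hx) (itv_ellipse ab2 r21 ht)).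
have h1 : nc (interp_err N1 a1 b1 x (fun z => G z t%:C)) <= 8 / rho1 ^+ N1 * M.
  by apply: interp_err_bound => // z hz; apply: GM => //; exact: itv_ellipse.
have h2 : nc (\sum_(k1 < N1) interp_coef a1 b1 k1 (fun z => interp_err N2 a2 b2 t (G z)) *
     ((T k1).[(affine_on a1 b1).[x]])%:C) <= 64 / rho2 ^+ N2 * M.
  have p0 : 0 <= 32 / rho2 ^+ N2 * M.
    by rewrite mulr_ge0 // divr_ge0 // exprn_ge0 // ltW.
  apply: le_trans (nc_sum _ _ _) _.
  apply: (@le_trans _ _ (\sum_(k1 < N1 | (0 <= k1)%N) (32 / rho2 ^+ N2 * M) * rho1^-1 ^+ k1)).
    apply: ler_sum => k1 _.
    rewrite Normc.normcM ncR -[leRHS]mulr1; apply: ler_pM; rewrite ?nc_ge0 //.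
      have -> : 32 / rho2 ^+ N2 * M * rho1^-1 ^+ k1 = 4 / rho1 ^+ k1 * (8 / rho2 ^+ N2 * M).
        by rewrite exprVn; ring.
      apply: interp_coef_bound => //.
        under [X in poly_approx X]eq_fun => z do rewrite /interp_err -mulN1r.
        apply: poly_approxD; first exact: G1.
        apply: poly_approxM; first exact: poly_approx_cst.
        apply: poly_approx_sum => k2; apply: poly_approxM; first exact: inner_approx.
        exact: poly_approx_cst.
      by move=> z hz; apply: interp_err_bound => // w hw; exact: GM.
    by apply: chebyshev_le1; exact: affine_on_itv.
  rewrite -mulr_sumr; have -> : 64 / rho2 ^+ N2 * M = 32 / rho2 ^+ N2 * M * (2 * rho1^-1 ^+ 0).
    by rewrite expr0; ring.
  apply: ler_wpM2l => //; apply: tail_geometric.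
    by rewrite invr_ge0 ltW.
  by rewrite div1r lef_pV2 ?posrE.
apply: le_trans (lerD h1 h2) _; rewrite mulrDr.
have : 0 <= M / rho1 ^+ N1 by rewrite divr_ge0 // exprn_ge0 // ltW.
move: (rho1 ^- N1) (rho2 ^- N2) => y z; lra.
Qed.

End Interpolation2D.

(** * Reduced bases *)

Section GramSchmidt.
Variable F : realFieldType.

Lemma dotC m (x y : 'rV[F]_m) : dot x y = dot y x.
Proof. by apply: eq_bigr => j _; rewrite mulrC. Qed.

Lemma dotDl m (x y z : 'rV[F]_m) : dot (x + y) z = dot x z + dot y z.
Proof. by rewrite -big_split; apply: eq_bigr => j _; rewrite mxE mulrDl. Qed.

Lemma dotZl m a (x z : 'rV[F]_m) : dot (a *: x) z = a * dot x z.
Proof. by rewrite mulr_sumr; apply: eq_bigr => j _; rewrite mxE mulrA. Qed.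

Lemma dotDr m (x y z : 'rV[F]_m) : dot z (x + y) = dot z x + dot z y.
Proof. by rewrite dotC dotDl !(dotC z). Qed.

Lemma dotZr m a (x z : 'rV[F]_m) : dot z (a *: x) = a * dot z x.
Proof. by rewrite dotC dotZl (dotC z). Qed.

Lemma dot0l m (z : 'rV[F]_m) : dot 0 z = 0.
Proof. by rewrite -(scale0r 0) dotZl mul0r. Qed.

Lemma dot_suml m (I : Type) (r : seq I) (P : pred I) (f : I -> 'rV[F]_m) z :
  dot (\sum_(i <- r | P i) f i) z = \sum_(i <- r | P i) dot (f i) z.
Proof.
elim/big_rec2 : _ => [|i x y _ h]; first exact: dot0l.
by rewrite dotDl h.
Qed.

Lemma dot_ge0 m (x : 'rV[F]_m) : 0 <= dot x x.
Proof. by apply: sumr_ge0 => j _; rewrite -expr2 sqr_ge0. Qed.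

Lemma dot_eq0 m (x : 'rV[F]_m) : (dot x x == 0) = (x == 0).
Proof.
apply/eqP/eqP => [|->]; last exact: dot0l.
move=> /eqP; rewrite psumr_eq0 => [|j _]; last by rewrite -expr2 sqr_ge0.
move=> /allP h; apply/rowP => j; rewrite mxE.
by have := h j (mem_index_enum _); rewrite /= -expr2 sqrf_eq0 => /eqP.
Qed.

Lemma mul_trmxE n k m (A : 'M[F]_(n, m)) (B : 'M[F]_(k, m)) i j :
  (A *m B^T) i j = dot (row i A) (row j B).
Proof. by rewrite !mxE; apply: eq_bigr => l _; rewrite !mxE. Qed.

Section Process.
Variables (m : nat) (b : nat -> 'rV[F]_m).

(** Carrying the list of all earlier orthogonal vectors turns a course-of-values recursion into a
    structural one. *)
Fixpoint gs_seq k : seq 'rV[F]_m :=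
  if k is k'.+1 then
    rcons (gs_seq k') (b k' - \sum_(v <- gs_seq k') (dot (b k') v / dot v v) *: v)
  else [::].

Definition gs k := b k - \sum_(v <- gs_seq k) (dot (b k) v / dot v v) *: v.

Lemma gs_seqE k : gs_seq k = [seq gs i | i <- iota 0 k].
Proof.
elim: k => // k IH; rewrite -[k.+1]addn1 iotaD map_cat /= -IH cats1.
by rewrite addn1 add0n.
Qed.

Lemma gsE k : b k = gs k + \sum_(i < k) (dot (b k) (gs i) / dot (gs i) (gs i)) *: gs i.
Proof.
rewrite -(big_mkord xpredT (fun i => (dot (b k) (gs i) / dot (gs i) (gs i)) *: gs i)).
by rewrite {1}/gs gs_seqE big_map /index_iota subn0 subrK.
Qed.

Lemma gs_orth i j : (i < j)%N -> dot (gs i) (gs j) = 0.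
Proof.
elim: j {-2}j (leqnn j) i => [[]//|n IH j hj i hij].
have E : gs j = b j - \sum_(k < j) (dot (b j) (gs k) / dot (gs k) (gs k)) *: gs k.
  by rewrite {1}(gsE j) addrK.
rewrite E dotC dotDl -scaleN1r dotZl dot_suml (bigD1 (Ordinal hij)) //= big1 ?addr0.
  (* A row depending on earlier ones has [gs i = 0], and orthogonality to it is trivial; hence
     independence of the rows is not assumed. *)
  rewrite dotZl mulN1r; case: (eqVneq (dot (gs i) (gs i)) 0) => [h|h].
    have /eqP : gs i == 0 by rewrite -dot_eq0 h.
    by move=> ->; rewrite dotC !dot0l mulr0 subr0.
  by rewrite divfK // subrr.
move=> k hk; rewrite dotZl.
have nk : k <> i :> nat by move=> e; move/eqP: hk; apply; apply: val_inj.
case: (ltngtP k i) => // h; first by rewrite (IH i) ?mulr0 //; lia.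
by rewrite (dotC (gs k) (gs i)) (IH k _ i) ?mulr0 //; have := ltn_ord k; lia.
Qed.
End Process.

Lemma det_lower_unitri n (mu : 'M[F]_n) :
  (forall i j : 'I_n, (i < j)%N -> mu i j = 0) -> (forall i, mu i i = 1) -> \det mu = 1.
Proof.
move=> h1 h2; rewrite det_trig; last by apply/is_trig_mxP.
by rewrite big1.
Qed.

Lemma orthogonal_decomposition n m (B : 'M[F]_(n, m)) :
  exists (Bs : 'M[F]_(n, m)) (mu : 'M[F]_n),
  [/\ forall i j : 'I_n, (i < j)%N -> mu i j = 0, forall i, mu i i = 1,
      forall i j, i != j -> dot (row i Bs) (row j Bs) = 0 & B = mu *m Bs].
Proof.
case: n B => [|n] B.
  by exists 0, 0; split; [case|case|case|apply/matrixP => -[]].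
pose b k := row (inord k : 'I_n.+1) B.
pose Bs := \matrix_(i < n.+1) gs b i.
pose mu := \matrix_(i < n.+1, j < n.+1)
  (if (j < i)%N then dot (b i) (gs b j) / dot (gs b j) (gs b j) else (i == j)%:R : F).
exists Bs, mu; split.
- by move=> i j h; rewrite mxE ltnNge (ltnW h) /= -val_eqE /= ltn_eqF.
- by move=> i; rewrite mxE ltnn eqxx.
- move=> i j nij; rewrite !rowK; case: (ltngtP i j) => h.
  + exact: gs_orth.
  + by rewrite dotC gs_orth.
  + by move: nij; rewrite -val_eqE /= h eqxx.
apply/row_matrixP => i; rewrite row_mul mulmx_sum_row.
have -> : row i B = b i by rewrite /b inord_val.
rewrite (gsE b i) (bigD1 i) //= rowK !mxE ltnn eqxx scale1r; congr (_ + _).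
rewrite (bigID (fun j : 'I_n.+1 => (j < i)%N)) /= [X in _ = _ + X]big1 ?addr0; last first.
  by move=> j /andP[h1 h2]; rewrite !mxE (negPf h2) eq_sym (negPf h1) scale0r.
rewrite (big_ord_widen n.+1 (fun j => (dot (b i) (gs b j) / dot (gs b j) (gs b j)) *: gs b j)) 1?ltnW //.
apply: eq_big => [j|j h]; last by rewrite rowK !mxE h.
by case: (ltngtP j i) => h; rewrite ?andbF // andbT -val_eqE /= neq_ltn h.
Qed.

Lemma gram_det n m (A Bs : 'M[F]_(n, m)) (mu : 'M[F]_n) :
  (forall i j : 'I_n, (i < j)%N -> mu i j = 0) -> (forall i, mu i i = 1) ->
  (forall i j, i != j -> dot (row i Bs) (row j Bs) = 0) -> A = mu *m Bs ->
  \det (A *m A^T) = \prod_i dot (row i Bs) (row i Bs).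
Proof.
move=> h1 h2 h3 ->; rewrite trmx_mul mulmxA -(mulmxA mu) !det_mulmx det_tr.
rewrite (det_lower_unitri h1 h2) mul1r mulr1.
have -> : Bs *m Bs^T = diag_mx (\row_i dot (row i Bs) (row i Bs)).
  apply/matrixP => i j; rewrite mul_trmxE !mxE.
  by have [->|h] := eqVneq i j; [rewrite mulr1n|rewrite mulr0n; exact: h3].
by rewrite det_diag; apply: eq_bigr => i _; rewrite mxE.
Qed.

End GramSchmidt.

(** * Existence of an LLL-reduced basis *)

Section LLLExistence.

Definition lead (T : pzRingType) n m (k : 'I_n) (B : 'M[T]_(n, m)) : 'M[T]_(k.+1, m) :=
  rowsub (widen_ord (ltn_ord k)) B.

Definition lead_gram (T : comPzRingType) n m (k : 'I_n) (B : 'M[T]_(n, m)) : T :=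
  \det (lead k B *m (lead k B)^T).

(** The classical potential of the LLL algorithm; being a natural number, it supports a descent. *)
Definition lll_potential n m (B : 'M[int]_(n, m)) : nat := \prod_(k < n) `|lead_gram k B|%N.

Local Notation toQ := (map_mx (intr : int -> rat)).

Lemma lead_gram_int n m (k : 'I_n) (B : 'M[int]_(n, m)) :
  (lead_gram k B)%:~R = lead_gram k (toQ B) :> rat.
Proof.
by rewrite /lead_gram -det_map_mx map_mxM -map_trmx /lead map_mxsub.
Qed.

Lemma lead_gramE n m (k : 'I_n) (A Bs : 'M[rat]_(n, m)) (mu : 'M[rat]_n) :
  (forall i j : 'I_n, (i < j)%N -> mu i j = 0) -> (forall i, mu i i = 1) ->
  (forall i j, i != j -> dot (row i Bs) (row j Bs) = 0) -> A = mu *m Bs ->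
  lead_gram k A = \prod_(i < k.+1)
    dot (row (widen_ord (ltn_ord k) i) Bs) (row (widen_ord (ltn_ord k) i) Bs).
Proof.
move=> h1 h2 h3 hA; set w := widen_ord (ltn_ord k).
have inj_w : injective w by move=> x y [] /val_inj.
rewrite /lead_gram (@gram_det _ _ _ _ (lead k Bs) (mxsub w w mu)).
- by apply: eq_bigr => i _; rewrite /lead row_rowsub.
- by move=> i j ij; rewrite mxE h1.
- by move=> i; rewrite mxE h2.
- by move=> i j ij; rewrite /lead !row_rowsub h3 // (inj_eq inj_w).
apply/matrixP => i l; rewrite hA !mxE.
rewrite (bigID (fun j : 'I_n => (j < k.+1)%N)) /= [X in _ + X]big1 ?addr0; last first.
  by move=> j hj; rewrite h1 ?mul0r //= (leq_trans (ltn_ord i)) // leqNgt.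
rewrite (big_ord_narrow (ltn_ord k)); apply: eq_bigr => j _.
by rewrite !mxE.
Qed.

Section Swap.
Variables (n m : nat) (j0 j1 : 'I_n).
Hypothesis j01 : j0.+1 = j1 :> nat.

(** Swapping adjacent rows permutes the rows of a leading block, or does not touch it, unless the
    block ends between them. *)
Lemma lead_gram_swap_neq (T : comPzRingType) (k : 'I_n) (B : 'M[T]_(n, m)) : k != j0 ->
  lead_gram k (xrow j0 j1 B) = lead_gram k B.
Proof.
move=> hk; have hk' : k <> j0 :> nat by move=> e; move/eqP: hk; apply; apply: val_inj.
case: (ltngtP k j0) hk' => // h _.
  congr (\det (_ *m _^T)); apply/matrixP => i l; rewrite !mxE; congr (B _ _);
    rewrite tpermD // -val_eqE /=; have := ltn_ord i; lia.
have h0 : (j0 < k.+1)%N by rewrite ltnS ltnW.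
have h1 : (j1 < k.+1)%N by rewrite ltnS -j01.
have E : lead k (xrow j0 j1 B) = row_perm (tperm (Ordinal h0) (Ordinal h1)) (lead k B).
  have wj0 : widen_ord (ltn_ord k) (Ordinal h0) = j0 by exact: val_inj.
  have wj1 : widen_ord (ltn_ord k) (Ordinal h1) = j1 by exact: val_inj.
  apply/matrixP => i l; rewrite !mxE; congr (B _ _).
  by rewrite -{1}wj0 -{1}wj1 inj_tperm // => x y [] /val_inj.
rewrite /lead_gram E row_permE trmx_mul mulmxA -(mulmxA (perm_mx _)) !det_mulmx det_tr.
by rewrite mulrAC det_perm -expr2 sqrr_sign mul1r.
Qed.

(** In the block ending at [j0] the swap changes only the last orthogonal vector. It becomes the
    projection [c] of row [j1], and failure of the Lovasz condition keeps its square norm below 3/4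
    of the old one. *)
Lemma lead_gram_swap (A Bs : 'M[rat]_(n, m)) (mu : 'M[rat]_n) :
  gram_schmidt A Bs mu ->
  dot (row j1 Bs + mu j1 j0 *: row j0 Bs) (row j1 Bs + mu j1 j0 *: row j0 Bs)
    < 3 / 4 * dot (row j0 Bs) (row j0 Bs) ->
  lead_gram j0 (xrow j0 j1 A) < lead_gram j0 A.
Proof.
move=> [h1 h2 h3 h4 hA] hlt; set w := widen_ord (ltn_ord j0).
have w_max : w ord_max = j0 by apply: val_inj.
have w_val (i : 'I_j0.+1) : w i = i :> nat by [].
set c := row j1 Bs + mu j1 j0 *: row j0 Bs in hlt *.
have n01 : j0 != j1 by rewrite -val_eqE /= -j01; lia.
rewrite (lead_gramE j0 h1 h2 h3 hA) big_ord_recr /= -/w w_max.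
(* An explicit orthogonal decomposition of the swapped block: the old vectors, with [c] in the last
   place. *)
pose Bs' := \matrix_(i < j0.+1) (if i == ord_max then c else row (w i) Bs).
pose mu' := \matrix_(i < j0.+1, l < j0.+1)
  (if i == ord_max then (if l == ord_max then 1 else mu j1 (w l)) else mu (w i) (w l)).
have nmax (i : 'I_j0.+1) : i != ord_max -> (i < j0)%N.
  by rewrite -val_eqE /= => hi; have := ltn_ord i; lia.
have cperp (i : 'I_j0.+1) : i != ord_max -> dot c (row (w i) Bs) = 0.
  move=> /nmax hi; rewrite /c dotDl dotZl !h3 ?mulr0 ?addr0 // -val_eqE /= ?w_val; lia.
rewrite /lead_gram (@gram_det _ _ _ _ Bs' mu').
- rewrite big_ord_recr /= rowK eqxx.
  have -> : \prod_(i < j0) dot (row (widen_ord (leqnSn j0) i) Bs') (row (widen_ord (leqnSn j0) i) Bs')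
    = \prod_(i < j0) dot (row (w (widen_ord (leqnSn j0) i)) Bs) (row (w (widen_ord (leqnSn j0) i)) Bs).
    apply: eq_bigr => i _; rewrite rowK ifN // -val_eqE /= ltn_eqF //.
  rewrite ltr_pM2l; last by apply: prodr_gt0 => i _; rewrite lt_def dot_eq0 h4 dot_ge0.
  apply: lt_le_trans hlt _; have := dot_ge0 (row j0 Bs); lra.
- move=> i l il; rewrite mxE; case: eqP => [E|/eqP E].
    by move: il; rewrite E /= ltnNge -ltnS ltn_ord.
  by rewrite h1.
- by move=> i; rewrite mxE; case: eqP => // _; rewrite h2.
- move=> i l il; rewrite !rowK; case: (eqVneq i ord_max) => [ei|ni].
    by case: (eqVneq l ord_max) => [el|nl]; [move: il; rewrite ei el eqxx|exact: cperp].
  case: (eqVneq l ord_max) => [el|nl]; first by rewrite dotC cperp.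
  by apply: h3; rewrite -val_eqE.
apply/row_matrixP => i; rewrite row_mul mulmx_sum_row /lead row_rowsub.
have rowA k : row k A = \sum_(l < n) mu k l *: row l Bs.
  by rewrite hA row_mul mulmx_sum_row; apply: eq_bigr => l _; rewrite mxE.
have -> : row (w i) (xrow j0 j1 A) = row (if i == ord_max then j1 else w i) A.
  apply/rowP => l; rewrite !mxE; congr (A _ _); case: eqP => [->|/eqP/nmax hi].
    by rewrite w_max tpermL.
  by rewrite tpermD // -val_eqE /= ?w_val; lia.
rewrite rowA (bigID (fun j : 'I_n => (j < j0.+1)%N)) /= (big_ord_narrow (ltn_ord j0)) /= -/w.
rewrite big_ord_recr [RHS]big_ord_recr /= !rowK !eqxx w_max.
have E1 : \sum_(l < j0) (row i mu') 0 (widen_ord (leqnSn j0) l) *: row (widen_ord (leqnSn j0) l) Bs'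
  = \sum_(l < j0) mu (if i == ord_max then j1 else w i) (w (widen_ord (leqnSn j0) l))
       *: row (w (widen_ord (leqnSn j0) l)) Bs.
  apply: eq_bigr => l _; rewrite rowK !mxE.
  have -> : (widen_ord (leqnSn j0) l == ord_max) = false.
    by rewrite -val_eqE /= ltn_eqF.
  by case: eqP.
rewrite E1 -addrA; congr (_ + _); rewrite !mxE.
case: (eqVneq i ord_max) => [ei|ni]; last first.
  have hi := nmax _ ni.
  rewrite w_max h1 ?scale0r ?add0r; last by rewrite w_val.
  by apply: big1 => l hl; rewrite h1 ?scale0r // w_val; lia.
rewrite ?eqxx scale1r /c addrC; congr (_ + _).
rewrite (bigD1 j1) /=; last by rewrite -j01 ltnn.
rewrite h2 scale1r big1 ?addr0 // => l /andP[hl nl].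
rewrite h1 ?scale0r //; move: hl nl; rewrite -val_eqE /= -j01; lia.
Qed.
End Swap.

Lemma lead_gram_gt0 n m (k : 'I_n) (A Bs : 'M[rat]_(n, m)) (mu : 'M[rat]_n) :
  gram_schmidt A Bs mu -> 0 < lead_gram k A.
Proof.
move=> [h1 h2 h3 h4 hA]; rewrite (lead_gramE k h1 h2 h3 hA).
by apply: prodr_gt0 => i _; rewrite lt_def dot_eq0 h4 dot_ge0.
Qed.

Lemma gram_schmidt_exists n m (A : 'M[rat]_(n, m)) : row_free A ->
  exists Bs mu, gram_schmidt A Bs mu.
Proof.
move=> fA; have [Bs [mu [h1 h2 h3 hA]]] := orthogonal_decomposition A.
exists Bs, mu; split=> // i.
have dmu : mu \in unitmx by rewrite unitmxE (det_lower_unitri h1 h2) unitr1.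
apply/eqP => E.
have : row i (invmx mu) *m A = 0.
  by rewrite hA mulmxA -row_mul mulVmx // -row_mul mul1mx.
rewrite -[0](mul0mx _ A) => /(row_free_inj fA) E2.
have : row i (invmx mu *m mu) = 0 by rewrite row_mul E2 mul0mx.
rewrite mulVmx // => /rowP/(_ i); rewrite !mxE eqxx => /eqP.
by rewrite oner_eq0.
Qed.

(** Each row is treated from the diagonal leftwards, rounding the current entry to the nearest
    integer. Subtracting a multiple of row [j] leaves the entries to the right of [j] unchanged,
    since [mu] is lower triangular. *)
Lemma size_reduction n (mu : 'M[rat]_n) :
  (forall i j : 'I_n, (i < j)%N -> mu i j = 0) -> (forall i, mu i i = 1) ->
  exists V : 'M[int]_n, [/\ forall i j : 'I_n, (i < j)%N -> V i j = 0, forall i, V i i = 1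
    & forall i j : 'I_n, (j < i)%N -> `|(toQ V *m mu) i j| <= 1 / 2].
Proof.
move=> h1 h2.
suff ex (i : 'I_n) : exists v : 'rV[int]_n, [/\ forall j : 'I_n, (i < j)%N -> v 0 j = 0,
   v 0 i = 1 & forall j : 'I_n, (j < i)%N -> `|(toQ v *m mu) 0 j| <= 1 / 2].
  have [v hv] := choice ex; exists (\matrix_i v i); split.
  - by move=> i j ij; have [h _ _] := hv i; rewrite mxE h.
  - by move=> i; have [_ h _] := hv i; rewrite mxE h.
  move=> i j ij; have [_ _ h] := hv i; have := h j ij.
  rewrite (_ : (toQ (v i) *m mu) 0 j = (toQ (\matrix_i v i) *m mu) i j) //.
  by rewrite !mxE; apply: eq_bigr => k _; rewrite !mxE.
suff ex t : exists v : 'rV[int]_n, [/\ forall j : 'I_n, (i < j)%N -> v 0 j = 0,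
   v 0 i = 1 & forall j : 'I_n, (i - t <= j < i)%N -> `|(toQ v *m mu) 0 j| <= 1 / 2].
  by have [v [k1 k2 k3]] := ex i; exists v; split=> // j ji; apply: k3; rewrite subnn.
elim: t => [|t [v [k1 k2 k3]]].
  exists (\row_j (j == i)%:R); split.
  - by move=> j ij; rewrite mxE -val_eqE /= gtn_eqF.
  - by rewrite mxE eqxx.
  - by move=> j; rewrite subn0; lia.
case: (leqP i t) => it.
  exists v; split=> // j hj; apply: k3; lia.
have ltj : (i - t.+1 < n)%N by have := ltn_ord i; lia.
pose j := Ordinal ltj; pose c := Num.floor ((toQ v *m mu) 0 j + 1 / 2).
exists (v - c *: \row_l (l == j)%:R).
have E l : (toQ (v - c *: \row_l (l == j)%:R) *m mu) 0 l = (toQ v *m mu) 0 l - c%:~R * mu j l.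
  rewrite map_mxB map_mxZ mulmxBl -scalemxAl !mxE; congr (_ - _ * _).
  rewrite (bigD1 j) //= !mxE eqxx big1 ?addr0; first by rewrite rmorph1 mul1r.
  by move=> k /negPf hk; rewrite !mxE hk rmorph0 mul0r.
split.
- move=> l hl; rewrite !mxE k1 // -val_eqE /= gtn_eqF ?mulr0 ?subr0 //; lia.
- rewrite !mxE k2 -val_eqE /= gtn_eqF ?mulr0 ?subr0 //; lia.
move=> l hl; rewrite E; case: (eqVneq l j) => [->|nl].
  rewrite h2 mulr1; have := floor_le ((toQ v *m mu) 0 j + 1 / 2).
  have := floorD1_gt ((toQ v *m mu) 0 j + 1 / 2).
  by rewrite -/c rmorphD /= rmorph1 ler_norml; lra.
have nl' : l <> j :> nat by move=> e; move/eqP: nl; apply; apply: val_inj.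
by move: hl nl' => /= hl nl'; rewrite h1 /=; [rewrite mulr0 subr0; apply: k3|]; lia.
Qed.

Lemma toQ_unitmx n (U : 'M[int]_n) : U \in unitmx -> toQ U \in unitmx.
Proof. by rewrite !unitmxE det_map_mx; exact: rmorph_unit. Qed.

Lemma row_free_unitmx n m (M : 'M[int]_(n, m)) (U : 'M[int]_n) :
  row_free (toQ M) -> U \in unitmx -> row_free (toQ (U *m M)).
Proof.
move=> fM hU; rewrite map_mxM /row_free mxrankMfree // mxrank_unit //.
exact: toQ_unitmx.
Qed.

Lemma lll_potential_swap n m (j0 j1 : 'I_n) (B : 'M[int]_(n, m)) Bs mu :
  j0.+1 = j1 :> nat -> gram_schmidt (toQ B) Bs mu ->
  dot (row j1 Bs + mu j1 j0 *: row j0 Bs) (row j1 Bs + mu j1 j0 *: row j0 Bs)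
    < 3 / 4 * dot (row j0 Bs) (row j0 Bs) ->
  (0 <= lead_gram j0 (toQ (xrow j0 j1 B))) ->
  (lll_potential (xrow j0 j1 B) < lll_potential B)%N.
Proof.
move=> j01 gB hlt h0; rewrite /lll_potential (bigD1 j0) //= [X in (_ < X)%N](bigD1 j0) //=.
rewrite (eq_bigr (fun k => `|lead_gram k B|%N)); last first.
  by move=> k hk; rewrite lead_gram_swap_neq.
have pos k : 0 < lead_gram k B.
  by rewrite -(ltr_int rat) lead_gram_int; exact: lead_gram_gt0 gB.
rewrite ltn_pmul2r; last first.
  by apply: prodn_gt0 => k; rewrite absz_gt0 gt_eqF.
have := lead_gram_swap j01 gB hlt; rewrite -map_xrow -!lead_gram_int ltr_int.
move: h0; rewrite -lead_gram_int ler0z; have := pos j0; lia.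
Qed.

(** A descent on the potential stands for the run of the algorithm. Size reduction keeps the
    orthogonal vectors, hence the potential; if a Lovasz condition then fails, the corresponding
    swap lowers it. *)
Lemma lll_output_exists n m (M : 'M[int]_(n, m)) : row_free (toQ M) ->
  exists U, lll_output M U.
Proof.
move=> fM.
suff ex k U : U \in unitmx -> (lll_potential (U *m M) <= k)%N -> exists U, lll_output M U.
  by apply: (ex (lll_potential (1%:M *m M)) 1%:M) => //; exact: unitmx1.
elim: k U => [|k IH] U hU.
  rewrite leqn0 => /eqP h; have [Bs [mu gB]] := gram_schmidt_exists (row_free_unitmx fM hU).
  have : (0 < lll_potential (U *m M))%N.
    apply: prodn_gt0 => j; rewrite absz_gt0 gt_eqF //.
    by rewrite -(ltr_int rat) lead_gram_int; exact: lead_gram_gt0 gB.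
  by rewrite h.
move=> hk; have [Bs [mu gB]] := gram_schmidt_exists (row_free_unitmx fM hU).
case: (gB) => h1 h2 h3 h4 hB.
have [V [v1 v2 v3]] := size_reduction h1 h2.
have uV : V \in unitmx.
  by rewrite unitmxE det_trig ?big1 ?unitr1 //; apply/is_trig_mxP.
have uVU : V *m U \in unitmx by rewrite unitmx_mul uV.
pose nu := toQ V *m mu.
have n1 (i j : 'I_n) : (i < j)%N -> nu i j = 0.
  move=> ij; rewrite mxE big1 // => l _; rewrite mxE.
  case: (ltnP i l) => il; first by rewrite v1 // rmorph0 mul0r.
  by rewrite h1 ?mulr0 //; apply: leq_ltn_trans ij.
have n2 i : nu i i = 1.
  rewrite mxE (bigD1 i) //= mxE v2 h2 rmorph1 mul1r big1 ?addr0 // => l hl.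
  rewrite mxE; case: (ltngtP i l) => il.
  - by rewrite v1 // rmorph0 mul0r.
  - by rewrite h1 ?mulr0.
  - by move: hl; rewrite -val_eqE /= il eqxx.
have gV : gram_schmidt (toQ (V *m U *m M)) Bs nu.
  by split=> //; rewrite /nu -(mulmxA (toQ V)) -hB -map_mxM mulmxA.
case: (pselect (forall i j : 'I_n, j.+1 = i :> nat ->
        3 / 4 * dot (row j Bs) (row j Bs)
        <= dot (row i Bs + nu i j *: row j Bs) (row i Bs + nu i j *: row j Bs))).
  by move=> hL; exists (V *m U); split=> //; exists Bs, nu; split.
move=> /existsNP[j1 /existsNP[j0 /not_implyP[j01 /negP]]]; rewrite -ltNge => hlt.
have uS : xrow j0 j1 (V *m U) \in unitmx.
  by rewrite xrowE unitmx_mul unitmx_perm.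
apply: (IH _ uS).
have -> : xrow j0 j1 (V *m U) *m M = xrow j0 j1 (V *m U *m M) by rewrite !xrowE !mulmxA.
have pe : lll_potential (V *m U *m M) = lll_potential (U *m M).
  apply: eq_bigr => l _; congr `|_|%N; apply: (@intr_inj rat).
  by rewrite !lead_gram_int (lead_gramE l n1 n2 h3 (_ : _ = nu *m Bs)) ?(lead_gramE l h1 h2 h3 hB) //;
    case: gV.
rewrite -ltnS; apply: leq_trans hk; rewrite -pe.
apply: (lll_potential_swap j01 gV hlt).
have [Bs' [mu' g']] := gram_schmidt_exists (row_free_unitmx fM uS).
have := lead_gram_gt0 j0 g'.
by rewrite -mulmxA !xrowE -!mulmxA => /ltW.
Qed.

End LLLExistence.

(** * The first two vectors of a reduced basis *)

Section LLLBound.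
Local Notation toQ := (map_mx (intr : int -> rat)).

Lemma dot_intr n m (B : 'M[int]_(n, m)) (i j : 'I_n) :
  dot (row i (toQ B)) (row j (toQ B)) = (dot (row i B) (row j B))%:~R.
Proof.
by rewrite /dot rmorph_sum /=; apply: eq_bigr => l _; rewrite !mxE rmorphM.
Qed.

Lemma det_gram_unitmx n m (U : 'M[int]_n) (M : 'M[int]_(n, m)) : U \in unitmx ->
  \det ((U *m M) *m (U *m M)^T) = \det (M *m M^T).
Proof.
move=> hU; rewrite trmx_mul mulmxA -(mulmxA U) !det_mulmx det_tr mulrAC.
have : \det U * \det U = 1.
  by move: hU; rewrite unitmxE => /orP[/eqP ->|/eqP ->].
by move=> ->; rewrite mul1r.
Qed.

(** Both rows have square norm at most [2 * q i1], and [q] decreases by at most a factor 2 at each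
    index, so [q i1] is controlled by the product of all [q] except the first. The first is a
    positive integer and may be inserted to complete the determinant. *)
Lemma lll_output_bound n m (M : 'M[int]_(n, m)) (U : 'M[int]_n) (r : 'I_n) :
  (2 <= n)%N -> lll_output M U -> (r < 2)%N ->
  dot (row r (U *m M)) (row r (U *m M)) ^+ n.-1 <= 2 ^+ (n.+1 * n.-1) * \det (M *m M^T).
Proof.
case: n M U r => [|[|n]] // M U r _ [hU [Bs [mu [gB hs hL]]]] hr.
set B := U *m M in gB.
case: (gB) => h1 h2 h3 h4 hB.
pose q i := dot (row i Bs) (row i Bs).
have q0 i : 0 < q i by rewrite lt_def dot_eq0 h4 dot_ge0.
pose i1 : 'I_n.+2 := lift ord0 ord0.
(* The Lovasz condition with [(mu i j) ^+ 2 <= 1 / 4] reads [3 / 4 * q j <= q i + q j / 4]. *)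
have step (i j : 'I_n.+2) : j.+1 = i :> nat -> q j <= 2 * q i.
  move=> ji; have := hL i j ji; rewrite dotDl !dotDr !dotZl !dotZr.
  have nij : i != j by rewrite -val_eqE /= -ji; lia.
  rewrite (h3 i j) // (h3 j i) 1?eq_sym // -!/(q _).
  have : (mu i j) ^+ 2 <= 1 / 4.
    have hij : (j < i)%N by rewrite -ji.
    by have := hs i j hij; rewrite ler_norml; nra.
  by have := q0 i; have := q0 j; nra.
have q1 k (hk : (k.+1 < n.+2)%N) : q i1 <= 2 ^+ k * q (Ordinal hk).
  elim: k hk => [|k IH] hk.
    by rewrite expr0 mul1r (_ : Ordinal hk = i1) //; apply: val_inj.
  apply: le_trans (IH (ltnW hk)) _; rewrite exprSr -mulrA; apply: ler_wpM2l.
    exact: exprn_ge0.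
  exact: step.
have q1' (i : 'I_n.+1) : q i1 / 2 ^+ n.+2 <= q (lift ord0 i).
  rewrite ler_pdivrMr ?exprn_gt0 // mulrC.
  have hk : (i.+1 < n.+2)%N by rewrite ltnS.
  have -> : lift ord0 i = Ordinal hk by apply: val_inj.
  apply: le_trans (q1 i hk) _; rewrite ler_pM2r //.
  by apply: ler_weXn2l => //; have := ltn_ord i; lia.
have intB i : (dot (row i B) (row i B))%:~R = dot (row i (toQ B)) (row i (toQ B)) :> rat.
  by rewrite dot_intr.
have rowB i : row i (toQ B) = \sum_j mu i j *: row j Bs.
  by rewrite hB row_mul mulmx_sum_row; apply: eq_bigr => l _; rewrite mxE.
have row0 : row ord0 (toQ B) = row ord0 Bs.
  rewrite rowB (bigD1 ord0) //= h2 scale1r big1 ?addr0 // => j hj.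
  by rewrite h1 ?scale0r // lt0n.
have row1 : row i1 (toQ B) = row i1 Bs + mu i1 ord0 *: row ord0 Bs.
  rewrite rowB (bigD1 i1) //= h2 scale1r; congr (_ + _).
  rewrite (bigD1 ord0) //= big1 ?addr0 // => j /andP[j1 j0].
  rewrite h1 ?scale0r //; move: j1 j0; rewrite -!val_eqE /=.
  by case: (val j) => [|[]].
have q00 : 1 <= q ord0.
  rewrite /q -row0 -intB -[1]/(1%:~R) ler_int -gtz0_ge1 -(ltr_int rat) intB row0.
  exact: q0.
have s01 : q ord0 <= 2 * q i1 by exact: step.
have br : (dot (row r B) (row r B))%:~R <= 2 * q i1.
  rewrite intB; case: r hr => -[|[|r]] hr' // _.
    have -> : Ordinal hr' = ord0 by apply: val_inj.
    by rewrite row0.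
  have -> : Ordinal hr' = i1 by apply: val_inj.
  rewrite row1 dotDl !dotDr !dotZl !dotZr (h3 i1 ord0) // (h3 ord0 i1) // -!/(q _).
  have : (mu i1 ord0) ^+ 2 <= 1 / 4.
    have hij : (@ord0 n.+1 < i1)%N by [].
    by have := hs i1 ord0 hij; rewrite ler_norml; nra.
  by have := q0 i1; have := q0 ord0; nra.
have detE : (\det (M *m M^T))%:~R = \prod_i q i.
  rewrite -(det_gram_unitmx M hU) -det_map_mx map_mxM -map_trmx -/B.
  exact: (gram_det h1 h2 h3 hB).
rewrite -(ler_int rat) rmorphM !rmorphXn /= detE big_ord_recl /=.
have p1 : (q i1 / 2 ^+ n.+2) ^+ n.+1 <= \prod_(i < n.+1) q (lift ord0 i).
  rewrite -[X in _ ^+ X]card_ord -prodr_const; apply: ler_prod => i _.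
  by rewrite q1' divr_ge0 ?exprn_ge0 // ltW.
have br0 : 0 <= (dot (row r B) (row r B))%:~R :> rat by rewrite intB dot_ge0.
apply: (@le_trans _ _ ((2 * q i1) ^+ n.+1)).
  by apply: lerXn2r; rewrite ?nnegrE // mulr_ge0 // ltW.
have -> : (2 * q i1) ^+ n.+1 = 2 ^+ (n.+3 * n.+1) * (q i1 / 2 ^+ n.+2) ^+ n.+1.
  rewrite exprM -exprMn; congr (_ ^+ _).
  by rewrite exprS mulrACA mulfV ?mulr1 // expf_neq0.
apply: ler_wpM2l; first exact: exprn_ge0.
apply: le_trans p1 _; rewrite -[leLHS]mul1r ler_wpM2r //.
by apply: prodr_ge0 => i _; exact: ltW.
Qed.

End LLLBound.

(** * A Cauchy-Binet bound for Gram determinants *)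

Section GramDeterminantBound.
Variable F : realFieldType.

(* Cauchy-Binet before grouping the column choices: only the injective ones
   contribute, and each contributes a product of column weights. *)
Lemma det_gram_le n m (M : 'M[F]_(n, m)) (r : 'I_n -> F) (w : 'I_m -> F) (W : F) :
  (forall i, 0 <= r i) -> (forall c, 0 <= w c) ->
  (forall i c, `|M i c| <= r i * w c) ->
  (forall f : {ffun 'I_n -> 'I_m}, injective f -> \prod_i w (f i) <= W) ->
  0 <= W ->
  \det (M *m M^T) <= (m ^ n)%:R * (n`!)%:R * (\prod_i r i) ^+ 2 * W ^+ 2.
Proof.
move=> r0 w0 hM hW W0; apply: le_trans (ler_norm _) _.
pose A (f : {ffun 'I_n -> 'I_m}) : 'M[F]_n := \matrix_(i, j) M j (f i).
have -> : \det (M *m M^T) = \sum_(f : {ffun 'I_n -> 'I_m}) (\prod_i M i (f i)) * \det (A f).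
  rewrite /determinant.
  under eq_bigr => s _.
    under eq_bigr => i _ do rewrite mxE.
    rewrite bigA_distr_bigA /= mulr_sumr; over.
  rewrite exchange_big /=; apply: eq_bigr => f _.
  rewrite mulr_sumr; apply: eq_bigr => s _.
  rewrite mulrCA -big_split /=; congr (_ * _); apply: eq_bigr => i _.
  by rewrite !mxE.
have R0 : 0 <= \prod_i r i by apply: prodr_ge0.
have bf (f : {ffun 'I_n -> 'I_m}) : `|(\prod_i M i (f i)) * \det (A f)| <= (n`!)%:R * (\prod_i r i) ^+ 2 * W ^+ 2.
  case: (boolP (injectiveb f)) => [/injectiveP inj|/injectivePn[i1 [i2 n12 e12]]]; last first.
    have -> : \det (A f) = 0.
      by apply: (determinant_alternate n12) => j; rewrite !mxE e12.
    by rewrite mulr0 normr0 !mulr_ge0 // exprn_ge0.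
  have pf (s : 'S_n) : \prod_i `|M (s i) (f i)| <= (\prod_i r i) * W.
    apply: (@le_trans _ _ (\prod_i (r (s i) * w (f i)))).
      by apply: ler_prod => i _; rewrite hM andbT.
    rewrite big_split /= ler_pM // ?prodr_ge0 //; last exact: hW.
    by rewrite [leRHS](reindex_inj (@perm_inj _ s)).
  have h1 : `|\prod_i M i (f i)| <= (\prod_i r i) * W.
    by rewrite normr_prod; have := pf 1%g; under eq_bigr => i _ do rewrite perm1.
  have h2 : `|\det (A f)| <= (n`!)%:R * ((\prod_i r i) * W).
    apply: le_trans (ler_norm_sum _ _ _) _.
    apply: (@le_trans _ _ (\sum_(s : 'S_n) (\prod_i r i) * W)); last first.
      by rewrite sumr_const -[#|_|]/(#|'S_n|) card_Sn mulr_natl.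
    apply: ler_sum => s _; rewrite normrM normr_sign mul1r normr_prod.
    by under eq_bigr => i _ do rewrite mxE; exact: pf.
  rewrite normrM; apply: le_trans (ler_pM (normr_ge0 _) (normr_ge0 _) h1 h2) _.
  by rewrite le_eqVlt; apply/orP; left; apply/eqP; ring.
apply: le_trans (ler_norm_sum _ _ _) _.
apply: (@le_trans _ _ (\sum_(f : {ffun 'I_n -> 'I_m}) (n`!)%:R * (\prod_i r i) ^+ 2 * W ^+ 2)).
  by apply: ler_sum => f _; exact: bf.
by rewrite sumr_const card_ffun !card_ord -[leLHS]mulr_natl !mulrA.
Qed.

End GramDeterminantBound.

(** * Column weights and the function psi *)

Section ColumnWeights.
Variable R : realType.

Lemma floorR_nat (x : R) : 0 <= x -> exists2 m : nat, floorR x = m%:R & m%:R <= x < m.+1%:R.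
Proof.
move=> x0; have /andP[h1 h2] := floor_itv x.
have f0 : 0 <= Num.floor x by rewrite floor_ge0.
have E : (`|Num.floor x|%N)%:R = (Num.floor x)%:~R :> R by rewrite natr_absz ger0_norm.
exists `|Num.floor x|%N; first by rewrite E.
by rewrite -natr1 E h1; move: h2; rewrite rmorphD /= rmorph1.
Qed.

Lemma phi_sub (m : nat) (x : R) : m%:R <= x < m.+1%:R -> phi x = (1 + m%:R) * (x - m%:R / 2).
Proof.
move=> hx; have x0 : 0 <= x by case/andP: hx => h _; apply: le_trans h.
have [k hk /andP[k1 k2]] := floorR_nat x0.
have -> : m = k.
  move/andP: hx => [m1 m2]; apply/eqP; rewrite eqn_leq; apply/andP.
  by split; rewrite -ltnS -(ltr_nat R); [exact: le_lt_trans m1 k2|exact: le_lt_trans k1 m2].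
by rewrite /phi hk.
Qed.

(** The endpoints are the values of [phi] at [m] and [m + 1], so [m] is the floor of [phi_inv y]. *)
Lemma triangular_interval (y : R) : 1 <= y -> exists2 m : nat, (0 < m)%N &
  m%:R * (m%:R + 1) / 2 <= y < (m%:R + 1) * (m%:R + 2) / 2.
Proof.
move=> y1.
have ex : exists k : nat, y < (k%:R + 1) * (k%:R + 2) / 2.
  exists (Num.bound y); have := archi_boundP (le_trans ler01 y1).
  have : 0 <= (Num.bound y)%:R :> R by [].
  set b := _%:R; nra.
have [m hm hmin] := ex_minnP ex.
exists m.
  by case: m hm {hmin} => // h; move: h; rewrite add0r; lra.
rewrite hm andbT; case: m hm hmin => [|m] hm hmin; first by rewrite !mul0r; lra.
rewrite leNgt; apply/negP => h.
have : (m < m)%N.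
  by apply: hmin; move: h; rewrite -natr1; set b := m%:R => h; move: h; lra.
by rewrite ltnn.
Qed.

(** On the interval found by [triangular_interval] the function [phi] is affine and can be inverted
    by hand, so the set searched by [xget] is nonempty. *)
Lemma phi_invP (lambda : R) : 1 <= lambda -> exists2 m : nat, (0 < m)%N &
  let x := phi_inv lambda in
  [/\ m%:R <= x < m.+1%:R, floorR x = m%:R & lambda = (1 + m%:R) * (x - m%:R / 2)].
Proof.
move=> l1; have : 1 <= phi_inv lambda /\ phi (phi_inv lambda) = lambda.
  apply: (@xgetPex _ 1 [set x : R | 1 <= x /\ phi x = lambda]).
  have [m m0 /andP[h1 h2]] := triangular_interval l1.
  have m1 : 1 <= m%:R :> R by rewrite ler1n.
  have k0 : 0 < 1 + m%:R :> R by rewrite ltr_pwDl.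
  pose x : R := lambda / (1 + m%:R) + m%:R / 2.
  have e : (1 + m%:R) * (x - m%:R / 2) = lambda.
    by rewrite /x addrK mulrC divfK // lt0r_neq0.
  have hx : m%:R <= x < m.+1%:R.
    rewrite -natr1 -lerBlDr -ltrBrDr ler_pdivlMr // ltr_pdivrMr //.
    by apply/andP; split; move: h1 h2; set b := m%:R; lra.
  exists x; split; last by rewrite (phi_sub hx).
  by case/andP: hx => hx _; apply: le_trans hx.
set x := phi_inv lambda => -[x1 hx].
have x0 : 0 <= x by apply: le_trans x1.
have [m fm hm] := floorR_nat x0; exists m.
  case/andP: hm => _; rewrite lt0n; apply: contraTneq => ->.
  by rewrite -leNgt.
by split=> //; rewrite -(phi_sub hm).
Qed.

Lemma psi_gt0 (lambda : R) : 1 <= lambda -> 0 < psi lambda.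
Proof.
move=> l1; have [m m0 [/andP[h1 h2] fm _]] := phi_invP l1.
have m1 : 1 <= m%:R :> R by rewrite ler1n.
rewrite /psi fm mulr_gt0 //.
  by rewrite divr_gt0 ?ltr_pwDl // mulr_gt0 // (lt_le_trans ltr01).
move: h1 m1; set x := phi_inv lambda; set b := m%:R; nra.
Qed.

(** With [x = phi_inv lambda] and [m] its floor, [2 * lambda - x ^+ 2 = x + (x - m) * (m + 1 - x)].
    This keeps the threshold [x * gamma] of [column_weight_ge] below [N1 + 1] and below
    [gamma * N2]. *)
Lemma phi_inv_le_sqrt (lambda : R) : 1 <= lambda -> phi_inv lambda <= Num.sqrt (2 * lambda).
Proof.
move=> l1; have [m m0 /= [/andP[h1 h2] fm hl]] := phi_invP l1.
have x0 : 0 <= phi_inv lambda by apply: le_trans h1.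
rewrite -[leLHS]ger0_norm // -sqrtr_sqr; apply: ler_wsqrtr.
rewrite [in leRHS]hl; move: h1 h2 x0; rewrite -natr1.
move: (phi_inv lambda) (m%:R : R) => x b h1 h2 x0.
have p : 0 <= (x - b) * (b + 1 - x) by apply: mulr_ge0; lra.
by move: p; nra.
Qed.

Definition posp (x : R) := Num.max x 0.

Lemma posp_ge0 x : 0 <= posp x. Proof. by rewrite le_max lexx orbT. Qed.
Lemma posp_ge x : x <= posp x. Proof. by rewrite le_max lexx. Qed.

Lemma sum_posp n (s : R) : \sum_(k < n) posp (s - k%:R) <= if 0 <= s then (s + 1) ^+ 2 / 2 else 0.
Proof.
elim: n s => [|n IH] s.
  by rewrite big_ord0; case: ifP => // _; rewrite divr_ge0 ?sqr_ge0.
rewrite big_ord_recl subr0 /=.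
under eq_bigr => k _ do rewrite /bump /= add1n -natr1 opprD addrA addrAC.
apply: le_trans (lerD (lexx _) (IH (s - 1))) _.
rewrite /posp; case: (leP 0 s) => s0.
  by case: ifP => s1; nra.
rewrite ifF; first by rewrite addr0.
by apply/negbTE; rewrite -ltNge; lra.
Qed.

(** A dual bound: each chosen column weighs at least [tau] minus its deficit, and distinct columns
    share the total deficit. It is sharp when [tau] separates the [n] lightest columns from the
    others. *)
Lemma sum_injective_ge n (T : finType) (w : T -> R) (f : 'I_n -> T) (tau : R) :
  injective f -> n%:R * tau - \sum_c posp (tau - w c) <= \sum_i w (f i).
Proof.
move=> inj.
have h1 : \sum_i (tau - w (f i)) <= \sum_c posp (tau - w c).
  apply: (@le_trans _ _ (\sum_i posp (tau - w (f i)))).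
    by apply: ler_sum => i _; exact: posp_ge.
  rewrite [leRHS](bigID [in codom f]) /= -[leLHS]addr0; apply: lerD; last first.
    by apply: sumr_ge0 => c _; exact: posp_ge0.
  have -> : \sum_(c in codom f) posp (tau - w c) = \sum_(c <- codom f) posp (tau - w c).
    by rewrite -big_uniq //; exact/injectiveP.
  by rewrite /codom /image_mem big_map big_enum.
move: h1; rewrite sumrB sumr_const card_ord -[tau *+ n]mulr_natl; lra.
Qed.

(** Exponents of [rho1^-1] in the column bounds: the Chebyshev block decays like
    [rho1 ^- k1 * rho2 ^- k2] with [rho2] the power [gamma] of [rho1], and the diagonal block like
    the larger term of [decay]. *)
Definition column_weight (N1 N2 N : nat) (gamma : R) : 'rV[R]_(N1 * N2 + N) :=
  row_mx (mxvec (\matrix_(k1 < N1, k2 < N2) (k1%:R + gamma * k2%:R)))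
         (const_mx (Num.min N1%:R (gamma * N2%:R))).

Lemma sum_column_weight N1 N2 N gamma (F : R -> R) :
  \sum_c F (column_weight N1 N2 N gamma 0 c) =
  \sum_(k2 < N2) \sum_(k1 < N1) F (k1%:R + gamma * k2%:R)
  + N%:R * F (Num.min N1%:R (gamma * N2%:R)).
Proof.
rewrite big_split_ord /=; congr (_ + _).
  rewrite (reindex _ (curry_mxvec_bij N1 N2)) /=.
  rewrite exchange_big pair_big /=; apply: eq_bigr => -[k1 k2] _ /=.
  by rewrite row_mxEl mxvecE mxE.
under eq_bigr => j _ do rewrite row_mxEr mxE.
by rewrite sumr_const card_ord mulr_natl.
Qed.

Lemma sum_sq_ord m (x : R) : \sum_(j < m.+1) (x - j%:R) ^+ 2 =
  (1 + m%:R) * x ^+ 2 - x * m%:R * (m%:R + 1) + m%:R * (m%:R + 1) * (2 * m%:R + 1) / 6.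
Proof.
elim: m => [|m IH]; first by rewrite big_ord1 subr0 !mul0r mulr0 !mul0r; ring.
by rewrite big_ord_recr /= IH -natr1; field.
Qed.

(** The threshold [x * gamma] has about [gamma * phi x = N] grid columns below it, hence is nearly
    optimal. Its deficits are triangular sums, one for each [k2 <= m]; their quadratic parts produce
    [psi], while rounding and the diagonal columns cost O(N). *)
Lemma column_weight_ge (lambda : R) : 1 <= lambda -> exists2 K, 0 <= K &
  forall (N N1 N2 : nat) (gamma : R), (0 < N)%N -> gamma = N%:R / lambda ->
    Num.sqrt (2 * gamma * N%:R) - 1 <= N1%:R -> Num.sqrt (2 * N%:R / gamma) <= N2%:R ->
    forall f : 'I_N -> 'I_(N1 * N2 + N), injective f ->
    N%:R ^+ 2 * psi lambda / lambda - K * N%:R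
      <= \sum_i column_weight N1 N2 N gamma 0 (f i).
Proof.
move=> l1; have [m m0 /= [/andP[h1 h2] fm hl]] := phi_invP l1.
have xs := phi_inv_le_sqrt l1.
set x := phi_inv lambda in h1 h2 fm hl xs.
have x0 : 0 <= x by apply: le_trans h1.
have l0 : 0 < lambda by apply: lt_le_trans l1.
exists ((1 + m%:R) * (x + 1) + 1).
  by rewrite addr_ge0 // mulr_ge0 // addr_ge0.
move=> N N1 N2 gamma N0 hg hN1 hN2 f inj.
have NR : 1 <= N%:R :> R by rewrite ler1n.
have NR0 : 0 < N%:R :> R by rewrite ltr0n.
have g0 : 0 < gamma by rewrite hg divr_gt0.
have gN : gamma <= N%:R by rewrite hg ler_pdivrMr // ler_peMr // ltW.
apply: le_trans (sum_injective_ge (fun c => column_weight N1 N2 N gamma 0 c) (x * gamma) inj).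
rewrite (sum_column_weight N1 N2 N gamma (fun w => posp (x * gamma - w))).
have e1 : 2 * gamma * N%:R = (gamma ^+ 2) * (2 * lambda).
  by rewrite hg; field; rewrite lt0r_neq0.
have e2 : 2 * N%:R / gamma = 2 * lambda.
  by rewrite hg; field; rewrite !lt0r_neq0.
(* The dimensions of the grid put the diagonal columns at most 1 below the threshold. *)
have t1 : posp (x * gamma - Num.min N1%:R (gamma * N2%:R)) <= 1.
  rewrite /posp ge_max ler01 andbT lerBlDr -lerBlDl le_min; apply/andP; split.
    apply: le_trans hN1; rewrite e1 sqrtrM ?sqr_ge0 // sqrtr_sqr gtr0_norm //.
    by rewrite lerB // mulrC ler_pM2l.
  rewrite -e2 in xs; apply: (@le_trans _ _ (x * gamma)); first by rewrite gerBl.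
  by rewrite mulrC ler_pM2l //; apply: le_trans hN2.
have t2 : \sum_(k2 < N2) \sum_(k1 < N1) posp (x * gamma - (k1%:R + gamma * k2%:R)) <=
    \sum_(j < m.+1) (gamma * (x - j%:R) + 1) ^+ 2 / 2.
  apply: (@le_trans _ _ (\sum_(k2 < N2) if (k2 < m.+1)%N then (gamma * (x - k2%:R) + 1) ^+ 2 / 2 else 0)).
    apply: ler_sum => k2 _.
    under eq_bigr => k1 _.
      rewrite (_ : _ - _ = gamma * (x - k2%:R) - k1%:R); last by ring.
      over.
    apply: le_trans (sum_posp _ _) _.
    rewrite pmulr_rge0 // subr_ge0; case: ifP => hk; last first.
      by case: ifP => // _; rewrite divr_ge0 ?sqr_ge0.
    by rewrite -(ltr_nat R) (le_lt_trans hk h2).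
  rewrite -big_mkcond /=.
  rewrite -[leRHS](big_mkord xpredT (fun j => (gamma * (x - j%:R) + 1) ^+ 2 / 2)).
  rewrite -(big_mkord (fun j => (j < m.+1)%N) (fun j => (gamma * (x - j%:R) + 1) ^+ 2 / 2)).
  have pos j : 0 <= (gamma * (x - j%:R) + 1) ^+ 2 / 2 by rewrite divr_ge0 ?sqr_ge0.
  case: (leqP N2 m.+1) => hN.
    rewrite (@big_cat_nat _ _ _ N2 0 m.+1) //= -[leLHS]addr0; apply: lerD.
      rewrite [leRHS]big_nat_cond [leLHS]big_nat_cond le_eqVlt; apply/orP; left; apply/eqP.
      apply: eq_bigl => j; rewrite andbT; case: (ltnP j N2) => // hj.
      by rewrite (leq_trans hj hN).
    by apply: sumr_ge0 => j _.
  rewrite (@big_cat_nat _ _ _ m.+1 0 N2) //=; last exact: ltnW.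
  rewrite [X in _ + X]big_nat_cond [X in _ + X]big_pred0 ?addr0; last first.
    by move=> j; case: (ltnP j m.+1); rewrite ?andbF.
  rewrite [leRHS]big_nat_cond [leLHS]big_nat_cond le_eqVlt; apply/orP; left; apply/eqP.
  by apply: eq_bigl => j; rewrite andbT -andbA andbb.
have t3 : \sum_(j < m.+1) (gamma * (x - j%:R) + 1) ^+ 2 / 2 <=
    gamma ^+ 2 / 2 * (\sum_(j < m.+1) (x - j%:R) ^+ 2) + (1 + m%:R) * (gamma * x + 1 / 2).
  have -> : (1 + m%:R) * (gamma * x + 1 / 2) = \sum_(j < m.+1) (gamma * x + 1 / 2).
    by rewrite sumr_const card_ord -[RHS]mulr_natl -[m.+1%:R]natr1 [1 + _]addrC.
  rewrite mulr_sumr -big_split; apply: ler_sum => j _ /=.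
  have : 0 <= gamma * j%:R by rewrite mulr_ge0 // ltW.
  by move: (j%:R : R) => b; nra.
rewrite sum_sq_ord in t3.
(* The origin of [psi]: it is the main term of the dual bound once [N] is written
   [gamma * lambda]. *)
have t4 : N%:R ^+ 2 * psi lambda / lambda = N%:R * (x * gamma) - gamma ^+ 2 / 2 *
  ((1 + m%:R) * x ^+ 2 - x * m%:R * (m%:R + 1) + m%:R * (m%:R + 1) * (2 * m%:R + 1) / 6).
  have Ng : N%:R = gamma * lambda by rewrite hg divfK // lt0r_neq0.
  rewrite /psi -/x fm.
  have -> : N%:R * (x * gamma) = gamma ^+ 2 * x * ((1 + m%:R) * (x - m%:R / 2)).
    by rewrite -hl Ng; ring.
  rewrite Ng; move: (m%:R : R) => b; field; exact: lt0r_neq0.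
have t5 : (1 + m%:R) * (gamma * x + 1 / 2) <= (1 + m%:R) * (x + 1) * N%:R.
  rewrite -mulrA; apply: ler_wpM2l; first by rewrite addr_ge0.
  by rewrite mulrDl mul1r; apply: lerD; [rewrite mulrC ler_wpM2l|lra].
have t6 : N%:R * posp (x * gamma - Num.min N1%:R (gamma * N2%:R)) <= N%:R.
  by rewrite -[leRHS]mulr1; apply: ler_wpM2l => //; exact: ltW.
rewrite t4 mulrDl mul1r; move: t2 t3 t5 t6; lra.
Qed.

End ColumnWeights.

(** * Algorithm 2 *)

Section SumsOverMonomials.

Lemma monomial_listing_sum (V : nmodType) d (e : 'I_(nb_monomials d) -> nat * nat) (g : nat * nat -> V) :
  monomial_listing e ->
  \sum_i g (e i) = \sum_(0 <= k < d.+1) \sum_(0 <= l < d.+1 - k) g (k, l).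
Proof.
move=> [inj he].
have E : perm_eq [seq e i | i <- index_enum 'I_(nb_monomials d)]
   [seq (k, l) | k <- index_iota 0 d.+1, l <- index_iota 0 (d.+1 - k)].
  apply: uniq_perm.
  - by rewrite map_inj_uniq // index_enum_uniq.
  - apply: allpairs_uniq_dep; [exact: iota_uniq|by move=> k _; exact: iota_uniq|].
    by move=> [k1 l1] [k2 l2] /= _ _ [-> ->].
  move=> [k l]; apply/mapP/allpairsPdep => /=.
    move=> [i _ hi]; exists k, l; split=> //; rewrite mem_index_iota.
      by have := (he k l).2 (ex_intro _ i (esym hi)); lia.
    by have := (he k l).2 (ex_intro _ i (esym hi)); lia.
  move=> [k' [l' [h1 h2 [-> ->]]]]; move: h1 h2; rewrite !mem_index_iota => h1 h2.
  have [i hi] : exists i, e i = (k', l') by apply/he; lia.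
  by exists i => //; exact: mem_index_enum.
rewrite -(big_map e xpredT g) (perm_big _ E) big_allpairs_dep.
by [].
Qed.

Lemma sum_nat_fst d : (6 * (\sum_(0 <= k < d.+1) \sum_(0 <= l < d.+1 - k) k) = d * (d.+1 * d.+2))%N.
Proof.
under eq_bigr => k _ do rewrite sum_nat_const_nat subn0.
(* Closed form of the partial sums, with the negative terms moved to the left so that natural
   subtraction does not interfere. *)
suff h m : (m <= d.+1)%N -> (6 * (\sum_(0 <= k < m) (d.+1 - k) * k) + 2 * m * m * m + 3 * m * d + 4 * m
    = 3 * m * m * d + 6 * m * m)%N.
  by have := h d.+1 (leqnn _); nia.
elim: m => [|m IH] hm; first by rewrite big_geq.
rewrite big_nat_recr //= mulnDr.
have := IH (ltnW hm).
have -> : (d.+1 - m = d - m + 1)%N by lia.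
have hd : (m <= d)%N by lia.
move: hd; set s := (\sum_(0 <= k < m) _)%N.
move=> hd; rewrite -(subnKC hd); move: (d - m)%N => q.
have -> : (m + q - m = q)%N by lia.
nia.
Qed.

Lemma sum_nat_snd d : (\sum_(0 <= k < d.+1) \sum_(0 <= l < d.+1 - k) l =
  \sum_(0 <= k < d.+1) \sum_(0 <= l < d.+1 - k) k)%N.
Proof.
have E (F : nat -> nat -> nat) : (\sum_(0 <= k < d.+1) \sum_(0 <= l < d.+1 - k) F k l =
  \sum_(0 <= k < d.+1) \sum_(0 <= l < d.+1 | k + l < d.+1) F k l)%N.
  rewrite [LHS]big_nat [RHS]big_nat; apply: eq_bigr => k hk.
  rewrite (big_nat_widen 0 (d.+1 - k) d.+1) ?leq_subr //.
  by apply: eq_bigl => l /=; rewrite ltn_subRL.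
rewrite !E (exchange_big_dep_nat xpredT) //=.
by apply: eq_bigr => k _; apply: eq_bigl => l; rewrite addnC.
Qed.

Lemma nb_monomialsE d : (2 * nb_monomials d = d.+1 * d.+2)%N.
Proof.
rewrite /nb_monomials mul2n -[RHS]odd_double_half oddM /= negbK.
by case: (odd d).
Qed.

End SumsOverMonomials.

Section Rounding.
Variable R : realType.

Lemma round_to_zero_bounds (x : R) :
  `|x - (round_to_zero x)%:~R| <= 1 /\ `|(round_to_zero x)%:~R| <= `|x|.
Proof.
rewrite /round_to_zero; case: ifPn => [x0|]; last first.
  rewrite -ltNge => x0; rewrite ceilNfloor rmorphN /=.
  have h1 := floor_le (- x); have h2 := floorD1_gt (- x).
  have h3 : 0 <= (Num.floor (- x))%:~R :> R by rewrite ler0z floor_ge0 oppr_ge0 ltW.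
  rewrite rmorphD /= rmorph1 in h2; rewrite (ltr0_norm x0) normrN (ger0_norm h3); split=> //.
  by rewrite ler_norml; move: h1 h2; lra.
have h1 := floor_le x; have h2 := floorD1_gt x.
have h3 : 0 <= (Num.floor x)%:~R :> R by rewrite ler0z floor_ge0.
rewrite rmorphD /= rmorph1 in h2; rewrite (ger0_norm x0) (ger0_norm h3); split=> //.
by rewrite ler_norml; move: h1 h2; lra.
Qed.

End Rounding.

(** * Size, precision and rank of the rounded matrix *)

Section Algorithm.
Variables (R : realType) (f : R[i] -> R[i]) (I : alg2_input R).
Local Notation C := R[i].
Local Notation nc := (@Normc.normc R).
Local Arguments Normc.normc : simpl never.
Local Notation N := (in_N I).
Local Notation N1 := (in_N1 I).
Local Notation N2 := (in_N2 I).
Local Notation u := (in_u I).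
Local Notation v := (in_v I).
Local Notation rho1 := (in_rho1 I).
Local Notation rho2 := (in_rho2 I).
Local Notation E1 := (in_E1 I).
Local Notation E2 := (in_E2 I).
Local Notation X := (max_norm E1 id).
Local Notation F := (max_norm_add E1 E2 f).

Variable e : 'I_N -> nat * nat.
Hypotheses (he : entire f) (hr : real_on_reals f) (hv : alg2_valid f I).
Hypotheses (X0 : 0 < X) (F0 : 0 < F).

Lemma alg2_valid_facts : [/\ in_a1 I < in_b1 I, in_a2 I < in_b2 I, (0 < N1)%N, (0 < N2)%N
  & [/\ 2 <= rho1, 2 <= rho2, (0 < u)%N & (0 < v)%N]].
Proof.
by case: hv => -[h1 h2 _] [_ h3 h4] [h5 h6 _] [h7 h8] _; split=> //; exact: (@ltn_trans 1).
Qed.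

Lemma rho_ge1 (x : R) : 2 <= x -> 1 <= x.
Proof. by apply: le_trans; rewrite ler1n. Qed.

Lemma max_norm_ub z : E1 z -> nc z <= X.
Proof.
move=> hz; have [ab1 _ _ _ [r1 _ _ _]] := alg2_valid_facts.
apply: ub_le_sup; last by exists z.
exists (disc_of rho1 (in_a1 I) (in_b1 I)) => _ [w hw <-].
exact: ellipse_disc ab1 (rho_ge1 r1) hw.
Qed.

Lemma max_norm_add_ub z t : E1 z -> E2 t -> nc (f z + t) <= F.
Proof.
move=> hz ht; have [ab1 ab2 _ _ [r1 r2 _ _]] := alg2_valid_facts.
have [B B0 hB] := poly_approx_bounded (entire_approx he) (disc_of_gt0 ab1 (rho_ge1 r1)).
apply: ub_le_sup; last by exists z => //; exists t.
exists (B + disc_of rho2 (in_a2 I) (in_b2 I)) => _ [w hw [s hs <-]].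
apply: le_trans (le_normcD _ _) _; apply: lerD.
  by apply: hB; exact: ellipse_disc ab1 (rho_ge1 r1) hw.
exact: ellipse_disc ab2 (rho_ge1 r2) hs.
Qed.

Definition monomial_size (kl : nat * nat) : R :=
  u%:R ^+ kl.1 * v%:R ^+ kl.2 * X ^+ kl.1 * F ^+ kl.2.

Lemma alg2_RE kl : alg2_R f I kl = 64 * monomial_size kl * decay I.
Proof. by rewrite /alg2_R /monomial_size; ring. Qed.

Lemma monomial_size_gt0 kl : 0 < monomial_size kl.
Proof.
have [_ _ _ _ [_ _ u0 v0]] := alg2_valid_facts.
by rewrite /monomial_size !mulr_gt0 // exprn_gt0 // ltr0n.
Qed.

Lemma decay_gt0 : 0 < decay I.
Proof.
have [_ _ _ _ [r1 r2 _ _]] := alg2_valid_facts.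
by rewrite addr_gt0 // invr_gt0 exprn_gt0 // (lt_le_trans _ (rho_ge1 _)).
Qed.

Lemma alg2_R_gt0 kl : 0 < alg2_R f I kl.
Proof.
rewrite alg2_RE; apply: mulr_gt0; last exact: decay_gt0.
by apply: mulr_gt0 => //; exact: monomial_size_gt0.
Qed.

Definition complex_monomial (kl : nat * nat) (z t : C) : C :=
  (u%:R * z) ^+ kl.1 * (v%:R * (f z + t)) ^+ kl.2.

Lemma real_part_onE x : f x%:C = (real_part_on f x)%:C.
Proof. by apply: complex_ext; rewrite //= hr. Qed.

Lemma complex_monomialR kl (x t : R) :
  complex_monomial kl x%:C t%:C = (monomial_fun f u v kl x t)%:C.
Proof.
rewrite /complex_monomial /monomial_fun real_part_onE.
by rewrite -!(rmorph_nat (real_complex R)) -!(rmorphM, rmorphD, rmorphXn).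
Qed.

Lemma complex_monomial_approx1 kl t : poly_approx (fun z => complex_monomial kl z t).
Proof.
apply: poly_approxM; apply: poly_approxX; (apply: poly_approxM; first exact: poly_approx_cst).
  exact: poly_approx_id.
by apply: poly_approxD; [exact: entire_approx|exact: poly_approx_cst].
Qed.

Lemma complex_monomial_approx2 kl z : poly_approx (complex_monomial kl z).
Proof.
apply: poly_approxM; first exact: poly_approx_cst.
apply: poly_approxX; apply: poly_approxM; first exact: poly_approx_cst.
by apply: poly_approxD; [exact: poly_approx_cst|exact: poly_approx_id].
Qed.

Lemma complex_monomial_bound kl z t : E1 z -> E2 t -> nc (complex_monomial kl z t) <= monomial_size kl.
Proof.
move=> hz ht; rewrite /complex_monomial /monomial_size Normc.normcM !ncX !Normc.normcM.
have ncn k : nc (k%:R : C) = k%:R.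
  by rewrite -(rmorph_nat (real_complex R)) ncR ger0_norm.
rewrite !ncn !exprMn -!mulrA; apply: ler_wpM2l; first exact: exprn_ge0.
rewrite mulrCA; apply: ler_wpM2l; first exact: exprn_ge0.
apply: ler_pM; rewrite ?exprn_ge0 ?nc_ge0 //; apply: lerXn2r; rewrite ?nnegrE ?nc_ge0 ?(ltW X0) ?(ltW F0) //.
  exact: max_norm_ub.
exact: max_norm_add_ub.
Qed.

Local Notation A1 := (alg2_A1 f e).

Lemma alg2_A1_bound i k1 k2 :
  `|A1 i (mxvec_index k1 k2)| <= 16 * monomial_size (e i) / (rho1 ^+ k1 * rho2 ^+ k2).
Proof.
have [ab1 ab2 n1 n2 [r1 r2 _ _]] := alg2_valid_facts.
rewrite mxE mxvecE.
apply: (@chebyshev_coefs_bound _ _ _ _ _ _ _ n1 n2 ab1 ab2 _ _ (complex_monomial (e i))) => //.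
- by move=> x t; exact: complex_monomialR.
- by move=> t; exact: complex_monomial_approx1.
- by move=> z; exact: complex_monomial_approx2.
- by move=> z t; exact: complex_monomial_bound.
Qed.

Definition cheb_basis (x t : R) (k1 : 'I_N1) (k2 : 'I_N2) : R :=
  (chebyshev_on k1 (in_a1 I) (in_b1 I)).[x] * (chebyshev_on k2 (in_a2 I) (in_b2 I)).[t].

Lemma cheb_basis_le1 x t k1 k2 : in_a1 I <= x <= in_b1 I -> in_a2 I <= t <= in_b2 I ->
  `|cheb_basis x t k1 k2| <= 1.
Proof.
have [ab1 ab2 _ _ _] := alg2_valid_facts.
move=> hx ht; rewrite normrM -[leRHS]mulr1.
by apply: ler_pM => //; exact: chebyshev_on_le1.
Qed.

Lemma alg2_A1_error i x t : in_a1 I <= x <= in_b1 I -> in_a2 I <= t <= in_b2 I ->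
  `|monomial_fun f u v (e i) x t -
    \sum_(k1 < N1) \sum_(k2 < N2) A1 i (mxvec_index k1 k2) * cheb_basis x t k1 k2|
  <= alg2_R f I (e i).
Proof.
have [ab1 ab2 n1 n2 [r1 r2 _ _]] := alg2_valid_facts.
move=> hx ht; rewrite alg2_RE.
have := @chebyshev_interp_error _ _ _ _ _ _ _ n1 n2 ab1 ab2 _ _ (complex_monomial (e i))
  (monomial_fun f u v (e i)) (monomial_size (e i)) r1 r2 (complex_monomialR (e i))
  (complex_monomial_approx1 (e i)) (complex_monomial_approx2 (e i))
  (fun z t => @complex_monomial_bound (e i) z t) x t hx ht.
rewrite (_ : \sum_(k1 < N1) _ = \sum_(k1 < N1) \sum_(k2 < N2)
  A1 i (mxvec_index k1 k2) * cheb_basis x t k1 k2) //.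
by apply: eq_bigr => k1 _; apply: eq_bigr => k2 _; rewrite mxE mxvecE.
Qed.

Local Notation S := ((2 : R) ^ alg2_tprec f e).
Local Notation M := (alg2_M f e).

Lemma alg2_S_gt0 : 0 < S.
Proof. exact: exprz_gt0. Qed.

(** In [tprec] the summand 2 gives the factor 4, and the ceiling loses at most a factor 2. The lower
    bound makes the diagonal of [M] large compared with rounding errors; the upper bound later
    controls the logarithm of the scaling. *)
Lemma alg2_S_bounds (N0 : (0 < N)%N) : exists2 i0, forall i, alg2_R f I (e i0) <= alg2_R f I (e i)
  & 4 * N%:R <= S * alg2_R f I (e i0) <= 8 * N%:R.
Proof.
pose i00 := Ordinal N0.
case: (arg_minP (fun i => alg2_R f I (e i)) (erefl : xpredT i00)) => i0 _ hmin.
exists i0; first by move=> i; exact: hmin.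
have -> : S = expR ((alg2_tprec f e)%:~R * ln 2).
  have -> : S = (2 : R) `^ (alg2_tprec f e)%:~R by rewrite powR_intmul.
  by rewrite /powR ifF // pnatr_eq0.
rewrite /alg2_tprec.
have -> : inf (range (fun i => alg2_R f I (e i))) = alg2_R f I (e i0).
  apply/eqP; rewrite eq_le; apply/andP; split.
    apply: ge_inf; last by exists i0.
    by exists (alg2_R f I (e i0)) => _ [i _ <-]; exact: hmin.
  apply: lb_le_inf; first by exists (alg2_R f I (e i0)); exists i0.
  by move=> _ [i _ <-]; exact: hmin.
set r := alg2_R f I (e i0); have r0 : 0 < r by exact: alg2_R_gt0.
have l2 : 0 < ln 2 :> R by rewrite ln_gt0 // ltr1n.
have NR0 : 0 < N%:R :> R by rewrite ltr0n.
set c := Num.ceil _; rewrite rmorphD /=.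
have h1 := ceil_ge (- log2 r + log2 N%:R); have h2 := ceilB1_lt (- log2 r + log2 N%:R).
rewrite -/c in h1 h2; rewrite rmorphB /= rmorph1 in h2.
have E : expR ((- log2 r + log2 N%:R) * ln 2) * r = N%:R.
  rewrite /log2 mulrDl mulNr !divfK ?lt0r_neq0 // expRD expRN !lnK ?posrE //.
  by rewrite mulrAC mulVf ?mul1r // lt0r_neq0.
apply/andP; split.
  have -> : 4 * N%:R = expR ((- log2 r + log2 N%:R + 2) * ln 2) * r.
    rewrite [_ * ln 2]mulrDl expRD mulrAC E expRM_natl lnK ?posrE //; ring.
  by rewrite ler_pM2r // ler_expR ler_pM2r // lerD2r.
have -> : 8 * N%:R = expR ((- log2 r + log2 N%:R + 3) * ln 2) * r.
  rewrite [_ * ln 2]mulrDl expRD mulrAC E expRM_natl lnK ?posrE //; ring.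
rewrite ler_pM2r // ler_expR ler_pM2r //; move: h2; lra.
Qed.

Lemma alg2_M_A1 i (j : 'I_(N1 * N2)) : M i (lshift N j) = round_to_zero (S * A1 i j).
Proof. by rewrite mxE mxE row_mxEl. Qed.

Lemma alg2_M_A2 i (j : 'I_N) : M i (rshift (N1 * N2) j) =
  if i == j then round_to_zero (S * alg2_R f I (e i)) else 0.
Proof.
rewrite mxE mxE row_mxEr !mxE; case: eqVneq => [->|_]; first by rewrite mulr1n.
by rewrite mulr0n mulr0 /round_to_zero lexx floor0.
Qed.

Lemma alg2_diag_ge i : (0 < N)%N -> (4 * N%:R <= round_to_zero (S * alg2_R f I (e i)))%R.
Proof.
move=> N0; have [i0 hmin /andP[h1 _]] := alg2_S_bounds N0.
have h : 4 * N%:R <= S * alg2_R f I (e i).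
  by apply: le_trans h1 _; rewrite ler_pM2l ?alg2_S_gt0.
rewrite /round_to_zero ifT; last by apply: le_trans h; rewrite mulr_ge0.
by rewrite floor_ge_int rmorphM /= !rmorph_nat.
Qed.

Lemma alg2_M_row_free : (0 < N)%N -> row_free (map_mx (intr : int -> rat) M).
Proof.
move=> N0; apply: inj_row_free => w /rowP hw; apply/rowP => i; rewrite mxE.
have := hw (rshift (N1 * N2) i); rewrite !mxE (bigD1 i) //= big1 ?addr0 => [|j hj].
  rewrite mxE alg2_M_A2 eqxx => /eqP; rewrite mulf_eq0 => /orP[/eqP //|].
  rewrite intr_eq0 => /eqP E; have := alg2_diag_ge i N0; rewrite E.
  by rewrite leNgt mulr_gt0 // ltr0n.
by rewrite mxE alg2_M_A2 (negPf hj) rmorph0 mulr0.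
Qed.

End Algorithm.

Lemma rounding_double (R : realType) (z y b : R) :
  `|y - z| <= 1 -> 4 * b <= z -> 1 <= b -> y <= 2 * z.
Proof. by rewrite ler_norml; lra. Qed.

(** The logarithmic comparison behind [alg2_row_small]. The scaling enters the determinant bound to
    the power [2 * n] and the target to the power [2 * (n - 1)], so only [2 * s] survives. *)
Lemma norm_arith (R : realType) (s l128 k l16 l2 sm lr n W : R) :
  0 <= l16 -> 0 <= k -> 0 <= l2 -> 1 <= n ->
  n ^+ 2 * l2 + 4 * n * (l16 + k) + 2 * n * l128 + 2 * s + 2 * sm <= 2 * W * lr ->
  (n + 1) * (n - 1) * l2 +
    (n * k + n * k + 2 * (n * l128 + n * s + sm) + 2 * (- W * lr)) <= 2 * (n - 1) * (s - (l16 + k)).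
Proof. by move=> *; nra. Qed.

(** * Short lattice vectors and small polynomials *)

Section Success.
Variables (R : realType) (f : R[i] -> R[i]) (I : alg2_input R).
Local Notation C := R[i].
Local Notation N := (in_N I).
Local Notation N1 := (in_N1 I).
Local Notation N2 := (in_N2 I).
Local Notation u := (in_u I).
Local Notation v := (in_v I).
Local Notation rho1 := (in_rho1 I).
Local Notation rho2 := (in_rho2 I).
Local Notation X := (max_norm (in_E1 I) id).
Local Notation F := (max_norm_add (in_E1 I) (in_E2 I) f).

Variable e : 'I_N -> nat * nat.
Hypotheses (he : entire f) (hr : real_on_reals f) (hv : alg2_valid f I).
Hypotheses (X0 : 0 < X) (F0 : 0 < F) (N2le : (2 <= N)%N).

Local Notation S := ((2 : R) ^ alg2_tprec f e).
Local Notation M := (alg2_M f e).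
Local Notation A1 := (alg2_A1 f e).
Local Notation K := (N + N1 * N2)%N.
Local Notation msize := (monomial_size f I).

Let N0 : (0 < N)%N. Proof. exact: ltnW. Qed.
Let K0 : 0 < K%:R :> R. Proof. by rewrite ltr0n addn_gt0 N0. Qed.
Let S0 : 0 < S. Proof. exact: exprz_gt0. Qed.

Lemma row_norm_sq n m (A : 'M[int]_(n, m)) i : row_norm R A i ^+ 2 = (dot (row i A) (row i A))%:~R.
Proof.
rewrite /row_norm sqr_sqrtr; last by apply: sumr_ge0 => j _; exact: sqr_ge0.
by rewrite rmorph_sum /=; apply: eq_bigr => j _; rewrite !mxE rmorphM expr2.
Qed.

Lemma row_norm_ge0 n m (A : 'M[int]_(n, m)) i : 0 <= row_norm R A i.
Proof. exact: sqrtr_ge0. Qed.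

Lemma row_norm_entry n m (A : 'M[int]_(n, m)) i j : `|(A i j)%:~R| <= row_norm R A i.
Proof.
rewrite /row_norm -sqrtr_sqr; apply: ler_wsqrtr; rewrite (bigD1 j) //= lerDl.
by apply: sumr_ge0 => k _; exact: sqr_ge0.
Qed.

Lemma eval2_alg2_P (U : 'M[int]_N) r (x y : R) :
  eval2 (alg2_P e U r) x y = \sum_i (U r i)%:~R * (x ^+ (e i).1 * y ^+ (e i).2).
Proof.
rewrite /eval2 /alg2_P rmorph_sum /= horner_sum horner_sum; apply: eq_bigr => i _.
rewrite !rmorphM /= !rmorphXn /= map_polyX map_polyC /= map_polyX rmorph_int /=.
have -> : (U r i)%:~R = ((U r i)%:~R : R)%:P%:P by rewrite !rmorph_int.
by rewrite !(hornerM, hornerC, hornerXn, horner_exp, hornerX) mulrA.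
Qed.

Section SmallRow.
Variables (U : 'M[int]_N) (r : 'I_N) (x t : R).
(** Sixteen times stronger than the test of the algorithm, to absorb the doublings due to
    rounding. *)
Hypothesis hrow : row_norm R (U *m M) r <= S / (16 * K%:R).
Hypotheses (hx : in_a1 I <= x <= in_b1 I) (ht : in_a2 I <= t <= in_b2 I).

Let eta : R := (16 * K%:R)^-1.
Let eta0 : 0 < eta. Proof. by rewrite invr_gt0 mulr_gt0. Qed.
Let entry c : `|((U *m M) r c)%:~R| <= S * eta :> R.
Proof. exact: le_trans (row_norm_entry _ _ _) hrow. Qed.

(** The diagonal block isolates the entries of [U]. The first bound absorbs the rounding errors of
    the Chebyshev block, the second the interpolation errors. *)
Let coef_bounds i : `|(U r i)%:~R| * N%:R <= S * eta :> R /\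
  `|(U r i)%:~R| * alg2_R f I (e i) <= 2 * eta :> R.
Proof.
pose D := round_to_zero (S * alg2_R f I (e i)).
have D4 : 4 * N%:R <= D%:~R :> R.
  have := alg2_diag_ge e hv X0 F0 i N0; rewrite -/D -(ler_int R).
  by rewrite rmorphM /= !rmorph_nat.
have D0 : 0 < D%:~R :> R by apply: lt_le_trans D4; rewrite mulr_gt0 // ltr0n.
have E : (U *m M) r (rshift (N1 * N2) i) = U r i * D.
  rewrite mxE (bigD1 i) //= big1 ?addr0 => [|j hj]; first by rewrite alg2_M_A2 eqxx.
  by rewrite alg2_M_A2 (negPf hj) mulr0.
have := entry (rshift (N1 * N2) i); rewrite E rmorphM normrM (gtr0_norm D0) => h.
have a0 : 0 <= `|(U r i)%:~R| :> R by [].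
have NR : 1 <= N%:R :> R by rewrite ler1n.
split; first by apply: le_trans h; apply: ler_wpM2l => //; apply: le_trans D4; rewrite ler_peMl // ler1n.
have [h1 _] := round_to_zero_bounds (S * alg2_R f I (e i)).
have h2 : S * alg2_R f I (e i) <= 2 * D%:~R.
  exact: rounding_double h1 D4 NR.
rewrite -(ler_pM2l S0); apply: (@le_trans _ _ (2 * (`|(U r i)%:~R| * D%:~R))).
  by rewrite mulrCA [leRHS]mulrCA; apply: ler_wpM2l.
by rewrite [leRHS]mulrCA ler_pM2l.
Qed.

Let combination_bound (c : 'I_(N1 * N2)) :
  `|\sum_i (U r i)%:~R * A1 i c| <= 2 * eta :> R.
Proof.
rewrite -(ler_pM2l S0) -{1}(gtr0_norm S0) -normrM.
have -> : S * \sum_i (U r i)%:~R * A1 i c = ((U *m M) r (lshift N c))%:~R +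
   \sum_i (U r i)%:~R * (S * A1 i c - (round_to_zero (S * A1 i c))%:~R).
  rewrite mxE rmorph_sum /= -big_split mulr_sumr; apply: eq_bigr => i _ /=.
  by rewrite alg2_M_A1 rmorphM /= -mulrDr addrC subrK mulrCA.
apply: le_trans (ler_normD _ _) _.
rewrite [leRHS]mulrCA mulr_natl mulr2n.
apply: lerD; first exact: entry.
apply: le_trans (ler_norm_sum _ _ _) _.
apply: (@le_trans _ _ (\sum_(i < N) S * eta / N%:R)).
  apply: ler_sum => i _; rewrite normrM.
  have [h1 _] := round_to_zero_bounds (S * A1 i c).
  have [h2 _] := coef_bounds i.
  rewrite -[leRHS]mulr1; apply: ler_pM => //.
  by rewrite ler_pdivlMr // ltr0n.
by rewrite sumr_const card_ord -[leLHS]mulr_natr divfK // pnatr_eq0 -lt0n.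
Qed.

(** Each monomial function is its interpolant plus an error of at most [alg2_R]. The diagonal block
    controls the errors, the Chebyshev block the interpolants, since the basis functions are at most
    1 in modulus. The total is at most [K * (2 * eta) = 1 / 8]. *)
Lemma alg2_P_small : `|eval2 (alg2_P e U r) (u%:R * x) (v%:R * (real_part_on f x + t))| < 1.
Proof.
rewrite eval2_alg2_P.
pose p i := \sum_(k1 < N1) \sum_(k2 < N2) A1 i (mxvec_index k1 k2) * cheb_basis x t k1 k2.
have -> : \sum_i (U r i)%:~R * ((u%:R * x) ^+ (e i).1 * (v%:R * (real_part_on f x + t)) ^+ (e i).2)
  = \sum_i (U r i)%:~R * (monomial_fun f u v (e i) x t - p i) + \sum_i (U r i)%:~R * p i.
  by rewrite -big_split /=; apply: eq_bigr => i _; rewrite -mulrDr subrK.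
have b1 : `|\sum_i (U r i)%:~R * (monomial_fun f u v (e i) x t - p i)| <= N%:R * (2 * eta).
  apply: le_trans (ler_norm_sum _ _ _) _.
  apply: (@le_trans _ _ (\sum_(i < N) 2 * eta)); last by rewrite sumr_const card_ord -[leLHS]mulr_natl.
  apply: ler_sum => i _; rewrite normrM; have [_ h] := coef_bounds i.
  apply: le_trans h; apply: ler_wpM2l => //.
  exact: alg2_A1_error.
have b2 : `|\sum_i (U r i)%:~R * p i| <= (N1 * N2)%:R * (2 * eta).
  have -> : \sum_i (U r i)%:~R * p i = \sum_(k1 < N1) \sum_(k2 < N2)
     (\sum_i (U r i)%:~R * A1 i (mxvec_index k1 k2)) * cheb_basis x t k1 k2.
    under eq_bigr => i _ do rewrite mulr_sumr.
    rewrite exchange_big; apply: eq_bigr => k1 _.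
    under eq_bigr => i _ do rewrite mulr_sumr.
    rewrite exchange_big; apply: eq_bigr => k2 _; rewrite mulr_suml.
    by apply: eq_bigr => i _; rewrite mulrA.
  apply: le_trans (ler_norm_sum _ _ _) _.
  apply: (@le_trans _ _ (\sum_(k1 < N1) \sum_(k2 < N2) 2 * eta)); last first.
    by rewrite !sumr_const !card_ord -[leLHS]mulrnA mulnC -[leLHS]mulr_natl.
  apply: ler_sum => k1 _; apply: le_trans (ler_norm_sum _ _ _) _; apply: ler_sum => k2 _.
  rewrite normrM -[leRHS]mulr1; apply: ler_pM => //.
  exact: (cheb_basis_le1 hv).
apply: le_lt_trans (ler_normD _ _) _.
apply: (@le_lt_trans _ _ (K%:R * (2 * eta))).
  by rewrite natrD mulrDl; apply: lerD.
by rewrite /eta invfM mulrCA (mulrCA K%:R) mulfV ?lt0r_neq0 // mulr1 ltr_pdivrMr // mul1r ltr_nat.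
Qed.

End SmallRow.

Section NormBound.
Variables (gamma W : R).
Hypothesis hrho : rho2 = rho1 `^ gamma.
Hypothesis hW : forall g : 'I_N -> 'I_(N1 * N2 + N), injective g ->
  W <= \sum_i column_weight N1 N2 N gamma 0 (g i).

Let rho1_ge1 : 1 <= rho1.
Proof. by have [_ _ _ _ [h _ _ _]] := alg2_valid_facts hv; exact: rho_ge1 h. Qed.
Let rho1_gt0 : 0 < rho1. Proof. exact: lt_le_trans rho1_ge1. Qed.

(** The constant is 64 * 2 in the diagonal block, where [decay] is at most twice its larger term; it
    dominates the 16 of the Chebyshev block. The relation [hrho] makes all decays powers of [rho1],
    and rounding toward zero does not enlarge entries. *)
Lemma alg2_M_entry i c : `|(M i c)%:~R| <= 128 * S * msize (e i) *
  rho1 `^ (- column_weight N1 N2 N gamma 0 c) :> R.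
Proof.
have m0 := monomial_size_gt0 hv X0 F0 (e i).
have sm : 0 <= S * msize (e i) by rewrite mulr_ge0 // ltW.
have re (k1 k2 : nat) : rho1 `^ (- (k1%:R + gamma * k2%:R)) = (rho1 ^+ k1 * rho2 ^+ k2)^-1.
  rewrite powRN powRD; last by rewrite (gt_eqF rho1_gt0) implybT.
  rewrite powRrM -hrho.
  by rewrite !powR_mulrn ?(ltW rho1_gt0) // hrho powR_ge0.
case: (splitP c) => j hj.
  have -> : c = lshift N j by apply: val_inj.
  rewrite alg2_M_A1 row_mxEl; case/mxvec_indexP: j {c hj} => k1 k2.
  rewrite mxvecE [X in rho1 `^ (- X)]mxE re.
  have [_ h] := round_to_zero_bounds (S * A1 i (mxvec_index k1 k2)).
  apply: le_trans h _; rewrite normrM (gtr0_norm S0).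
  have := alg2_A1_bound e he hr hv X0 F0 i k1 k2 => h.
  apply: (@le_trans _ _ (S * (16 * msize (e i) / (rho1 ^+ k1 * rho2 ^+ k2)))).
    by rewrite ler_pM2l.
  have -> : S * (16 * msize (e i) / (rho1 ^+ k1 * rho2 ^+ k2)) =
    16 * (S * msize (e i)) / (rho1 ^+ k1 * rho2 ^+ k2) by rewrite !mulrA (mulrC S).
  rewrite -[128 * S * _]mulrA; apply: ler_wpM2r.
    by rewrite -re powR_ge0.
  by apply: ler_wpM2r => //; rewrite ler_nat.
have -> : c = rshift (N1 * N2) j by apply: val_inj.
rewrite alg2_M_A2 row_mxEr [X in rho1 `^ (- X)]mxE; set w := Num.min _ _.
have p0 : 0 <= 128 * S * msize (e i) * rho1 `^ (- w).
  by rewrite -[128 * S * _]mulrA mulr_ge0 ?powR_ge0 // mulr_ge0.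
case: ifP => _; last by rewrite rmorph0 normr0.
have [_ h] := round_to_zero_bounds (S * alg2_R f I (e i)).
apply: le_trans h _; rewrite normrM (gtr0_norm S0) (gtr0_norm (alg2_R_gt0 hv X0 F0 (e i))) alg2_RE.
have d2 : decay I <= 2 * rho1 `^ (- w).
  rewrite mulr_natl mulr2n; apply: lerD.
    rewrite -powR_invn ?(ltW rho1_gt0) //; apply: ler_powR => //.
    by rewrite lerN2 ge_min lexx.
  rewrite hrho -powR_invn ?powR_ge0 // -powRrM; apply: ler_powR => //.
  by rewrite mulrN lerN2 ge_min lexx orbT.
have -> : S * (64 * msize (e i) * decay I) = 64 * (S * msize (e i)) * decay I.
  by rewrite !mulrA (mulrC S).
have -> : 128 * S * msize (e i) * rho1 `^ (- w) = 64 * (S * msize (e i)) * (2 * rho1 `^ (- w)).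
  have E (s m p : R) : 128 * s * m * p = 64 * (s * m) * (2 * p) by ring.
  exact: E.
by apply: ler_wpM2l => //; rewrite mulr_ge0.
Qed.

Lemma fact_le_exp n : (n`! <= n ^ n)%N.
Proof.
elim: n => // n IH; rewrite factS expnS leq_mul2l /=.
by apply: leq_trans IH _; case: n => // n; rewrite leq_exp2r.
Qed.

Lemma alg2_det_bound : (\det (M *m M^T))%:~R <=
  K%:R ^+ N * K%:R ^+ N * (128 ^+ N * S ^+ N * \prod_i msize (e i)) ^+ 2 * (rho1 `^ (- W)) ^+ 2 :> R.
Proof.
have m0 i := monomial_size_gt0 hv X0 F0 (e i).
rewrite -det_map_mx map_mxM -map_trmx.
have := @det_gram_le R _ _ (map_mx intr M) (fun i => 128 * S * msize (e i))
  (fun c => rho1 `^ (- column_weight N1 N2 N gamma 0 c)) (rho1 `^ (- W)).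
move=> /(_ _ _ _ _ _)/le_trans; apply.
- by move=> i; rewrite -mulrA mulr_ge0 // mulr_ge0 // ltW.
- by move=> c; exact: powR_ge0.
- by move=> i c; rewrite mxE; exact: alg2_M_entry.
- move=> g inj; have h := hW inj.
  have -> : \prod_i rho1 `^ (- column_weight N1 N2 N gamma 0 (g i)) =
     rho1 `^ (- \sum_i column_weight N1 N2 N gamma 0 (g i)).
    rewrite -sumrN; elim/big_rec2 : _ => [|i y z _ ->]; first by rewrite powRr0.
    by rewrite powRD // (gt_eqF rho1_gt0) implybT.
  by apply: ler_powR => //; rewrite lerN2.
- exact: powR_ge0.
rewrite big_split /= big_split /= !prodr_const card_ord; apply: ler_wpM2r; first exact: sqr_ge0.
apply: ler_wpM2r; first exact: sqr_ge0.
rewrite -!natrX -!natrM ler_nat; apply: leq_mul; first by rewrite addnC.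
apply: leq_trans (fact_le_exp _) _; rewrite leq_exp2r // leq_addr //.
Qed.

(** The term in [16 * K] covers both factors [K ^+ N] of the determinant bound and the denominator
    of the target; the term in [ln 2] is the loss of LLL. *)
Hypothesis main : N%:R ^+ 2 * ln 2 + 4 * N%:R * ln (16 * K%:R) + 2 * N%:R * ln 128 + 2 * ln S
  + 2 * (\sum_i ln (msize (e i))) <= 2 * W * ln rho1.

Lemma alg2_row_small U (r : 'I_N) : lll_output M U -> (r < 2)%N ->
  row_norm R (U *m M) r <= S / (16 * K%:R).
Proof.
move=> hU r2; have h := lll_output_bound N2le hU r2.
have K16 : 0 < 16 * K%:R :> R by rewrite mulr_gt0.
have N1R : 0 < N.-1%:R :> R by rewrite ltr0n -ltnS prednK.
rewrite -(@ler_pXn2r _ (2 * N.-1)) ?nnegrE ?row_norm_ge0 ?divr_ge0 ?(ltW S0) ?(ltW K16) //; last first.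
  by rewrite muln_gt0 -[X in _ && X](ltr0n R) N1R.
rewrite exprM row_norm_sq.
rewrite -(ler_int R) rmorphM !rmorphXn /= in h.
apply: le_trans h _; rewrite rmorph_nat.
apply: (@le_trans _ _ (2 ^+ (N.+1 * N.-1) * (K%:R ^+ N * K%:R ^+ N *
   (128 ^+ N * S ^+ N * \prod_i msize (e i)) ^+ 2 * (rho1 `^ (- W)) ^+ 2))).
  by apply: ler_wpM2l; [exact: exprn_ge0|exact: alg2_det_bound].
have m0 i : 0 < msize (e i) := monomial_size_gt0 hv X0 F0 (e i).
have pm0 : 0 < \prod_i msize (e i) by apply: prodr_gt0.
have lnpm : ln (\prod_i msize (e i)) = \sum_i ln (msize (e i)).
  have : 0 < \prod_i msize (e i) /\ ln (\prod_i msize (e i)) = \sum_i ln (msize (e i)).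
    elim/big_rec2 : _ => [|i y z _ [h1 h2]]; first by rewrite ln1.
    by rewrite mulr_gt0 // lnM ?posrE // h2.
  by case.
have pw0 : 0 < rho1 `^ (- W) by exact: powR_gt0.
have pp (k n : nat) : 0 < k%:R ^+ n :> R -> 0 < k%:R ^+ n :> R by [].
rewrite -ler_ln ?posrE; last first.
- by rewrite exprn_gt0 // divr_gt0.
- by rewrite !mulr_gt0 ?exprn_gt0 // ?mulr_gt0 ?exprn_gt0.
rewrite lnXn ?divr_gt0 // ln_div ?posrE //.
rewrite lnM ?posrE ?exprn_gt0 //; last by rewrite !mulr_gt0 ?exprn_gt0 // ?mulr_gt0 ?exprn_gt0.
rewrite lnM ?posrE ?exprn_gt0 //; last by rewrite !mulr_gt0 ?exprn_gt0 // ?mulr_gt0 ?exprn_gt0.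
rewrite lnM ?posrE ?exprn_gt0 //; last 2 first.
- by rewrite !mulr_gt0 ?exprn_gt0.
- by rewrite !mulr_gt0 ?exprn_gt0.
rewrite lnM ?posrE ?exprn_gt0 // !lnXn //; last by rewrite !mulr_gt0 ?exprn_gt0.
rewrite lnM ?posrE //; last by rewrite mulr_gt0 ?exprn_gt0.
rewrite lnM ?posrE ?exprn_gt0 // !lnXn // lnpm ln_powR.
have lK : ln (16 * K%:R) = ln 16 + ln K%:R :> R by rewrite lnM ?posrE.
have l16 : 0 <= ln 16 :> R by rewrite ln_ge0 // ler1n.
have lnK0 : 0 <= ln K%:R :> R by rewrite ln_ge0 // ler1n addn_gt0 N0.
have l2 : 0 <= ln 2 :> R by rewrite ln_ge0 // ler1n.
move: main; rewrite lK.
have NE : N.-1%:R = N%:R - 1 :> R by rewrite -subn1 natrB.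
have En (y : R) k : ln y *+ k = k%:R * ln y by rewrite mulr_natl.
have Ea (y z : R) k : (y + z) *+ k = k%:R * (y + z) by rewrite mulr_natl.
have Em (y z : R) k : (y * z) *+ k = k%:R * (y * z) by rewrite mulr_natl.
rewrite !(En, Ea, Em) !natrM NE -[N.+1%:R]natr1.
have n1 : 1 <= N%:R :> R by rewrite ler1n.
move: (ln S) (ln 128 : R) (ln (K%:R : R)) (ln 16 : R) (ln (2 : R)) (\sum_i ln _) (ln rho1) (N%:R : R)
  l16 lnK0 l2 n1 => s l128 k l16 l2 sm lr n p16 pk p2 n1.
exact: norm_arith.
Qed.

End NormBound.
End Success.

(** * A numerical criterion for success *)

Section SuccessCriterion.
Variables (R : realType) (f : R[i] -> R[i]) (I : alg2_input R).
Local Notation N := (in_N I).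
Local Notation N1 := (in_N1 I).
Local Notation N2 := (in_N2 I).
Local Notation d := (in_d I).
Local Notation u := (in_u I).
Local Notation v := (in_v I).
Local Notation rho1 := (in_rho1 I).
Local Notation rho2 := (in_rho2 I).
Local Notation X := (max_norm (in_E1 I) id).
Local Notation F := (max_norm_add (in_E1 I) (in_E2 I) f).
Local Notation K := (N + N1 * N2)%N.

Hypotheses (he : entire f) (hr : real_on_reals f) (hv : alg2_valid f I).
Variables (Xb kap Fb : R).
Hypotheses (X1 : 1 <= X) (XXb : X <= Xb) (kap0 : 0 < kap) (kap1 : kap <= 1)
  (kapF : kap <= F) (FFb : F <= Fb) (N2le : (2 <= N)%N).

Let X0 : 0 < X. Proof. exact: lt_le_trans X1. Qed.
Let F0 : 0 < F. Proof. exact: lt_le_trans kapF. Qed.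
Let Xb0 : 0 < Xb. Proof. exact: lt_le_trans XXb. Qed.
Let Fb0 : 0 < Fb. Proof. exact: lt_le_trans FFb. Qed.

Lemma ln_monomial_size kl : ln (monomial_size f I kl) =
  kl.1%:R * (ln u%:R + ln X) + kl.2%:R * (ln v%:R + ln F).
Proof.
have [_ _ _ _ [_ _ u0 v0]] := alg2_valid_facts hv.
have uR : 0 < u%:R :> R by rewrite ltr0n.
have vR : 0 < v%:R :> R by rewrite ltr0n.
rewrite /monomial_size lnM ?posrE ?mulr_gt0 ?exprn_gt0 //.
rewrite lnM ?posrE ?mulr_gt0 ?exprn_gt0 // lnM ?posrE ?exprn_gt0 // !lnXn //.
rewrite -!(mulr_natl (ln _)); ring.
Qed.

(** By symmetry both exponents have the same sum [T] over all monomials, and [3 * T = N * d]. This 3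
    is the one in the condition on [nu]. *)
Lemma sum_ln_monomial_size (e : 'I_N -> nat * nat) : monomial_listing e ->
  3 * \sum_i ln (monomial_size f I (e i)) <=
    N%:R * d%:R * (ln u%:R + ln v%:R + ln Xb + ln Fb).
Proof.
move=> le.
pose T := (\sum_(0 <= k < d.+1) \sum_(0 <= l < d.+1 - k) k)%N.
have ek : (\sum_i (e i).1 = T)%N by rewrite (monomial_listing_sum fst le).
have el : (\sum_i (e i).2 = T)%N by rewrite (monomial_listing_sum snd le) sum_nat_snd.
have eT : (3 * T = N * d)%N.
  have h1 := sum_nat_fst d; have h2 := nb_monomialsE d.
  apply/eqP; rewrite -(eqn_pmul2l (isT : (0 < 2)%N)) mulnA h1 -h2 /in_N.
  by apply/eqP; ring.
have -> : \sum_i ln (monomial_size f I (e i)) =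
    T%:R * (ln u%:R + ln X) + T%:R * (ln v%:R + ln F).
  rewrite -{1}ek -el !natr_sum !mulr_suml -big_split /=.
  by apply: eq_bigr => i _; rewrite ln_monomial_size.
have hX : ln X <= ln Xb by rewrite ler_ln ?posrE.
have hF : ln F <= ln Fb by rewrite ler_ln ?posrE.
rewrite -natrM -eT natrM -mulrDr -mulrA; apply: ler_wpM2l => //.
by apply: ler_wpM2l => //; move: hX hF; lra.
Qed.

(** In a monomial size all factors except the powers of [F] are at least 1, so every [alg2_R] is at
    least [kap ^+ d / rho1 ^+ N1]. This is where a positive lower bound on [F] enters. *)
Lemma ln_alg2_S (e : 'I_N -> nat * nat) : monomial_listing e ->
  ln ((2 : R) ^ alg2_tprec f e) <= ln (8 * N%:R) - d%:R * ln kap + N1%:R * ln rho1.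
Proof.
move=> le; have N0 : (0 < N)%N by exact: ltnW.
have [_ _ _ _ [r1 r2 u0 v0]] := alg2_valid_facts hv.
have r10 : 0 < rho1 by apply: lt_le_trans r1.
have r20 : 0 < rho2 by apply: lt_le_trans r2.
have [i0 _ /andP[_ hS]] := alg2_S_bounds e hv X0 F0 N0.
have S0 := @alg2_S_gt0 R f I e.
set s := (2 : R) ^ _ in hS S0 *.
have Rlow : kap ^+ d / rho1 ^+ N1 <= alg2_R f I (e i0).
  have hd : ((e i0).1 + (e i0).2 <= d)%N.
    by apply/(le.2 (e i0).1 (e i0).2); exists i0; case: (e i0).
  rewrite alg2_RE; apply: ler_pM.
  - by rewrite exprn_ge0 // ltW.
  - by rewrite invr_ge0 exprn_ge0 // ltW.
  - rewrite /monomial_size -[leLHS]mul1r; apply: ler_pM => //; rewrite ?ler1n //.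
      by rewrite exprn_ge0 // ltW.
    apply: (@le_trans _ _ (kap ^+ (e i0).2)).
      by apply: ler_wiXn2l; rewrite ?(ltW kap0) //; apply: leq_trans hd; rewrite leq_addl.
    rewrite -[leLHS]mul1r; apply: ler_pM => //; first by rewrite exprn_ge0 // ltW.
      rewrite mulr_ege1 ?mulr_ege1 ?exprn_ege1 ?ler1n //.
    by apply: lerXn2r; rewrite ?nnegrE ?(ltW F0) ?(ltW kap0).
  - by rewrite lerDl invr_ge0 exprn_ge0 // ltW.
have q0 : 0 < kap ^+ d / rho1 ^+ N1 by rewrite divr_gt0 ?exprn_gt0.
have : s * (kap ^+ d / rho1 ^+ N1) <= 8 * N%:R.
  by apply: le_trans hS; rewrite ler_pM2l.
have p1 : 0 < s * (kap ^+ d / rho1 ^+ N1) by exact: mulr_gt0.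
have p2 : 0 < 8 * N%:R :> R by rewrite mulr_gt0 // ltr0n.
rewrite -ler_ln ?posrE // [ln (s * _)]lnM ?posrE // ln_div ?posrE ?exprn_gt0 //.
rewrite !lnXn // -!(mulr_natl (ln _)).
move: (ln s) (ln (8 * N%:R)) (d%:R * ln kap) (N1%:R * ln rho1) => a b c g; lra.
Qed.

Lemma alg2_success (gamma W : R) : rho2 = rho1 `^ gamma ->
  (forall g : 'I_N -> 'I_(N1 * N2 + N), injective g ->
     W <= \sum_i column_weight N1 N2 N gamma 0 (g i)) ->
  N%:R ^+ 2 * ln 2 + 4 * N%:R * ln (16 * K%:R) + 2 * N%:R * ln 128
    + 2 * (ln (8 * N%:R) - d%:R * ln kap + N1%:R * ln rho1)
    + 2 / 3 * (N%:R * d%:R * (ln u%:R + ln v%:R + ln Xb + ln Fb)) <= 2 * W * ln rho1 ->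
  alg2_succeeds f I.
Proof.
move=> hrho hW hmain; split=> // e le M; split.
  by apply: lll_output_exists; apply: (alg2_M_row_free e hv X0 F0); exact: ltnW.
move=> U hU r r2.
have hrow : row_norm R (U *m M) r <= (2 : R) ^ alg2_tprec f e / (16 * K%:R).
  apply: (alg2_row_small he hr hv X0 F0 N2le hrho hW) => //.
  have h1 := sum_ln_monomial_size le; have h2 := ln_alg2_S le.
  move: hmain h1 h2; move: (ln ((2 : R) ^ alg2_tprec f e)) (\sum_i ln _) (ln (8 * N%:R) - _ + _)
    (N%:R * d%:R * _) (2 * W * ln rho1) (N%:R ^+ 2 * _ + _ + _) => y1 y2 y3 y4 y5 y6; lra.
have S0 := @alg2_S_gt0 R f I e.
have K0 : 0 < K%:R :> R by rewrite ltr0n addn_gt0 (ltnW N2le).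
split.
  apply: le_trans hrow _; rewrite ler_pM2l // lef_pV2 ?posrE ?mulr_gt0 //.
  by rewrite ler_peMl ?(ltW K0) // ler1n.
move=> x t; rewrite !in_itv /= => hx ht.
exact: (alg2_P_small he hr hv X0 F0 N2le hrow).
Qed.

End SuccessCriterion.

(** * Growth estimates *)

Section EllipseGrowth.
Variable R : realType.
Local Notation C := R[i].
Local Notation nc := (@Normc.normc R).
Local Arguments Normc.normc : simpl never.

Lemma polar_angle (x y : R) : x ^+ 2 + y ^+ 2 = 1 ->
  exists2 t, 0 <= t <= 2 * pi & cos t = x /\ sin t = y.
Proof.
move=> xy; have hx : -1 <= x <= 1 by apply/andP; split; have := sqr_ge0 y; nra.
have p0 := pi_ge0 R; have a0 := acos_ge0 hx; have a1 := acos_lepi hx.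
have ca : cos (acos x) = x by rewrite acosK // in_itv.
have sa : sin (acos x) = `|y|.
  by rewrite sin_acos // -sqrtr_sqr; congr Num.sqrt; rewrite -xy; ring.
case: (leP 0 y) => y0.
  exists (acos x); first by lra.
  by rewrite ca sa ger0_norm.
exists (2 * pi - acos x); first by lra.
rewrite mulr_natl cosB sinB cos2pi sin2pi ca sa ltr0_norm //; split; ring.
Qed.

(** Dividing the centered coordinates by the half-axes [p] and [q] brings the point into the unit
    disc, and its polar form there gives the scaling and the angle; the threshold on [rho] makes [q]
    at least [D]. The lemma serves for the point 1 and for two points where [f] differs. *)
Lemma ellipse_contains (a b : R) (z : C) : a < b -> exists2 rho0 : R, 1 <= rho0 &
  forall rho, rho0 <= rho -> ellipse_region rho a b z.
Proof.
move=> ab; have ba : 0 < b - a by rewrite subr_gt0.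
pose x := complex.Re z - (a + b) / 2; pose y := complex.Im z.
pose D := `|x| + `|y|; have D0 : 0 <= D by rewrite addr_ge0.
exists (2 + 4 * D / (b - a)); first by rewrite ler_wpDr // ?ler1n // divr_ge0 ?mulr_ge0 // ltW.
move=> rho hrho.
have q0 : 0 <= 4 * D / (b - a) by rewrite divr_ge0 ?mulr_ge0 // ltW.
have r2 : 2 <= rho by lra.
have r0 : 0 < rho by lra.
have ir : rho^-1 <= 1 by rewrite invf_le1 //; lra.
have ir0 : 0 < rho^-1 by rewrite invr_gt0.
pose p := (b - a) / 4 * (rho + rho^-1); pose q := (b - a) / 4 * (rho - rho^-1).
have b4 : 0 < (b - a) / 4 by rewrite divr_gt0.
have Dq : D <= q.
  have : 4 * D / (b - a) <= rho - rho^-1 by lra.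
  by rewrite ler_pdivrMr // /q; lra.
have qp : q <= p by rewrite /q /p ler_pM2l //; lra.
have q1 : 0 < q by rewrite /q mulr_gt0 //; lra.
have p1 : 0 < p by exact: lt_le_trans qp.
pose X := x / p; pose Y := y / q.
have hX : `|X| <= `|x| / q.
  rewrite normrM normfV (gtr0_norm p1); apply: ler_wpM2l => //.
  by rewrite lef_pV2 ?posrE.
have hY : `|Y| = `|y| / q by rewrite normrM normfV (gtr0_norm q1).
have XY : `|X| + `|Y| <= 1.
  apply: (@le_trans _ _ (D / q)); first by rewrite /D mulrDl hY lerD2r.
  by rewrite ler_pdivrMr // mul1r.
pose s := Num.sqrt (X ^+ 2 + Y ^+ 2).
have s2 : s ^+ 2 = X ^+ 2 + Y ^+ 2 by rewrite sqr_sqrtr // addr_ge0 ?sqr_ge0.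
have s0 : 0 <= s by exact: sqrtr_ge0.
have s1 : s <= 1.
  rewrite -(@ler_pXn2r _ 2) ?nnegrE // expr1n s2 -(real_normK (num_real X)) -(real_normK (num_real Y)).
  by have := normr_ge0 X; have := normr_ge0 Y; nra.
have [t ht [ct st]] : exists2 t, 0 <= t <= 2 * pi & s * cos t = X /\ s * sin t = Y.
  case: (eqVneq s 0) => [E|n0].
    exists 0; first by rewrite lexx mulr_ge0 // pi_ge0.
    move: s2; rewrite E !mul0r expr0n /= => /esym/eqP.
    by rewrite paddr_eq0 ?sqr_ge0 // !sqrf_eq0 => /andP[/eqP -> /eqP ->].
  have [|t ht [ct st]] := @polar_angle (X / s) (Y / s).
    have E2 (k l c : R) : c != 0 -> (k / c) ^+ 2 + (l / c) ^+ 2 = (k ^+ 2 + l ^+ 2) / c ^+ 2.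
      by move=> c0; field.
    by rewrite E2 // -s2 mulfV // expf_neq0.
  by exists t => //; rewrite ct st !(mulrC s) !divfK.
exists s; first by rewrite /= in_itv /= s0 s1.
exists t; first by rewrite /= in_itv.
have jE : (rho%:C * expi t + (rho^-1)%:C * expi (- t)) / 2%:R =
   ((rho + rho^-1) / 2 * cos t) +i* ((rho - rho^-1) / 2 * sin t).
  apply: (mulIf (C2 R)); rewrite divfK ?C2 // -(rmorph_nat (real_complex R)).
  by rewrite /expi cosN sinN; apply: complex_ext; rewrite !(ReD, ReM, ImD, ImM) /=; field;
    rewrite ?lt0r_neq0.
rewrite jE; apply: complex_ext; rewrite !(ReD, ReM, ImD, ImM) /= ?mul0r ?subr0 ?addr0 ?add0r.
  have -> : s * ((b - a) / 2 * ((rho + rho^-1) / 2 * cos t)) = p * (s * cos t).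
    by rewrite /p; field; rewrite lt0r_neq0.
  by rewrite ct /X mulrC divfK ?lt0r_neq0 // /x subrK.
have -> : s * ((b - a) / 2 * ((rho - rho^-1) / 2 * sin t)) = q * (s * sin t).
  by rewrite /q; field; rewrite lt0r_neq0.
by rewrite st /Y mulrC divfK ?lt0r_neq0.
Qed.

Lemma transcendental_nonconstant (f : C -> C) : transcendental f -> exists p q, f p != f q.
Proof.
move=> hf; apply: contrapT => H.
have cf z : f z = f 0 by apply/eqP; apply: contrapT => /negP n; apply: H; exists z, 0.
(* ['X%:P] is the second variable, the one evaluated at [f z]. *)
have := hf ('X%:P - (f 0)%:P%:P) _; have E : ('X%:P - (f 0)%:P%:P : {poly {poly C}}) != 0.
  by rewrite -rmorphB polyC_eq0 polyXsubC_eq0.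
move=> /(_ _)/eqP; rewrite (negPf E) => h; suff : false by [].
apply: h => z; rewrite !(hornerD, hornerN, hornerC, hornerX) cf subrr //.
Qed.

(** The limsup controls [f] on large circles. The additive constant is a bound of [f] on the
    remaining disc, which makes the estimate hold everywhere. *)
Lemma order_growth (f : C -> C) (theta theta1 : R) : entire f -> order_le f theta ->
  theta < theta1 -> exists2 A, 0 <= A & forall z, nc (f z) <= expR (A + (nc z) `^ theta1).
Proof.
move=> he; rewrite /order_le /limf_esup => ho ht.
have : (ereal_inf [set ereal_sup [set ((ln (ln (max_norm (circle rho) f)) / ln rho)%:E) | rho in V]
   | V in pinfty_nbhs R] < theta1%:E)%E.
  by apply: le_lt_trans ho _; rewrite lte_fin.
move=> /ereal_inf_lt[_ [V [m [mr hV]] <-] hsup].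
have bnd r : 0 < r -> exists2 B, 0 < B & forall z, nc z <= r -> nc (f z) <= B.
  by apply: poly_approx_bounded; exact: entire_approx.
pose m1 := Num.max m 2 + 1.
have m10 : 0 < m1 by rewrite ltr_wpDl // le_max ler0n orbT.
have [B B0 hB] := bnd m1 m10.
exists B; first exact: ltW.
move=> z; set rho := nc z.
have [hz|hz] := leP rho m1.
  apply: le_trans (hB z hz) _; apply: le_trans (expR_ge1Dx _).
  by rewrite addrCA lerDl addr_ge0 // powR_ge0.
have mx : Num.max m 2 < m1 by rewrite /m1 ltrDl.
have x2 : 2 <= Num.max m 2 by rewrite le_max lexx orbT.
have xm : m <= Num.max m 2 by rewrite le_max lexx.
have r2 : 2 < rho := lt_trans (le_lt_trans x2 mx) hz.
have rm : m < rho := lt_trans (le_lt_trans xm mx) hz.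
have r0 : 0 < rho by apply: lt_trans r2.
have lr0 : 0 < ln rho by rewrite ln_gt0 // (lt_trans _ r2) // ltr1n.
have [B' _ hB'] := bnd rho r0.
have zm : nc (f z) <= max_norm (circle rho) f.
  apply: ub_le_sup; last by exists z.
  by exists B' => _ [w hw <-]; apply: hB'; rewrite hw.
apply: le_trans zm _; set M := max_norm _ f.
have hM : ln (ln M) <= theta1 * ln rho.
  rewrite -ler_pdivrMr // -lee_fin; apply: le_trans (ltW hsup).
  by apply: ereal_sup_ubound; exists rho => //; exact: hV.
have e1 : 1 <= expR (B + rho `^ theta1).
  by rewrite -expR0 ler_expR addr_ge0 ?(ltW B0) // powR_ge0.
(* For [M] at most 1 the outer logarithm in [hM] has a nonpositive argument and carries no
   information, but then the bound is immediate. *)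
case: (leP M 1) => hM1; first exact: le_trans e1.
have lM : 0 < ln M by rewrite ln_gt0.
rewrite -[leLHS]lnK ?posrE; last by apply: lt_trans hM1.
rewrite ler_expR; apply: (@le_trans _ _ (rho `^ theta1)); last by rewrite lerDr ltW.
by rewrite /powR gt_eqF // -[leLHS]lnK ?posrE // ler_expR.
Qed.

End EllipseGrowth.

(** * The limiting inequalities between real numbers *)

Section RealEstimates.
Variable R : realType.

(** To be read with [y] the iterated logarithm of [u * v]: then [expR y] is [L] and [expR (tau * y)]
    is its power [tau]. *)
Lemma exp_dominates (c tau : R) : 0 < tau -> tau < 1 -> exists y0 : R, forall y, y0 <= y ->
  [/\ c * y <= expR y, c * expR (tau * y) <= expR y & c <= y].
Proof.
move=> t0 t1; exists (2 * `|c| + `|c| / (1 - tau)) => y hy.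
have c0 := normr_ge0 c; have cc := ler_norm c.
have k0 : 0 < 1 - tau by lra.
have q0 : 0 <= `|c| / (1 - tau) by rewrite divr_ge0 // ltW.
have y0 : 0 <= y by lra.
split.
- apply: (@le_trans _ _ (1 + y ^+ 2 / 2)).
    have h1 : (2 * `|c| - y) * y <= 0 by apply: mulr_le0_ge0 => //; lra.
    have h2 : c * y <= `|c| * y by apply: ler_wpM2r.
    by move: h1 h2; rewrite expr2; lra.
  have := @expR_ge1Dxn R y 1 y0.
  by rewrite (_ : 2`!%:R = 2).
- have -> : expR y = expR ((1 - tau) * y) * expR (tau * y) by rewrite -expRD; congr expR; ring.
  rewrite ler_pM2r ?expR_gt0 //; apply: le_trans (expR_ge1Dx _).
  have : `|c| / (1 - tau) <= y by lra.
  by rewrite ler_pdivrMr //; lra.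
- by lra.
Qed.

(** After division by [2 * n], the monomial sizes cost [P / 3] with [P = d * L], while the weights
    yield at least [(1 + h) * P / 3]. The errors take at most [h / 24], [h / 24], [h / 12] and
    [h / 24] of [P], less than the [h / 3] available. Here [eta] is the constant part of the bound
    on [lK]. *)
Lemma main_estimate (d n L y nu th lam sg psi_ eta h e1 q Kc lK l128 l8 lk n1 lx lf l2 : R) :
  0 < th -> 0 < lam -> 0 < nu -> 0 < sg -> 0 < psi_ -> 0 < h -> 0 <= Kc -> 0 < y -> 0 < L ->
  1 <= d -> d ^+ 2 / 2 <= n -> d <= n -> n <= 3 * d ^+ 2 -> n1 <= 2 * n -> l2 <= 2 ->
  d * y = nu * L * (1 + e1) -> `|e1| <= 1 / 2 ->
  1 + h <= 3 * psi_ * nu / (2 * lam * th) * sg * (1 + e1) ->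
  q = sg / th * y -> l8 <= 8 * n -> lk <= 0 ->
  lK <= eta + 2 * d ->
  144 * nu / h <= y ->
  2 * eta + 4 + l128 + 8 - lk <= h / 24 * L -> 0 <= 2 * eta + 4 -> 0 <= l128 ->
  (2 + Kc) * q <= h / 24 * L -> lx <= h / 8 * L -> lf <= h / 8 * L ->
  n ^+ 2 * l2 + 4 * n * lK + 2 * n * l128 + 2 * (l8 - d * lk + n1 * q)
    + 2 / 3 * (n * d * (L + lx + lf)) <= 2 * (n ^+ 2 * psi_ / lam - Kc * n) * q.
Proof.
move=> th0 lam0 nu0 sg0 psi0 h0 Kc0 y0 L0 d1 dn2 dn n3d n1n l22 dy e1h hK hq l8n lk0 hlK hy hC he hl128 hKc hlx hlf.
have n0 : 0 < n by lra.
have q0 : 0 < q by rewrite hq mulr_gt0 // divr_gt0.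
set P := d * L.
have P0 : 0 < P by rewrite mulr_gt0 //; lra.
have LP : L <= P by rewrite /P ler_peMl // ltW.
have hP : h / 24 * L <= h / 24 * P by rewrite ler_pM2l // divr_gt0.
have t1 : n * l2 / 2 <= h / 24 * P.
  apply: (@le_trans _ _ (3 * d ^+ 2)); first by nra.
  have hdy : d * y <= 3 / 2 * nu * L.
    rewrite dy; have : 1 + e1 <= 3 / 2 by move: e1h; rewrite ler_norml; lra.
    have : 0 < nu * L by rewrite mulr_gt0.
    by nra.
  have h1 : 144 * nu <= h * y by rewrite [h * y]mulrC -ler_pdivrMr.
  have h2 : d * (144 * nu) <= h * (3 / 2 * nu * L).
    apply: (@le_trans _ _ (h * (d * y))); first by rewrite [leRHS]mulrCA ler_wpM2l //; lra.
    by rewrite ler_pM2l.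
  have h3 : 96 * d <= h * L.
    by rewrite -(ler_pM2l nu0); move: h2; lra.
  rewrite /P expr2; have : d * (96 * d) <= d * (h * L) by rewrite ler_wpM2l //; lra.
  have : 0 < d * (h * L) by rewrite mulr_gt0 ?mulr_gt0 //; lra.
  by lra.
have t2 : 2 * lK + l128 + 8 - lk <= h / 24 * P.
  apply: (@le_trans _ _ (d * (2 * eta + 4 + l128 + 8 - lk))).
    by nra.
  by rewrite /P [leRHS]mulrCA; apply: ler_wpM2l => //; lra.
have t3 : d / 3 * (lx + lf) <= h / 12 * P.
  have -> : h / 12 * P = d / 3 * (h / 8 * L + h / 8 * L) by rewrite /P; field.
  by apply: ler_wpM2l; [lra|exact: lerD].
have t4 : (1 + h) * P / 3 <= n * psi_ / lam * q.
  have E : 3 * psi_ * nu / (2 * lam * th) * sg * (1 + e1) * P / 3 = d ^+ 2 / 2 * psi_ / lam * q.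
    have -> : 3 * psi_ * nu / (2 * lam * th) * sg * (1 + e1) * P / 3 =
        d * (nu * L * (1 + e1)) * (psi_ / lam * sg / th / 2).
      by rewrite /P; field; rewrite !lt0r_neq0.
    by rewrite -dy hq; field; rewrite !lt0r_neq0.
  apply: (@le_trans _ _ (d ^+ 2 / 2 * psi_ / lam * q)).
    rewrite -E ler_pM2r ?invr_gt0 // ler_pM2r //.
  have k0 : 0 < psi_ / lam * q by rewrite mulr_gt0 // divr_gt0.
  have E3 (x : R) : x * psi_ / lam * q = x * (psi_ / lam * q) by rewrite !mulrA.
  by rewrite !E3 ler_pM2r.
have key : n * l2 / 2 + 2 * lK + l128 + (8 - lk + 2 * q) + d / 3 * (L + lx + lf) + Kc * q
   <= n * psi_ / lam * q.
  apply: le_trans t4.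
  have -> : d / 3 * (L + lx + lf) = P / 3 + d / 3 * (lx + lf) by rewrite /P; ring.
  have : h / 24 * L <= h / 24 * P by [].
  have : 0 < h * P by rewrite mulr_gt0.
  by move: t1 t2 t3 hKc; lra.
have k8 : l8 - d * lk + n1 * q <= n * (8 - lk + 2 * q).
  have : n1 * q <= 2 * n * q by rewrite ler_pM2r.
  have : - (d * lk) <= - (n * lk) by rewrite lerN2; nra.
  by move: l8n; lra.
have := ler_wpM2l (ltW n0) key.
have -> : 2 * (n ^+ 2 * psi_ / lam - Kc * n) * q = 2 * (n * (n * psi_ / lam * q)) - 2 * (n * (Kc * q)) by ring.
by move: k8; lra.
Qed.

(** The right-hand side is of order at least [d * L] and reaches [5 * L] by the lower bound on [d],
    while the left-hand side is at most [4 * L]. This secures the smallness condition on the input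
    of the algorithm. *)
Lemma decay_estimate (d n L y nu th lam sg e1 q lf l128 : R) :
  0 < th -> 0 < lam -> 0 < nu -> 0 < sg -> 0 < y -> 0 < L -> 0 < d -> d ^+ 2 / 2 <= n ->
  d * y = nu * L * (1 + e1) -> `|e1| <= 1 / 2 -> q = sg / th * y ->
  20 * th * lam / (nu * sg) <= d -> q <= L -> lf <= L -> l128 <= L ->
  l128 + q + L + lf < n / lam * q.
Proof.
move=> th0 lam0 nu0 sg0 y0 L0 d0 dn dy e1h hq hd qL fL lL.
have q0 : 0 < q by rewrite hq mulr_gt0 // divr_gt0.
have e12 : 1 / 2 <= 1 + e1 by move: e1h; rewrite ler_norml; lra.
apply: (@lt_le_trans _ _ (5 * L)); first by lra.
apply: (@le_trans _ _ (d ^+ 2 / 2 / lam * q)); last first.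
  by rewrite ler_pM2r // ler_pM2r // invr_gt0.
have -> : d ^+ 2 / 2 / lam * q = d * (d * y) * (sg / (2 * th * lam)).
  by rewrite hq; field; rewrite !lt0r_neq0.
have k0 : 0 < sg / (2 * th * lam) by rewrite divr_gt0 // !mulr_gt0.
apply: (@le_trans _ _ (d * (nu * L / 2) * (sg / (2 * th * lam)))); last first.
  rewrite ler_pM2r // ler_pM2l // dy ler_pM2l ?mulr_gt0 //; lra.
have -> : d * (nu * L / 2) * (sg / (2 * th * lam)) = d / (4 * th * lam / (nu * sg)) * L.
  by field; rewrite !lt0r_neq0.
rewrite ler_pM2r // ler_pdivlMr; last by rewrite divr_gt0 // !mulr_gt0.
by move: hd; rewrite -[20 * th * lam]mulrA -(_ : 5 * (4 * th * lam / (nu * sg)) = 20 * (th * lam) / (nu * sg)) //; ring.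
Qed.

(** The first term is the logarithm of [rho2], the second that of [b2 - a2]. In modulus both are
    close to [nu ^+ 2 * L ^+ 2 / (2 * th * lam * y)], the first with the extra factor [sg]; the gap
    [8 * eta] absorbs [e1], [e2] and the excess of [2 * n] over [d ^+ 2]. *)
Lemma ellipse2_estimate (d n L y nu th lam sg eta e1 e2 q : R) :
  0 < th -> 0 < lam -> 0 < nu -> 0 < sg -> 0 < y -> 0 < L -> 1 <= d -> 0 < eta ->
  2 * n = (d + 1) * (d + 2) -> 5 / eta <= d -> eta <= 1 / 2 -> sg + 8 * eta <= 1 ->
  d * y = nu * L * (1 + e1) -> `|e1| <= eta -> `|e2| <= eta -> q = sg / th * y ->
  n / lam * q + - (nu ^+ 2 / (2 * th * lam) * (L / y) * (1 + e2)) * L <= 0.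
Proof.
move=> th0 lam0 nu0 sg0 y0 L0 d1 eta0 hn hd eta1 hs dy; rewrite !ler_norml => he1 he2 hq.
have d5 : 5 <= eta * d by rewrite mulrC -ler_pdivrMr.
have n2 : 2 * n <= d ^+ 2 * (1 + eta) by rewrite hn; nra.
have e3 : sg * ((1 + eta) * (1 + e1) ^+ 2) <= 1 + e2.
  have s1 : sg <= 1 by lra.
  have x1 : (1 + e1) ^+ 2 <= 1 + 3 * eta by nra.
  have x2 : (1 + eta) * (1 + e1) ^+ 2 <= 1 + 7 * eta.
    by apply: (@le_trans _ _ ((1 + eta) * (1 + 3 * eta))); [apply: ler_wpM2l => //; lra|nra].
  apply: (@le_trans _ _ (sg * (1 + 7 * eta))); first by rewrite ler_pM2l.
  by nra.
rewrite mulNr subr_le0.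
have k0 : 0 < nu ^+ 2 * L ^+ 2 / (2 * th * lam * y).
  by rewrite divr_gt0 ?mulr_gt0 // exprn_gt0.
have -> : nu ^+ 2 / (2 * th * lam) * (L / y) * (1 + e2) * L = nu ^+ 2 * L ^+ 2 / (2 * th * lam * y) * (1 + e2).
  by field; rewrite !lt0r_neq0.
apply: (@le_trans _ _ (nu ^+ 2 * L ^+ 2 / (2 * th * lam * y) * (sg * ((1 + eta) * (1 + e1) ^+ 2)))); last first.
  by rewrite ler_pM2l.
have -> : nu ^+ 2 * L ^+ 2 / (2 * th * lam * y) * (sg * ((1 + eta) * (1 + e1) ^+ 2)) =
   (d ^+ 2 * (1 + eta)) * (sg * y / (2 * th * lam)).
  have -> : d = nu * L * (1 + e1) / y by rewrite -dy mulfK // lt0r_neq0.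
  by field; rewrite !lt0r_neq0.
have -> : n / lam * q = 2 * n * (sg * y / (2 * th * lam)) by rewrite hq; field; rewrite !lt0r_neq0.
by rewrite ler_pM2r // divr_gt0 ?mulr_gt0.
Qed.

End RealEstimates.

(** * The dimensions of the interpolation grid *)

Section MethodDimensions.
Variable R : realType.

(** The two square roots have product [2 * n] and the second is at most [2 * lambda], so rounding
    the first one down still leaves at least [n] grid points. *)
Lemma method_dims (lambda : R) (n : nat) : 1 <= lambda -> 3 * lambda <= n%:R ->
  let gamma := n%:R / lambda in
  let N1 := `|Num.floor (Num.sqrt (2 * gamma * n%:R))|%N in
  let N2 := `|Num.ceil (Num.sqrt (2 * n%:R / gamma))|%N in
  [/\ Num.sqrt (2 * gamma * n%:R) - 1 <= N1%:R, Num.sqrt (2 * n%:R / gamma) <= N2%:R,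
      N1%:R <= 2 * n%:R :> R & N2%:R <= 2 * lambda + 1 :> R] /\
  [/\ (2 <= N1)%N, (2 <= N2)%N, (n <= N1 * N2)%N, n%:R / lambda - 1 <= N1%:R :> R
    & n%:R / lambda <= gamma * N2%:R].
Proof.
move=> l1 hn gamma N1 N2.
have l0 : 0 < lambda by apply: lt_le_trans l1.
have n0 : 0 < n%:R :> R by apply: lt_le_trans hn; rewrite mulr_gt0.
have g0 : 0 < gamma by rewrite divr_gt0.
set A := Num.sqrt (2 * gamma * n%:R) in N1 *; set B := Num.sqrt (2 * n%:R / gamma) in N2 *.
have A0 : 0 <= A by exact: sqrtr_ge0.
have B0 : 0 <= B by exact: sqrtr_ge0.
have A2 : A ^+ 2 = 2 * n%:R ^+ 2 / lambda.
  by rewrite sqr_sqrtr; [rewrite /gamma; field; rewrite lt0r_neq0|by rewrite mulr_ge0 // mulr_ge0 // ltW].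
have B2 : B ^+ 2 = 2 * lambda.
  by rewrite sqr_sqrtr; [rewrite /gamma; field; rewrite !lt0r_neq0|apply: divr_ge0; [exact: mulr_ge0|exact: ltW]].
have AB : A * B = 2 * n%:R.
  have p : 0 <= 2 * gamma * n%:R by rewrite mulr_ge0 // mulr_ge0 // ltW.
  rewrite -sqrtrM //.
  have -> : 2 * gamma * n%:R * (2 * n%:R / gamma) = (2 * n%:R) ^+ 2 by field; rewrite lt0r_neq0.
  by rewrite sqrtr_sqr ger0_norm // mulr_ge0.
have A1 : n%:R / lambda <= A.
  rewrite -(@ler_pXn2r _ 2) ?nnegrE // ?(ltW g0) // A2.
  have i1 : lambda^-1 <= 1 by rewrite invf_le1.
  have i0 : 0 < lambda^-1 by rewrite invr_gt0.
  have -> : (n%:R / lambda) ^+ 2 = n%:R ^+ 2 / lambda * lambda^-1 by rewrite expr_div_n; field; rewrite lt0r_neq0.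
  have -> : 2 * n%:R ^+ 2 / lambda = n%:R ^+ 2 / lambda * 2 by ring.
  have : 0 < n%:R ^+ 2 / lambda by rewrite divr_gt0 // exprn_gt0.
  by move=> h; rewrite ler_pM2l //; lra.
have A3 : A <= 2 * n%:R.
  rewrite -(@ler_pXn2r _ 2) ?nnegrE // ?mulr_ge0 // A2 ler_pdivrMr //.
  have : 0 < n%:R ^+ 2 :> R by rewrite exprn_gt0.
  by nra.
have Bg : 1 < B.
  rewrite ltNge; apply/negP => h; have : B ^+ 2 <= 1 by nra.
  by rewrite B2; lra.
have Bl : B <= 2 * lambda.
  rewrite -(@ler_pXn2r _ 2) ?nnegrE // ?mulr_ge0 // ?(ltW l0) // B2.
  by nra.
have N1E : N1%:R = (Num.floor A)%:~R :> R.
  by rewrite natr_absz ger0_norm // floor_ge0.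
have cB0 : 0 <= Num.ceil B by rewrite ceil_ge0; lra.
have N2E : N2%:R = (Num.ceil B)%:~R :> R by rewrite natr_absz ger0_norm.
have f1 := floor_le A; have f2 := floorD1_gt A.
have c1 := ceil_ge B; have c2 := ceilB1_lt B.
rewrite -N1E in f1 f2; rewrite rmorphD /= rmorph1 -N1E in f2.
rewrite -N2E in c1; rewrite rmorphB /= rmorph1 -N2E in c2.
have n3 : 3 <= n%:R / lambda by rewrite ler_pdivlMr.
have gN : n%:R / lambda <= gamma * N2%:R by rewrite -[leLHS]mulr1 -/gamma ler_pM2l //; move: Bg c1; lra.
have g3 : n%:R / lambda - 1 <= N1%:R by move: A1 f2; rewrite -/gamma; lra.
have AN : n%:R <= N1%:R * N2%:R :> R.
  have h1 : (A - 1) * B <= N1%:R * N2%:R by apply: ler_pM => //; move: A1 n3 f2 Bg; rewrite -/gamma; lra.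
  by move: h1; rewrite mulrBl AB; move: Bl hn; lra.
split; split=> //.
- by move: f2; lra.
- by move: f1 A3; lra.
- by move: c2 Bl; lra.
- by rewrite -(ler_nat R); move: A1 n3 f2; rewrite -/gamma; lra.
- by rewrite -(ltr_nat R); move: Bg c1; lra.
- by rewrite -(ler_nat R) natrM.
Qed.

Lemma nb_monomials_bounds (d : nat) : (0 < d)%N ->
  [/\ 2 * (nb_monomials d)%:R = (d%:R + 1) * (d%:R + 2) :> R,
      d%:R ^+ 2 / 2 <= (nb_monomials d)%:R :> R, d%:R <= (nb_monomials d)%:R :> R,
      (nb_monomials d)%:R <= 3 * d%:R ^+ 2 :> R & (2 <= nb_monomials d)%N].
Proof.
move=> d0; have E : 2 * (nb_monomials d)%:R = (d%:R + 1) * (d%:R + 2) :> R.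
  by rewrite -(natrM _ 2) nb_monomialsE natrM -!natr1; ring.
have d1 : 1 <= d%:R :> R by rewrite ler1n.
split=> //; [by nra|by nra|by nra|].
by rewrite -(ler_nat R); nra.
Qed.

End MethodDimensions.

(** * The choice of the parameters *)

Section Instance.
Variables (R : realType) (f : R[i] -> R[i]).
Local Notation C := R[i].
Local Notation nc := (@Normc.normc R).
Local Arguments Normc.normc : simpl never.

Lemma max_norm_le (E : set C) (g : C -> C) (z : C) (B : R) : E z ->
  (forall w, E w -> nc (g w) <= B) -> max_norm E g <= B.
Proof.
move=> Ez h; apply: ge_sup; first by exists (nc (g z)); exists z.
by move=> _ [w hw <-]; exact: h.
Qed.

Lemma max_norm_add_le (E E' : set C) (z t : C) (B : R) : E z -> E' t ->
  (forall w s, E w -> E' s -> nc (f w + s) <= B) -> max_norm_add E E' f <= B.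
Proof.
move=> Ez Et h; apply: ge_sup; first by exists (nc (f z + t)); exists z => //; exists t.
by move=> _ [w hw [s hs <-]]; exact: h.
Qed.

Lemma expRXn (x : R) n : expR x ^+ n = expR (n%:R * x).
Proof. by rewrite expRM_natl. Qed.

Variables (theta lambda nu sg eta h a1 b1 B kap Kc C1 : R) (p p' : C).
Hypotheses (hf : entire f) (hr : real_on_reals f) (ab1 : a1 < b1) (l1 : 1 <= lambda)
  (th0 : 0 < theta) (nu0 : 0 < nu) (sg0 : 0 < sg) (eta0 : 0 < eta) (h0 : 0 < h)
  (eta2 : eta <= 1 / 2) (sg_eta : sg + 8 * eta <= 1)
  (h_eta : 1 + h <= 3 * psi lambda * nu / (2 * lambda * theta) * sg * (1 - eta))
  (B0 : 0 <= B) (kap0 : 0 < kap) (kap1 : kap <= 1) (kap_lt : 2 * kap <= nc (f p - f p'))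
  (C1E : C1 = (b1 - a1) + (`|a1| + `|b1|) + 1) (Kc0 : 0 <= Kc)
  (hKc : forall (N N1 N2 : nat) (gamma : R), (0 < N)%N -> gamma = N%:R / lambda ->
    Num.sqrt (2 * gamma * N%:R) - 1 <= N1%:R -> Num.sqrt (2 * N%:R / gamma) <= N2%:R ->
    forall g : 'I_N -> 'I_(N1 * N2 + N), injective g ->
    N%:R ^+ 2 * psi lambda / lambda - Kc * N%:R
      <= \sum_i column_weight N1 N2 N gamma 0 (g i)).

Variables (u v d : nat) (a2 b2 e1 e2 L y q G : R).
Hypotheses (u0 : (0 < u)%N) (v0 : (0 < v)%N) (d0 : (0 < d)%N) (ab2 : a2 < b2)
  (a2B : `|a2| <= B) (b2B : `|b2| <= B) (LE : (u * v)%:R = expR L)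
  (y0 : 0 < y) (L0 : 0 < L) (dE : d%:R * y = nu * L * (1 + e1))
  (bE : b2 - a2 = expR (- (nu ^+ 2 / (2 * theta * lambda) * (L / y) * (1 + e2)) * L))
  (e1_eta : `|e1| <= eta) (e2_eta : `|e2| <= eta)
  (qE : q = sg / theta * y) (q2 : 2 <= expR q)
  (Ep : ellipse_region (expR q) a1 b1 p) (Ep' : ellipse_region (expR q) a1 b1 p')
  (Eone : ellipse_region (expR q) a1 b1 1)
  (G0 : 0 <= G) (fG : forall z, nc z <= C1 * expR q -> nc (f z) <= expR G).

(** [lf] and [lx] bound the logarithms of [F] and of the modulus on the first ellipse; [c3] is the
    constant part in the bound on the logarithm of [16 * K]. *)
Let lf := G + (2 * B + 2).
Let lx := ln C1 + q.
Let c3 := ln (48 * (4 * lambda + 3)).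

Hypotheses (d_l : 3 * lambda <= d%:R) (d_sg : 20 * theta * lambda / (nu * sg) <= d%:R)
  (d_eta : 5 / eta <= d%:R) (qL : q <= L) (lfL : lf <= L) (l128L : ln 128 <= L)
  (nu_y : 144 * nu / h <= y)
  (cL : 2 * c3 + 4 + ln 128 + 8 - ln kap <= h / 24 * L) (KcL : (2 + Kc) * q <= h / 24 * L)
  (lxL : lx <= h / 8 * L) (lfL8 : lf <= h / 8 * L).

Local Notation I := (method_input lambda a1 b1 a2 b2 d u v (expR q)).
Local Notation N := (nb_monomials d).
Local Notation gamma := (N%:R / lambda).
Local Notation E1 := (in_E1 I).
Local Notation E2 := (in_E2 I).
Local Notation F := (max_norm_add E1 E2 f).

Let l0 : 0 < lambda. Proof. exact: lt_le_trans l1. Qed.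
Let q0 : 0 < q. Proof. by rewrite qE mulr_gt0 // divr_gt0. Qed.

Let rho1_ge1 : 1 <= expR q. Proof. by apply: le_trans q2; rewrite ler1n. Qed.

Let nbd := @nb_monomials_bounds R d d0.
Let N3 : 3 * lambda <= N%:R :> R.
Proof. by case: nbd => _ _ h1 _ _; apply: le_trans h1. Qed.

Let dims := method_dims l1 N3.

Let rho2E : in_rho2 I = expR (gamma * q).
Proof. by rewrite /= /powR ifF ?expRK // gt_eqF ?expR_gt0. Qed.

Let rho2_ge2 : 2 <= in_rho2 I.
Proof.
rewrite rho2E; apply: le_trans q2 _; rewrite ler_expR ler_peMl ?(ltW q0) //.
by rewrite ler_pdivlMr // mul1r; apply: le_trans N3; rewrite ler_peMl ?(ltW l0) // ler1n.
Qed.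

Let rho2_ge1 : 1 <= in_rho2 I. Proof. by apply: le_trans rho2_ge2; rewrite ler1n. Qed.

Let E1_le z : E1 z -> nc z <= C1 * expR q.
Proof.
move=> /(ellipse_disc ab1 rho1_ge1) hz; apply: le_trans hz _; rewrite /disc_of C1E.
rewrite [leRHS]mulrDl [X in _ <= X + _]mulrDl mul1r; apply: lerD => //.
by rewrite lerD2l ler_peMr // addr_ge0.
Qed.

(** By [ellipse2_estimate] the product of [b2 - a2] and [rho2] is at most 1, so the ellipse stays
    bounded however large [rho2] is. *)
Let E2_le t : E2 t -> nc t <= 2 * B + 2.
Proof.
move=> /(ellipse_disc ab2 rho2_ge1) ht; apply: le_trans ht _; rewrite /disc_of rho2E bE -expRD.
have : expR (- (nu ^+ 2 / (2 * theta * lambda) * (L / y) * (1 + e2)) * L + gamma * q) <= 1.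
  rewrite -[leRHS]expR0 ler_expR addrC; case: nbd => nE _ _ _ _.
  have d1 : 1 <= d%:R :> R by rewrite ler1n.
  exact: (ellipse2_estimate th0 l0 nu0 sg0 y0 L0 d1 eta0 nE d_eta eta2 sg_eta dE e1_eta e2_eta qE).
move=> h1; rewrite (_ : 2 * B + 2 = 1 + (B + B) + 1); last by ring.
by rewrite lerD2r; apply: lerD => //; exact: lerD.
Qed.

Let E1a : E1 a1%:C.
Proof. by apply: itv_ellipse; rewrite ?lexx ?(ltW ab1). Qed.

Let E2a : E2 a2%:C.
Proof. by apply: itv_ellipse; rewrite ?lexx ?(ltW ab2). Qed.

Let Fle z t : E1 z -> E2 t -> nc (f z + t) <= expR lf.
Proof.
move=> hz ht; apply: le_trans (le_normcD _ _) _.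
apply: (@le_trans _ _ (expR G + (2 * B + 2))).
  by apply: lerD; [exact/fG/E1_le|exact: E2_le].
rewrite /lf expRD; have h1 := expR_ge1Dx (2 * B + 2); have h2 : 1 <= expR G by rewrite -[leLHS]expR0 ler_expR.
by apply: le_trans (ler_wpM2l (expR_ge0 _) h1); rewrite mulrDr mulr1 lerD2l ler_peMl // addr_ge0 // mulr_ge0.
Qed.

Let F_ub : F <= expR lf. Proof. exact: max_norm_add_le E1a E2a Fle. Qed.

Let F_lb z t : E1 z -> E2 t -> nc (f z + t) <= F.
Proof.
move=> hz ht; apply: ub_le_sup; last by exists z => //; exists t.
by exists (expR lf) => _ [w hw [s hs <-]]; exact: Fle.
Qed.

Let F_ge0 : 0 <= F. Proof. exact: le_trans (nc_ge0 _) (F_lb E1a E2a). Qed.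

(** A common translation cannot make [f + t] small at both [p] and [p'], where the values of [f] are
    at least [2 * kap] apart. *)
Let kapF : kap <= F.
Proof.
have h1 := F_lb Ep E2a; have h2 := F_lb Ep' E2a.
have : nc (f p - f p') <= F + F.
  have -> : f p - f p' = (f p + a2%:C) - (f p' + a2%:C) by ring.
  by apply: le_trans (le_normcD _ _) _; rewrite normcN; exact: lerD.
by move=> h3; rewrite -(ler_pM2l (ltr0Sn R 1)) [2 * F]mulr_natl mulr2n; exact: le_trans h3.
Qed.

Let decay_le : decay I <= 2 * expR (q - gamma * q).
Proof.
have [_ [_ _ _ n1 n2]] := dims.
rewrite /decay rho2E [in_rho1 _]/= !expRXn -!expRN.
have h1 : - ((in_N1 I)%:R * q) <= q - gamma * q.
  have : (gamma - 1) * q <= (in_N1 I)%:R * q by rewrite ler_pM2r.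
  by rewrite -lerN2 mulrBl mul1r opprB.
have h2 : - ((in_N2 I)%:R * (gamma * q)) <= q - gamma * q.
  have : gamma * q <= gamma * (in_N2 I)%:R * q by rewrite ler_pM2r.
  rewrite -[gamma * _ * q]mulrA mulrCA => h2; by rewrite -[leLHS]add0r lerD ?(ltW q0) // lerN2.
by rewrite [leRHS]mulr_natl [leRHS]mulr2n lerD // ler_expR.
Qed.

Let small : 64 * decay I * v%:R * F < 1.
Proof.
have v1 : v%:R <= expR L.
  by rewrite -LE ler_nat leq_pmull.
have [_ dn _ _ _] := nbd.
have key : ln 128 + q + L + lf < gamma * q.
  have d1 : 0 < d%:R :> R by rewrite ltr0n.
  exact: (decay_estimate th0 l0 nu0 sg0 y0 L0 d1 dn dE (le_trans e1_eta eta2) qE d_sg qL lfL l128L).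
apply: (@le_lt_trans _ _ (expR (ln 128 + q + L + lf - gamma * q))); last first.
  by rewrite -[ltRHS]expR0 ltr_expR subr_lt0.
have -> : ln 128 + q + L + lf - gamma * q = ln 128 + (q - gamma * q) + L + lf :> R by ring.
rewrite (expRD (_ + L) lf) (expRD (_ + _) L) (expRD (ln _)) lnK ?posrE //.
have d0' : 0 <= decay I.
  by rewrite addr_ge0 // invr_ge0 exprn_ge0 ?expR_ge0 // (le_trans _ rho2_ge1).
apply: ler_pM => //; rewrite ?mulr_ge0 //.
apply: ler_pM => //; rewrite ?mulr_ge0 //.
by rewrite (_ : 128 = 64 * 2) -?[leRHS]mulrA ?ler_pM2l // -natrM.
Qed.

Let valid : alg2_valid f I.
Proof.
have [_ [n1 n2 n12 _ _]] := dims.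
split=> //; split=> //.
by move=> z _; exists 1 => [|w _]; [exact: ltr01|exact: hf].
Qed.

Lemma method_input_succeeds : alg2_succeeds f I.
Proof.
have [[n1 n2 n3 n4] [n5 n6 n7 n8 n9]] := dims.
have [nE dn2 dn n3d N2] := nbd.
have C10 : 0 < C1 by rewrite C1E addr_gt0 // ltr_wpDr ?subr_gt0 // addr_ge0.
have X1 : 1 <= max_norm E1 id.
  apply: le_trans (max_norm_ub valid Eone).
  by rewrite -(rmorph1 (real_complex R)) ncR normr1.
have XXb : max_norm E1 id <= C1 * expR q by exact: max_norm_le E1a E1_le.
apply: (alg2_success hf hr valid X1 XXb kap0 kap1 kapF F_ub N2 (gamma := gamma)
  (W := N%:R ^+ 2 * psi lambda / lambda - Kc * N%:R)) => //.
  by move=> g; apply: hKc => //; exact: ltnW.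
have uR : 0 < u%:R :> R by rewrite ltr0n.
have vR : 0 < v%:R :> R by rewrite ltr0n.
have d1 : 1 <= d%:R :> R by rewrite ler1n.
have NR : 0 < N%:R :> R by rewrite ltr0n ltnW.
rewrite -[in_u I]/u -[in_v I]/v -[in_rho1 I]/(expR q) !expRK.
have -> : ln u%:R + ln v%:R = L by rewrite -lnM ?posrE // -natrM LE expRK.
rewrite [ln (C1 * _)]lnM ?posrE ?expR_gt0 // expRK.
have psi0 := psi_gt0 l1.
have ln2 : ln 2 <= 2 :> R by apply/ltW/ln_sublinear.
have hK : 1 + h <= 3 * psi lambda * nu / (2 * lambda * theta) * sg * (1 + e1).
  apply: le_trans h_eta _; apply: ler_wpM2l.
    by apply/ltW/mulr_gt0 => //; apply: divr_gt0; rewrite mulr_gt0 // mulr_gt0.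
  by rewrite lerD2l; move: e1_eta; rewrite ler_norml => /andP[].
have l8 : ln (8 * N%:R) <= 8 * N%:R :> R by apply/ltW/ln_sublinear; rewrite mulr_gt0.
have lk : ln kap <= 0 by exact: ln_le0.
have c48 : 1 <= 48 * (4 * lambda + 3).
  apply: mulr_ege1; first by rewrite ler1n.
  by rewrite ler_wpDl ?mulr_ge0 ?(ltW l0) // ler1n.
have c30 : 0 <= c3 by exact: ln_ge0.
(* The number of columns is at most [(4 * lambda + 3) * N], and [N <= 3 * d ^+ 2], whence the 48;
   then [d ^+ 2 <= expR (2 * d)]. *)
have lK : ln (16 * (in_N I + in_N1 I * in_N2 I)%:R) <= c3 + 2 * d%:R.
  rewrite -ler_expR lnK; last by rewrite posrE mulr_gt0 // ltr0n addn_gt0 ltnW.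
  rewrite expRD lnK; last by rewrite posrE (lt_le_trans _ c48).
  have k1 : (in_N1 I * in_N2 I)%:R <= 2 * N%:R * (2 * lambda + 1) :> R.
    by rewrite natrM; apply: ler_pM.
  have k2 : d%:R ^+ 2 <= expR (2 * d%:R) :> R.
    rewrite expRM_natl; apply: lerXn2r; rewrite ?nnegrE ?expR_ge0 //.
    by apply: le_trans (expR_ge1Dx _); rewrite lerDr.
  apply: (@le_trans _ _ (48 * (4 * lambda + 3) * d%:R ^+ 2)); last first.
    by rewrite ler_pM2l // (lt_le_trans _ c48).
  apply: (@le_trans _ _ (16 * (4 * lambda + 3) * N%:R)).
    rewrite -[leRHS]mulrA ler_pM2l // natrD [leRHS](_ : _ = N%:R + 2 * N%:R * (2 * lambda + 1)); last by ring.
    by rewrite lerD2l.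
  rewrite [leRHS](_ : _ = 16 * (4 * lambda + 3) * (3 * d%:R ^+ 2)); last by ring.
  by rewrite ler_wpM2l // mulr_ge0 // addr_ge0 // mulr_ge0 // ltW.
have c34 : 0 <= 2 * c3 + 4 by rewrite addr_ge0 // mulr_ge0.
have l128 : 0 <= ln 128 :> R by rewrite ln_ge0 // ler1n.
exact: (main_estimate th0 l0 nu0 sg0 psi0 h0 Kc0 y0 L0 d1 dn2 dn n3d n3 ln2 dE
  (le_trans e1_eta eta2) hK qE l8 lk lK nu_y cL c34 l128 KcL lxL lfL8).
Qed.

End Instance.

(** * Uniform choice of the thresholds *)

Section Asymptotics.
Variables (R : realType) (f : R[i] -> R[i]).
Local Notation C := R[i].
Local Notation nc := (@Normc.normc R).
Local Arguments Normc.normc : simpl never.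

Lemma common_bound (s : seq R) : exists c, all (fun x => x <= c) s.
Proof.
exists (\sum_(x <- s) `|x|); apply/allP => x xs.
by rewrite (big_rem x) //=; apply: ler_wpDr; [exact: sumr_ge0|exact: ler_norm].
Qed.

(* [K > 1] is the hypothesis on [nu]; the room it leaves is divided between [sg], the
   loss on the exponent of [rho1], and [h], the loss allowed in the main inequality. *)
Lemma slack_constants (K : R) : 1 < K -> exists h sg eta, [/\ [/\ 0 < h, 0 < sg, sg < 1 & 0 < eta],
  eta <= 1 / 2, sg + 8 * eta <= 1 & 1 + h <= K * sg * (1 - eta)].
Proof.
move=> K1; have K0 : 0 < K by lra.
pose h := (K - 1) / 4; pose sg := (1 + K) / (2 * K).
have h0 : 0 < h by rewrite /h; lra.
have Ks : K * sg = 1 + 2 * h by rewrite /sg /h; field; rewrite lt0r_neq0.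
have sg0 : 0 < sg by rewrite divr_gt0 ?mulr_gt0 //; lra.
have sg1 : sg < 1 by rewrite ltr_pdivrMr ?mulr_gt0 //; lra.
have t0 : 0 < 1 + 2 * h by lra.
pose eta := Num.min (1 / 2) (Num.min (h / (1 + 2 * h)) ((1 - sg) / 8)).
have [m1 m2 m3] : [/\ eta <= 1 / 2, eta <= h / (1 + 2 * h) & eta <= (1 - sg) / 8].
  by split; rewrite !ge_min lexx ?orbT.
exists h, sg, eta; split=> //.
- split=> //; rewrite !lt_min divr_gt0 //= divr_gt0 //=; lra.
- by lra.
- by move: m2; rewrite ler_pdivlMr // Ks; lra.
Qed.

Lemma threshold_estimates (a0 cg M0 h Kc st lC c y L E : R) :
  0 < h -> 1 <= c -> 1 <= y -> 0 < E -> 0 <= lC -> c * y <= L -> c * E <= L ->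
  16 * a0 / h <= c -> 16 * cg / h <= c -> 2 * a0 <= c -> 2 * cg <= c -> 24 * M0 / h <= c ->
  (2 + Kc) * st * 24 / h <= c -> 8 * (lC + st) / h <= c ->
  [/\ a0 + cg * E <= L, a0 + cg * E <= h / 8 * L, M0 <= h / 24 * L,
      (2 + Kc) * (st * y) <= h / 24 * L & lC + st * y <= h / 8 * L].
Proof.
move=> h0 c1 y1 E0 lC0 cyL cEL; rewrite !ler_pdivrMr // => H1 H2 H3 H4 H5 H6 H7.
have y0 : 0 < y by lra.
have cL : c <= L by nra.
have hcL : c * h <= L * h by rewrite ler_pM2r.
have hEL : c * h * E <= L * h by rewrite mulrAC ler_pM2r.
have hyL : c * h * y <= L * h by rewrite mulrAC ler_pM2r.
split.
- by have : 2 * cg * E <= c * E by [rewrite ler_pM2r]; lra.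
- by have : 16 * cg * E <= c * h * E by [rewrite ler_pM2r]; lra.
- by lra.
- by have : (2 + Kc) * st * 24 * y <= c * h * y by [rewrite ler_pM2r]; lra.
- have : 8 * (lC + st) * y <= c * h * y by rewrite ler_pM2r.
  by have : lC <= lC * y by [rewrite ler_peMr]; lra.
Qed.

Lemma addends_le (x y z : R) : 1 <= x -> 1 <= y -> 1 <= z ->
  [/\ 2 <= 2 + x + y + z, x <= 2 + x + y + z, y <= 2 + x + y + z & z <= 2 + x + y + z].
Proof. by move=> *; split; lra. Qed.

(** [eta] and [y0] depend only on the fixed data and on [B], so for the theorem it remains to check
    that the conditions on [u], [v], [d], [a2], [b2], [e1] and [e2] hold eventually. *)
Lemma method_succeeds_eventually (theta a1 b1 lambda nu B : R) :
  0 < theta -> entire f -> transcendental f -> real_on_reals f -> order_le f theta ->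
  a1 < b1 -> 1 <= lambda -> 2 * lambda * theta / (3 * psi lambda) < nu -> 0 <= B ->
  exists2 eta, 0 < eta & exists y0, forall (u v d : nat) (a2 b2 e1 e2 : R),
    (0 < u)%N -> (0 < v)%N -> (0 < d)%N -> a2 < b2 -> `|a2| <= B -> `|b2| <= B ->
    let uv := (u * v)%:R : R in
    y0 <= ln (ln uv) -> `|e1| <= eta -> `|e2| <= eta ->
    d%:R = nu * (ln uv / ln (ln uv)) * (1 + e1) ->
    `|b2 - a2| = uv `^ (- (nu ^+ 2 / (2 * theta * lambda) * (ln uv / ln (ln uv)) * (1 + e2))) ->
    method_succeeds f lambda a1 b1 a2 b2 d u v.
Proof.
move=> th0 hf ht hr ho ab1 l1 hnu B0.
have l0 : 0 < lambda by exact: lt_le_trans l1.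
have psi0 := psi_gt0 l1.
have lt0 : 0 < 2 * lambda * theta by rewrite mulr_gt0 // mulr_gt0.
have ps0 : 0 < 3 * psi lambda by rewrite mulr_gt0.
have nu0 : 0 < nu by apply: lt_trans hnu; rewrite divr_gt0.
have K1 : 1 < 3 * psi lambda * nu / (2 * lambda * theta).
  by rewrite ltr_pdivlMr // mul1r [ltRHS]mulrC -ltr_pdivrMr.
have [h [sg [eta [[h0 sg0 sg1 eta0] eta2 sg_eta h_eta]]]] := slack_constants K1.
(* The midpoint [tau] of [sg] and 1 leaves room on both sides: [theta1 = theta * tau / sg] exceeds
   [theta], while [theta1 * sg / theta = tau] stays below 1. *)
pose theta1 := theta * ((1 + sg) / (2 * sg)); pose tau := (1 + sg) / 2.
have th10 : 0 <= theta1 by rewrite mulr_ge0 ?(ltW th0) // divr_ge0 ?mulr_ge0 ?addr_ge0 // ltW.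
have th1 : theta < theta1.
  by rewrite ltr_pMr // ltr_pdivlMr ?mulr_gt0 //; lra.
have tau0 : 0 < tau by rewrite divr_gt0 // addr_gt0.
have tau1 : tau < 1 by rewrite ltr_pdivrMr //; lra.
have [A A0 hA] := order_growth hf ho th1.
have [p [p' pp]] := transcendental_nonconstant ht.
have kp : 0 < nc (f p - f p') by rewrite nc_gt0 subr_eq0.
pose kap := Num.min 1 (nc (f p - f p') / 2).
have kap0 : 0 < kap by rewrite lt_min ltr01 divr_gt0.
have kap1 : kap <= 1 by rewrite ge_min lexx.
have kap_le : 2 * kap <= nc (f p - f p').
  by rewrite mulrC -ler_pdivlMr // ge_min lexx orbT.
have [rp rp1 hrp] := ellipse_contains p ab1.
have [rp' rp'1 hrp'] := ellipse_contains p' ab1.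
have [ro ro1 hro] := ellipse_contains 1 ab1.
have [Kc Kc0 hKc] := column_weight_ge l1.
pose C1 := (b1 - a1) + (`|a1| + `|b1|) + 1.
have C11 : 1 <= C1 by rewrite lerDr; apply: addr_ge0; [rewrite subr_ge0 ltW|exact: addr_ge0].
have C10 : 0 < C1 by exact: lt_le_trans C11.
pose D0 := 3 * lambda + 20 * theta * lambda / (nu * sg) + 5 / eta.
have D1 : 0 <= 3 * lambda by rewrite mulr_ge0 // ltW.
have D2 : 0 <= 20 * theta * lambda / (nu * sg) by rewrite divr_ge0 ?mulr_ge0 // ltW.
have D3 : 0 <= 5 / eta by rewrite divr_ge0 // ltW.
pose a0 := A + (2 * B + 2); pose cg := C1 `^ theta1.
pose c3 := ln (48 * (4 * lambda + 3)) : R.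
pose M0 := 2 * c3 + 4 + ln 128 + 8 - ln kap.
pose r0 := 2 + rp + rp' + ro.
(* One constant above all thresholds, so that the growth of [y] is invoked once. *)
have [c /and5P[c1 c2 c4 c5 /and5P[c6 c7 c8 c9 /and5P[c10 c11 c12 c13 /andP[c14 _]]]]] := common_bound
  [:: 1; 2 * D0 / nu; sg / theta; 16 * a0 / h; 16 * cg / h; 2 * a0; 2 * cg; ln 128;
      24 * M0 / h; (2 + Kc) * (sg / theta) * 24 / h; 8 * (ln C1 + sg / theta) / h;
      144 * nu / h; r0 / (sg / theta)].
have [y0 hy0] := exp_dominates c tau0 tau1.
exists eta => //; exists y0 => u v d a2 b2 e1 e2 u0 v0 d0 ab2 a2B b2B uv hy e1_eta e2_eta dE bE.
have [] := hy0 _ hy; set y := ln (ln uv) in hy dE bE *; set L := expR y; set E := expR (tau * y).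
move=> cyL cEL cy.
have y1 : 1 <= y by exact: le_trans cy.
have yp : 0 < y by exact: lt_le_trans y1.
have E0 : 0 < E by exact: expR_gt0.
have Ty x : x <= c -> x * y <= L by move=> hx; apply: le_trans cyL; rewrite ler_pM2r.
have TE x : x <= c -> x * E <= L by move=> hx; apply: le_trans cEL; rewrite ler_pM2r.
have T1 x : x <= c -> x <= L.
  by move=> hx; apply: le_trans hx _; apply: le_trans cyL; rewrite ler_peMr // (le_trans _ c1).
have uv0 : 0 < uv by rewrite ltr0n muln_gt0 u0.
(* If [ln uv] were nonpositive, [y] would take the conventional value 0, contrary to [yp]. *)
have luv0 : 0 < ln uv by rewrite ltNge; apply/negP => h'; move: yp; rewrite /y ln0 ?ltxx.
have Lln : ln uv = L by rewrite /L /y lnK.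
have uvE : uv = expR L by rewrite -Lln lnK.
have L0 : 0 < L by exact: expR_gt0.
pose q := sg / theta * y.
have st0 : 0 < sg / theta by rewrite divr_gt0.
have q_ge : r0 <= q by rewrite /q mulrC -ler_pdivrMr // (le_trans c14).
have rho_ge : r0 <= expR q.
  by apply: le_trans q_ge _; apply: le_trans (expR_ge1Dx _); rewrite lerDr.
have hd : D0 <= d%:R.
  have e12 : 1 / 2 <= 1 + e1 by move: (le_trans e1_eta eta2); rewrite ler_norml => /andP[+ _]; clear; lra.
  rewrite dE Lln; have := Ty _ c2; rewrite -ler_pdivlMr // ler_pdivrMr // => hL.
  apply: (@le_trans _ _ (2 * D0 * (1 / 2))); first by rewrite -mulrA mulrCA mul1r divff ?mulr1 ?pnatr_eq0.
  apply: ler_pM => //; first by rewrite mulr_ge0 // addr_ge0 // addr_ge0.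
  by rewrite [leRHS]mulrC.
have d_l : 3 * lambda <= d%:R.
  by apply: le_trans hd; rewrite /D0 -addrA lerDl addr_ge0.
have d_sg : 20 * theta * lambda / (nu * sg) <= d%:R.
  by apply: le_trans hd; rewrite /D0 addrAC lerDr addr_ge0.
have d_eta : 5 / eta <= d%:R.
  by apply: le_trans hd; rewrite /D0 lerDr addr_ge0.
have cg0 : 0 <= cg by exact: powR_ge0.
have G0 : 0 <= A + cg * E by rewrite addr_ge0 // mulr_ge0 // ltW.
exists (expR q).
have dyE : d%:R * y = nu * L * (1 + e1) by rewrite dE Lln; field; rewrite lt0r_neq0.
have bE' : b2 - a2 = expR (- (nu ^+ 2 / (2 * theta * lambda) * (L / y) * (1 + e2)) * L).
  by move: bE; rewrite gtr0_norm ?subr_gt0 // /powR gt_eqF // Lln.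
have [r2 rpr rp'r ror] := addends_le rp1 rp'1 ro1.
have q2 : 2 <= expR q by exact: le_trans rho_ge.
have Ep : ellipse_region (expR q) a1 b1 p by exact/hrp/(le_trans rpr).
have Ep' : ellipse_region (expR q) a1 b1 p' by exact/hrp'/(le_trans rp'r).
have Eo : ellipse_region (expR q) a1 b1 1 by exact/hro/(le_trans ror).
have fG z : nc z <= C1 * expR q -> nc (f z) <= expR (A + cg * E).
  move=> hz; apply: le_trans (hA z) _; rewrite ler_expR lerD2l.
  have -> : cg * E = (C1 * expR q) `^ theta1.
    rewrite powRM ?expR_ge0 ?(ltW C10) // /cg; congr (_ * _).
    rewrite /powR gt_eqF ?expR_gt0 // expRK /E; congr expR.
    by rewrite /tau /theta1 /q; field; rewrite !lt0r_neq0.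
  by apply: ge0_ler_powR => //; rewrite nnegrE ?nc_ge0 // mulr_ge0 ?expR_ge0 ?(ltW C10).
have qL : q <= L by exact: Ty.
have a00 : 0 <= a0 by rewrite addr_ge0 // addr_ge0 // mulr_ge0.
have lfE : A + cg * E + (2 * B + 2) = a0 + cg * E by rewrite /a0 addrAC.
have l128L : ln 128 <= L by exact: T1.
have nu_y : 144 * nu / h <= y by exact: le_trans cy.
have lC0 : 0 <= ln C1 by exact: ln_ge0.
have [lfL lfL8 cL KcL lxL] := threshold_estimates h0 c1 y1 E0 lC0 cyL cEL c5 c6 c7 c8 c10 c11 c12.
rewrite -lfE in lfL lfL8.
split; first exact: q2.
exact: (@method_input_succeeds R f theta lambda nu sg eta h a1 b1 B kap Kc C1 p p'
  hf hr ab1 l1 th0 nu0 sg0 eta0 h0 eta2 sg_eta h_eta B0 kap0 kap1 kap_le erefl Kc0 hKc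
  u v d a2 b2 e1 e2 L y q (A + cg * E) u0 v0 d0 ab2 a2B b2B uvE yp L0 dyE bE' e1_eta e2_eta
  erefl q2 Ep Ep' Eo G0 fG d_l d_sg d_eta qL lfL l128L nu_y cL KcL lxL lfL8).
Qed.

End Asymptotics.

Theorem theorem4p15 (R : realType) (theta : R) (f : R[i] -> R[i])
    (a1 b1 lambda nu : R)
    (u v d : nat -> nat) (a2 b2 e1 e2 : nat -> R) :
  0 < theta ->
  entire f -> transcendental f -> real_on_reals f -> order_le f theta ->
  a1 < b1 ->
  1 <= lambda ->
  2 * lambda * theta / (3 * psi lambda) < nu ->
  (forall n, (0 < u n)%N /\ (0 < v n)%N) ->
  (forall n, (0 < d n)%N) ->
  (forall n, a2 n < b2 n) ->
  (exists B : R, forall n, `|a2 n| <= B /\ `|b2 n| <= B) ->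
  let uv := fun n => (u n * v n)%:R : R in
  uv n @[n --> \oo] --> +oo ->
  e1 n @[n --> \oo] --> (0 : R) ->
  e2 n @[n --> \oo] --> (0 : R) ->
  (\forall n \near \oo,
     (d n)%:R = nu * (ln (uv n) / ln (ln (uv n))) * (1 + e1 n)) ->
  (\forall n \near \oo,
     `|b2 n - a2 n| =
     uv n `^ (- (nu ^+ 2 / (2 * theta * lambda)
                 * (ln (uv n) / ln (ln (uv n))) * (1 + e2 n)))) ->
  \forall n \near \oo,
    method_succeeds f lambda a1 b1 (a2 n) (b2 n) (d n) (u n) (v n).
Proof.
move=> th0 hf ht hr ho ab1 l1 hnu uv0 d0 ab2 [B hB] uv huv he1 he2 hd hb.
have B0 : 0 <= B by case: (hB 0%N) => h _; exact: le_trans h.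
have [eta eta0 [y0 H]] := method_succeeds_eventually th0 hf ht hr ho ab1 l1 hnu B0.
(* The threshold [expR (expR y0)] for [uv n] also keeps the arguments of both logarithms
   positive. *)
have hy : \forall n \near \oo, y0 <= ln (ln (uv n)).
  move/cvgryPge/(_ (expR (expR y0))): huv; apply: filterS => n hn.
  have p0 : 0 < uv n by apply: lt_le_trans hn; exact: expR_gt0.
  have h1 : expR y0 <= ln (uv n) by rewrite -ler_expR lnK.
  have p1 : 0 < ln (uv n) by apply: lt_le_trans h1; exact: expR_gt0.
  by rewrite -ler_expR lnK.
have h1 := cvgr0_norm_le _ he1 _ eta0; have h2 := cvgr0_norm_le _ he2 _ eta0.
near=> n; have [un vn] := uv0 n; have [an bn] := hB n.
apply: (H (u n) (v n) (d n) (a2 n) (b2 n) (e1 n) (e2 n)) => //; near: n.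
- exact: hy.
- exact: h1.
- exact: h2.
- exact: hd.
- exact: hb.
Unshelve. all: by end_near.
Qed.
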